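(* Let $\mathfrak g=sl_N$, let $V=V_1\otimes\cdots\otimes V_n$ be a tensor product of finite dimensional $sl_N$-modules, $\kappa\in\mathbb C\setminus\{0\}$, and let $v_1,\dots,v_d$ be a basis of a weight subspace $V[\nu]$. Suppose that $u_i(z_1,\dots,z_n,\lambda)=\sum_{j=1}^d u_{i,j}v_j$, $i=1,\dots,d$, is a set of $V[\nu]$-valued solutions of the combined system consisting of the trigonometric KZ equations $\nabla_j(\lambda,\kappa)u=0$, $j=1,\dots,n$, and the dynamical equations $$u(z_1,\dots,z_n,\lambda+\kappa\omega_i^\vee)=\prod_{k=1}^n z_k^{(\omega_i^\vee)^{(k)}}\,\mathbb B_{w_{[i]},V}(\lambda)\,u(z_1,\dots,z_n,\lambda),\qquad i=1,\dots,N-1.$$ Then $$\det(u_{i,j})_{1\le i,j\le d}=C_{V[\nu]}(\lambda)\,D_{V[\nu]}(z_1,\dots,z_n,\lambda),$$ where $C_{V[\nu]}(\lambda)$ is a function of $\lambda$ only (depending also on $V_1,\dots,V_n$ and $\nu$) such that $C_{V[\nu]}(\lambda+\kappa\omega)=C_{V[\nu]}(\lambda)$ for all $\omega\in P^\vee$, and $$D_{V[\nu]}(z_1,\dots,z_n,\lambda)=\prod_{k=1}^n z_k^{\frac{\Lambda_k(\lambda)}{\kappa}-\frac{\gamma_k}{2\kappa}}\prod_{1\le k<l\le n}(z_k-z_l)^{\frac{\epsilon_{k,l}}{\kappa}}\prod_{\alpha\in\Sigma_+}X_{\alpha,V[\nu]}(\lambda).$$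
   Context: $e_{i,j}$ are the standard generators of $gl_N$; $\mathfrak h\subset sl_N$ is the diagonal subalgebra; the invariant form $(e_{i,j},e_{k,l})=\delta_{i,l}\delta_{j,k}$ identifies $\mathfrak h$ with $\mathfrak h^*$. Roots $\alpha=e_{i,i}-e_{j,j}$, $i\ne j$; $\Sigma_+$: those with $i<j$; $\alpha^\vee=\alpha$; $H_\alpha=e_{i,i}-e_{j,j}$, $E_\alpha=e_\alpha=e_{i,j}$, $F_\alpha=e_{-\alpha}=e_{j,i}$. Simple roots $\alpha_i=e_{i,i}-e_{i+1,i+1}$ with simple reflections $s_i$; Weyl group $S^N$. Dual fundamental weights $\omega_i^\vee=\sum_{j\le i}(1-\frac iN)e_{j,j}-\sum_{j>i}\frac iN e_{j,j}$; $P^\vee=\oplus_i\mathbb Z\omega_i^\vee$. $w_{[i]}=w_0w_0^i$, with $w_0$ the longest element of $S^N$ and $w_0^i$ the longest element of the subgroup generated by $s_j$, $j\ne i$. KZ operators: with an orthonormal basis $x_i$ of $\mathfrak h$, $\Omega^0=\frac12\sum_i x_i\otimes x_i$, $\Omega^\pm=\Omega^0+\sum_{\alpha\in\Sigma_+}e_{\pm\alpha}\otimes e_{\mp\alpha}$, $\Omega=\Omega^++\Omega^-$, $r(z)=\frac{\Omega^+z+\Omega^-}{z-1}$, $\nabla_i(\lambda,\kappa)=\kappa z_i\frac{\partial}{\partial z_i}-\sum_{j\ne i}r(z_i/z_j)^{(i,j)}-\lambda^{(i)}$, superscripts indicating tensor factors. $p(t;H,E,F)=\sum_{k\ge0}F^kE^k\frac1{k!}\prod_{j=0}^{k-1}\frac1{t-H-j}$.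 For a root $\alpha$ and $v\in V[\mu]$: $\mathbb B_V^\alpha(\lambda)v=p((\lambda+\frac12\mu,\alpha^\vee)-1;H_\alpha,E_\alpha,F_\alpha)v$. For $w\in S^N$ with reduced presentation $w=s_{i_l}\cdots s_{i_1}$: $\alpha^1=\alpha_{i_1}$, $\alpha^j=s_{i_1}\cdots s_{i_{j-1}}(\alpha_{i_j})$, $\mathbb B_{w,V}(\lambda)=\mathbb B_V^{\alpha^l}(\lambda)\cdots\mathbb B_V^{\alpha^1}(\lambda)$ (independent of the presentation). $z_k^{\omega^{(k)}}$ multiplies a tensor whose $k$-th factor has weight $\mu_k$ by $z_k^{(\omega,\mu_k)}$. Data in $D_{V[\nu]}$: $\Lambda_k(\lambda)=\mathrm{tr}_{V[\nu]}\lambda^{(k)}$, $\epsilon_{k,l}=\mathrm{tr}_{V[\nu]}\Omega^{(k,l)}$, $\gamma_k=\sum_{l\ne k}\epsilon_{k,l}$. For $\alpha\in\Sigma_+$, let $V[\nu]_\alpha\subset V$ be the submodule generated by $V[\nu]$ for the $sl_2$-subalgebra spanned by $H_\alpha,E_\alpha,F_\alpha$, decomposed as $V[\nu]_\alpha=\oplus_{k\ge0}W_k^\alpha\otimes L_{\nu+k\alpha}$, where $L_{\nu+k\alpha}$ is the irreducible $sl_2$-module with highest weight $\nu+k\alpha$ and $W^\alpha_k$ the multiplicity space; $d_k^\alpha=\dim W_k^\alpha$; and, with $\Gamma$ the gamma function, $$X_{\alpha,V[\nu]}(\lambda)=\prod_{k\ge0}\left(\prod_{j=1}^k\frac{\Gamma\left(1-\frac{(\lambda-\frac12(\nu+j\alpha),\alpha)}{\kappa}\right)}{\Gamma\left(1-\frac{(\lambda+\frac12(\nu+j\alpha),\alpha)}{\kappa}\right)}\right)^{d_k^\alpha}.$$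 Solutions and powers are (multivalued) functions of $z$ with $z_k\ne0$, $z_k\ne z_l$, considered on a connected, simply connected domain in $z$ with fixed branches of $\log z_k$, $\log(z_k-z_l)$; identities hold where all terms are defined. *)

(* Defs.v *)
From HB Require Import structures.
From mathcomp Require Import all_boot all_order all_fingroup all_algebra.
From mathcomp Require Import complex.
From mathcomp Require Import all_classical all_reals all_analysis.
Import Order.TTheory GRing.Theory Num.Theory numFieldNormedType.Exports.

Set Implicit Arguments.
Unset Strict Implicit.
Unset Printing Implicit Defensive.

Local Open Scope classical_set_scope.
Local Open Scope ring_scope.
Local Open Scope complex_scope.

(* sl_N with N = r.+1, as traceless matrices; the r simple roots are indexed
   from 0.  The algebra is set up over an arbitrary C : numClosedFieldType. *)

Section Weyl.
Variable r : nat.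
Local Notation N := r.+1.

(* The root e_{i,i} - e_{j,j} is encoded by the pair (i, j), i != j. *)
Definition slroot : Type := ('I_N * 'I_N)%type.
Definition posroot (a : slroot) : bool := (a.1 < a.2)%N.

Definition simple_root (i : 'I_r) : slroot :=
  (widen_ord (leqnSn r) i, lift ord0 i).
Definition simple_refl (i : 'I_r) : 'S_N :=
  tperm (simple_root i).1 (simple_root i).2.
Definition root_act (w : 'S_N) (a : slroot) : slroot := (w a.1, w a.2).

(* Products of permutations in MathComp are read from left to right, so the
   word [:: i_1; ...; i_l] stands for the map s_{i_l} o ... o s_{i_1}. *)
Definition word_perm (s : seq 'I_r) : 'S_N := (\prod_(i <- s) simple_refl i)%g.

Lemma word_perm_ex (w : 'S_N) :
  exists l, [exists t : l.-tuple 'I_r, word_perm t == w].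
Proof.
pose S : {set 'S_N} := [set simple_refl i | i : 'I_r]%SET.
have SS i : simple_refl i \in <<S>>%g by apply: mem_gen; apply: imset_f.
have t0 (y : 'I_N) : tperm ord0 y \in <<S>>%g.
  case: y => m; elim: m => [|m IH] hm.
    by have -> : Ordinal hm = ord0 by [apply: val_inj]; rewrite tperm1 group1.
  have hm' : (m < r)%N by [].
  pose i := Ordinal hm'.
  have e2 : Ordinal hm = (simple_root i).2 by apply: val_inj.
  case: m IH hm hm' @i e2 => [|m] IH hm hm' i e2.
    have -> : tperm ord0 (Ordinal hm) = simple_refl i.
      by rewrite e2 /simple_refl; congr (tperm _ _); apply: val_inj.
    exact: SS.
  have e1 : Ordinal (ltnW hm) = (simple_root i).1 by apply: val_inj.
  have -> : tperm ord0 (Ordinal hm)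
          = (tperm ord0 (Ordinal (ltnW hm)) ^ simple_refl i)%g.
    rewrite tpermJ e1 /simple_refl tpermL -e2; congr (tperm _ _).
    by rewrite tpermD.
  by rewrite groupJ // IH.
have : w \in <<S>>%g.
  have : w \in [set: 'S_N]%SET by rewrite inE.
  rewrite -(gen_tperm ord0); apply/fintype.subsetP; rewrite gen_subG.
  by apply/fintype.subsetP => _ /imsetP[y _ ->].
move=> /gen_prodgP[l [c cS ->]]; exists l.
have /choice[f fE] : forall i : 'I_l, exists j, c i = simple_refl j.
  by move=> i; have /imsetP[j _ ->] := cS i; exists j.
apply/existsP; exists [tuple f i | i < l]; rewrite /word_perm big_tuple.
by apply/eqP/eq_bigr => i _; rewrite tnth_mktuple fE.
Qed.

Definition wlen (w : 'S_N) : nat := ex_minn (word_perm_ex w).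

Definition reduced_word (w : 'S_N) (s : seq 'I_r) : Prop :=
  word_perm s = w /\ size s = wlen w.

Definition longest (J : {set 'I_r}) : 'S_N :=
  [arg max_(w > 1%g in <<[set simple_refl j | j in J]%SET>>%g) wlen w].

(* w_{[i]} = w_0 o w_0^i. *)
Definition w_bracket (i : 'I_r) : 'S_N :=
  (longest [set~ i]%SET * longest [set: 'I_r]%SET)%g.

(* The roots alpha^1, ..., alpha^l of [:: i_1; ...; i_l], where
   alpha^j = s_{i_1} ... s_{i_(j-1)} (alpha_{i_j}). *)
Fixpoint word_roots (s : seq 'I_r) : seq slroot :=
  if s is i :: s' then
    simple_root i :: [seq root_act (simple_refl i) a | a <- word_roots s']
  else [::].

End Weyl.

Section SlN.
Variables (C : numClosedFieldType) (r : nat).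
Local Notation N := r.+1.
Local Notation slroot := (slroot r).

Definition gform (A B : 'M[C]_N) : C := \tr (A *m B).

Definition cartan (h : 'M[C]_N) : bool := is_diag_mx h && (\tr h == 0).

Definition orthonormal_basis (x : 'I_r -> 'M[C]_N) : Prop :=
  [/\ forall i, cartan (x i),
      forall i j, gform (x i) (x j) = (i == j)%:R
    & forall h, cartan h -> exists c : 'I_r -> C, h = \sum_i c i *: x i].

Definition rootH (a : slroot) : 'M[C]_N := delta_mx a.1 a.1 - delta_mx a.2 a.2.
Definition rootE (a : slroot) : 'M[C]_N := delta_mx a.1 a.2.
Definition rootF (a : slroot) : 'M[C]_N := delta_mx a.2 a.1.

Definition coweight (i : 'I_r) : 'M[C]_N :=
  \sum_(j < N | (j <= i)%N) (1 - i.+1%:R / N%:R) *: delta_mx j j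
  - \sum_(j < N | (i < j)%N) (i.+1%:R / N%:R) *: delta_mx j j.

Definition coweight_lattice (w : 'M[C]_N) : Prop :=
  exists c : 'I_r -> int, w = \sum_i (c i)%:~R *: coweight i.

(* Finite dimensional sl_N-modules in coordinates: A acts on column vectors by
   the matrix slact A; only the values on traceless A are meaningful. *)
Record slMod := SlMod {
  sldim : nat;
  slact : 'M[C]_N -> 'M[C]_sldim;
  slact_lin : forall (a : C) (A B : 'M[C]_N), \tr A = 0 -> \tr B = 0 ->
    slact (a *: A + B) = a *: slact A + slact B;
  slact_bracket : forall A B : 'M[C]_N, \tr A = 0 -> \tr B = 0 ->
    slact (A *m B - B *m A) = slact A *m slact B - slact B *m slact A
}.

Lemma tr_rootH (a : slroot) : \tr (rootH a) = 0.
Proof.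
have h (b : 'I_N) : \tr (delta_mx b b : 'M[C]_N) = 1.
  rewrite /mxtrace (bigD1 b) //= mxE !eqxx big1 ?addr0 // => i /negbTE ib.
  by rewrite mxE ib.
by rewrite /rootH raddfB /= !h subrr.
Qed.

Lemma rootH_cartan (a : slroot) : cartan (rootH a).
Proof.
rewrite /cartan tr_rootH eqxx andbT; apply/is_diag_mxP => i j ij.
have h (b : 'I_N) : (delta_mx b b : 'M[C]_N) i j = 0.
  rewrite mxE; case: (i =P b) => [ib|] //=; case: (j =P b) => [jb|] //.
  by move: ij; rewrite ib jb eqxx.
by rewrite /rootH mxE [X in _ + X]mxE !h subrr.
Qed.

Lemma cartanE (h : 'M[C]_N) : cartan h ->
  h = \sum_a h a a *: rootH (a, ord0).
Proof.
case/andP => /is_diag_mxP hd /eqP ht.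
have -> : \sum_a h a a *: rootH (a, ord0)
        = \sum_a h a a *: delta_mx a a - (\tr h) *: delta_mx ord0 ord0.
  rewrite /mxtrace scaler_suml -sumrB; apply: eq_bigr => a _.
  by rewrite /rootH scalerBr.
rewrite ht scale0r subr0; apply/matrixP => i j; rewrite summxE (bigD1 i) //=.
rewrite !mxE eqxx big1 => [|k ki]; last first.
  by rewrite !mxE eq_sym (negbTE ki) mulr0.
rewrite addr0; have [->|ij] := eqVneq j i; first by rewrite mulr1.
by rewrite mulr0 hd // eq_sym.
Qed.

End SlN.

Section Tensor.
Variables (C : numClosedFieldType) (r n : nat) (V : 'I_n -> slMod C r).
Local Notation N := r.+1.
Local Notation slroot := (slroot r).

(* V_1 (x) ... (x) V_n as functions on multi-indices: v is the tensor
   \sum_t v t *: (e_{t 1} (x) ... (x) e_{t n}). *)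
Definition tidx := {dffun forall k : 'I_n, 'I_(sldim (V k))}.
Definition tensor := {ffun tidx -> C^o}.

Definition tset (t : tidx) (k : 'I_n) (a : 'I_(sldim (V k))) : tidx :=
  [ffun j => dfwith t k a j].

Definition factor_op (k : 'I_n) (A : 'M[C]_(sldim (V k))) (v : tensor) :
    tensor :=
  [ffun t : tidx => \sum_a A (t k) a * v (tset t a)].

(* X^{(k)}, and the action of X on the tensor product. *)
Definition act_at (k : 'I_n) (X : 'M[C]_N) (v : tensor) : tensor :=
  factor_op (slact (V k) X) v.
Definition tact (X : 'M[C]_N) (v : tensor) : tensor := \sum_k act_at k X v.

(* V[nu]; see mem_wspace. *)
Definition wspace (nu : 'M[C]_N) : {vspace tensor} :=
  (\bigcap_(a : 'I_N * 'I_N) lker (linfun (fun v : tensor =>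
     tact (rootH C a) v - gform nu (rootH C a) *: v)))%VS.

Lemma factor_op_linear k A : linear (@factor_op k A).
Proof.
move=> c v w; apply/ffunP => t; rewrite !ffunE scaler_sumr -big_split /=.
by apply: eq_bigr => a _; rewrite !ffunE /GRing.scale /= mulrDr mulrCA.
Qed.

Lemma tact_linear X : linear (tact X).
Proof.
move=> c v w; rewrite /tact scaler_sumr -big_split /=.
by apply: eq_bigr => k _; rewrite /act_at factor_op_linear.
Qed.

Lemma tact_lin_l (c : C) (A B : 'M[C]_N) v : \tr A = 0 -> \tr B = 0 ->
  tact (c *: A + B) v = c *: tact A v + tact B v.
Proof.
move=> hA hB; rewrite /tact scaler_sumr -big_split /=; apply: eq_bigr => k _.
apply/ffunP => t; rewrite !ffunE slact_lin // scaler_sumr -big_split /=.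
by apply: eq_bigr => a _; rewrite !mxE /GRing.scale /= mulrDl mulrA.
Qed.

Lemma mem_wspace (nu : 'M[C]_N) (v : tensor) :
  v \in wspace nu <-> forall h, cartan h -> tact h v = gform nu h *: v.
Proof.
have inE a : (v \in lker (linfun (fun w : tensor => tact (rootH C a) w
    - gform nu (rootH C a) *: w))) = (tact (rootH C a) v
    == gform nu (rootH C a) *: v).
  pose f := fun w : tensor => tact (rootH C a) w - gform nu (rootH C a) *: w.
  have fl : linear f.
    move=> c u w; rewrite /f tact_linear !scalerDr !scalerA opprD addrACA.
    by rewrite mulrC scalerN scalerA.
  pose g : {linear tensor -> tensor} :=
    HB.pack f (GRing.isLinear.Build C tensor tensor _ f fl).
  by rewrite memv_ker -[RHS]subr_eq0; congr (_ == _); exact: (lfunE g v).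
split=> [|hv]; last first.
  rewrite memvE; apply/subv_bigcapP => a _; rewrite -memvE inE.
  by rewrite hv // rootH_cartan.
rewrite memvE => /subv_bigcapP hv h hc.
have {}hv a : tact (rootH C a) v = gform nu (rootH C a) *: v.
  by have := hv a isT; rewrite -memvE inE => /eqP.
have act0 : tact 0 v = 0.
  have := @tact_lin_l (-1) 0 0 v (mxtrace0 _ _) (mxtrace0 _ _).
  by rewrite scaler0 addr0 scaleN1r addNr.
rewrite (cartanE hc).
suff [] : tact (\sum_a h a a *: rootH C (a, ord0)) v
  = gform nu (\sum_a h a a *: rootH C (a, ord0)) *: v
  /\ \tr (\sum_a h a a *: rootH C (a, ord0)) = 0 by [].
apply: (big_ind (fun A => tact A v = gform nu A *: v /\ \tr A = 0)).
- by rewrite act0 /gform mulmx0 !mxtrace0 scale0r.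
- move=> A B [hA tA] [hB tB]; rewrite mxtraceD tA tB addr0; split=> //.
  by rewrite -[A]scale1r tact_lin_l // !scale1r hA hB /gform mulmxDr mxtraceD
             scalerDl.
- move=> a _; rewrite mxtraceZ tr_rootH mulr0; split=> //.
  rewrite -[_ *: rootH _ _]addr0 tact_lin_l ?tr_rootH ?mxtrace0 //.
  by rewrite act0 !addr0 hv scalerA /gform -scalemxAr mxtraceZ.
Qed.

(* tr_W f, for f preserving W. *)
Definition trace_on (W : {vspace tensor}) (f : tensor -> tensor) : C :=
  \sum_(i < \dim W) coord (vbasis W) i (f (vbasis W)`_i).

Section KZ.
Variable x : 'I_r -> 'M[C]_N.

(* The superscript (k, l): first leg on factor k, second leg on factor l. *)
Definition Omega0 (k l : 'I_n) (v : tensor) : tensor :=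
  2^-1 *: \sum_i act_at k (x i) (act_at l (x i) v).
Definition OmegaP (k l : 'I_n) (v : tensor) : tensor :=
  Omega0 k l v
  + \sum_(a : 'I_N * 'I_N | posroot a)
      act_at k (rootE C a) (act_at l (rootF C a) v).
Definition OmegaM (k l : 'I_n) (v : tensor) : tensor :=
  Omega0 k l v
  + \sum_(a : 'I_N * 'I_N | posroot a)
      act_at k (rootF C a) (act_at l (rootE C a) v).
Definition Omega (k l : 'I_n) (v : tensor) : tensor :=
  OmegaP k l v + OmegaM k l v.

Definition rmat (z : C) (k l : 'I_n) (v : tensor) : tensor :=
  (z - 1)^-1 *: (z *: OmegaP k l v + OmegaM k l v).

Definition upd (z : 'rV[C]_n) (k : 'I_n) (s : C) : 'rV[C]_n :=
  \row_j (if j == k then s else z 0 j).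

Definition zslice (f : 'rV[C]_n -> tensor) (z : 'rV[C]_n) (k : 'I_n)
  (t : tidx) : C -> C := fun s => f (upd z k s) t.

Definition zderivable (f : 'rV[C]_n -> tensor) (z : 'rV[C]_n) : Prop :=
  forall k t, derivable (zslice f z k t) (z 0 k) 1.

Definition zpartial (k : 'I_n) (f : 'rV[C]_n -> tensor) (z : 'rV[C]_n) :
    tensor :=
  [ffun t => 'D_1 (zslice f z k t) (z 0 k)].

Definition nabla (lam : 'M[C]_N) (kappa : C) (k : 'I_n)
    (f : 'rV[C]_n -> tensor) (z : 'rV[C]_n) : tensor :=
  (kappa * z 0 k) *: zpartial k f z
  - \sum_(l | l != k) rmat (z 0 k / z 0 l) k l (f z)
  - act_at k lam (f z).

Definition kz_solution (lam : 'M[C]_N) (kappa : C) (U : set 'rV[C]_n)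
    (f : 'rV[C]_n -> tensor) : Prop :=
  forall z, U z -> zderivable f z /\ forall k, nabla lam kappa k f z = 0.

End KZ.

(* p(t; H_a, E_a, F_a) v for v with H_a v = m *: v; E_a is nilpotent of index
   at most dim V. *)
Definition pfun (t m : C) (a : slroot) (v : tensor) : tensor :=
  \sum_(k < \dim {: tensor})
    ((k`!)%:R^-1 * \prod_(j < k) (t - m - j%:R)^-1)
      *: iter k (tact (rootF C a)) (iter k (tact (rootE C a)) v).

(* B_V^a(lam) on V[mu]. *)
Definition Bop (mu lam : 'M[C]_N) (a : slroot) (v : tensor) : tensor :=
  pfun (gform (lam + 2^-1 *: mu) (rootH C a) - 1) (gform mu (rootH C a)) a v.

(* No denominator of a nonzero term of B_V^a(lam) on V[mu] vanishes. *)
Definition Bop_defined (mu lam : 'M[C]_N) (a : slroot) : Prop :=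
  forall k j : nat, (j < k)%N ->
    (exists2 v, v \in wspace mu & iter k (tact (rootE C a)) v != 0) ->
    gform (lam + 2^-1 *: mu) (rootH C a) - 1 - gform mu (rootH C a) - j%:R != 0.

(* B_{w,V}(lam) on V[mu], for the reduced word s of w. *)
Definition Bword (mu lam : 'M[C]_N) (s : seq 'I_r) (v : tensor) : tensor :=
  foldl (fun v' a => Bop mu lam a v') v (word_roots s).

Definition Bword_defined (mu lam : 'M[C]_N) (s : seq 'I_r) : Prop :=
  forall a, a \in word_roots s -> Bop_defined mu lam a.

(* The decomposition of V[nu]_a under the sl_2-subalgebra of the root a. *)
Section Sl2.
Variables (nu : 'M[C]_N) (a : slroot).

Definition sl2_stable (L : {vspace tensor}) : Prop :=
  forall v, v \in L -> [/\ tact (rootH C a) v \in L, tact (rootE C a) v \in L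
                        & tact (rootF C a) v \in L].

Definition sl2_generated (W M : {vspace tensor}) : Prop :=
  [/\ (W <= M)%VS, sl2_stable M
    & forall M', sl2_stable M' -> (W <= M')%VS -> (M <= M')%VS].

Definition sl2_irreducible (c : C) (L : {vspace tensor}) : Prop :=
  [/\ sl2_stable L,
      forall L', sl2_stable L' -> (L' <= L)%VS -> L' = 0%VS \/ L' = L
    & exists2 v, v \in L &
        [/\ v != 0, tact (rootE C a) v = 0 & tact (rootH C a) v = c *: v]].

(* V[nu]_a is the direct sum of d k irreducible submodules of highest weight
   nu + k a, for each k.  Such a submodule meets the k + 1 weight subspaces
   V[nu], ..., V[nu + k a], whence k < dim V. *)
Definition sl2_decomposition (d : {ffun 'I_(\dim {: tensor}) -> nat}) : Prop :=
  exists (M : {vspace tensor}) (L : forall k, 'I_(d k) -> {vspace tensor}),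
    [/\ sl2_generated (wspace nu) M,
        forall (k : 'I_(\dim {: tensor})) (j : 'I_(d k)), sl2_irreducible
          (gform (nu + k%:R *: rootH C a) (rootH C a)) (L k j),
        M = (\sum_k \sum_j L k j)%VS
      & directv (\sum_k \sum_j L k j)].

(* d_k^a = dim W_k^a. *)
Definition sl2_mult : {ffun 'I_(\dim {: tensor}) -> nat} :=
  xget [ffun=> 0%N] [set d | sl2_decomposition d].

End Sl2.

Definition Lambda (nu : 'M[C]_N) (k : 'I_n) (lam : 'M[C]_N) : C :=
  trace_on (wspace nu) (act_at k lam).

Definition epsilon (nu : 'M[C]_N) (x : 'I_r -> 'M[C]_N) (k l : 'I_n) : C :=
  trace_on (wspace nu) (Omega x k l).

Definition gammak (nu : 'M[C]_N) (x : 'I_r -> 'M[C]_N) (k : 'I_n) : C :=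
  \sum_(l | l != k) epsilon nu x k l.

End Tensor.

(* R[i] typed as a numClosedFieldType, so that it inherits the topology and
   normed-module structure that MathComp-Analysis puts on numFieldTypes. *)
Definition CC (R : realType) : numClosedFieldType := R[i].

Section ComplexFunctions.
Variable R : realType.
Local Notation C := (CC R).

Definition expC (z : C) : C :=
  let: a +i* b := (z : R[i]) in (expR a * cos b) +i* (expR a * sin b).

(* Gauss' product: Gamma z = lim_m  m! m^z / (z (z+1) ... (z+m)).  At a pole
   z = 0, -1, -2, ... a factor of the denominator vanishes for all large m and,
   since 0^-1 = 0, Gamma z = 0; in particular (Gamma z)^-1 is everywhere the
   entire function 1/Gamma. *)
Definition Gamma (z : C) : C :=
  limn (fun m : nat =>
    (m`!)%:R * expC (z * (ln (m%:R : R))%:C) / \prod_(j < m.+1) (z + j%:R) : C).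

Definition Gamma_pole (z : C) : Prop := exists m : nat, z = - m%:R.

Definition null_homotopic n (U : set 'rV[C]_n) (f : R -> 'rV[C]_n) : Prop :=
  exists H : R * R -> 'rV[C]_n,
    [/\ {within `[0, 1] `*` `[0, 1], continuous H},
        forall s t, 0 <= s <= 1 -> 0 <= t <= 1 -> U (H (s, t)),
        forall t, 0 <= t <= 1 -> H (0, t) = f t,
        forall t, 0 <= t <= 1 -> H (1, t) = f 0
      & forall s, 0 <= s <= 1 -> H (s, 0) = f 0 /\ H (s, 1) = f 0].

(* Used together with connectedness of U. *)
Definition simply_connected n (U : set 'rV[C]_n) : Prop :=
  forall f : R -> 'rV[C]_n, {within `[0, 1], continuous f} ->
    (forall t, 0 <= t <= 1 -> U (f t)) -> f 0 = f 1 -> null_homotopic U f.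

Definition config_space n : set 'rV[C]_n :=
  [set z | (forall k, z 0 k != 0) /\ (forall k l, k != l -> z 0 k != z 0 l)].

(* lf is a continuous branch of log f on the open set U. *)
Definition log_branch n (U : set 'rV[C]_n) (f lf : 'rV[C]_n -> C) : Prop :=
  forall z, U z -> {for z, continuous lf} /\ expC (lf z) = f z.

Section Dynamical.
Variables (r n : nat) (V : 'I_n -> slMod C r).
Local Notation N := r.+1.

(* z^omega on a module M, for the value lz of log z: the operator equal to
   z^{(omega, mu)} on M[mu].  M is the direct sum of its weight subspaces, so
   exactly one matrix has this property. *)
Definition zpow_mx (M : slMod C r) (om : 'M[C]_N) (lz : C) :
    'M[C]_(sldim M) :=
  xget 0 [set Q : 'M[C]_(sldim M) |
    forall (mu : 'M[C]_N) (y : 'cV[C]_(sldim M)), cartan mu ->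
      (forall h, cartan h -> slact M h *m y = gform mu h *: y) ->
      Q *m y = expC (gform om mu * lz) *: y].

(* \prod_k z_k^{omega^(k)}; the factors commute. *)
Definition zpow_op (om : 'M[C]_N) (lz : 'I_n -> C) (v : tensor V) : tensor V :=
  foldr (fun k v' => factor_op (zpow_mx (V k) om (lz k)) v') v (enum 'I_n).

Section Determinant.
Variables (kappa : C) (nu : 'M[C]_N).

Definition X_num (a : slroot r) (lam : 'M[C]_N) (j : nat) : C :=
  1 - gform (lam - 2^-1 *: (nu + j%:R *: rootH C a)) (rootH C a) / kappa.
Definition X_den (a : slroot r) (lam : 'M[C]_N) (j : nat) : C :=
  1 - gform (lam + 2^-1 *: (nu + j%:R *: rootH C a)) (rootH C a) / kappa.

Definition Xfun (a : slroot r) (lam : 'M[C]_N) : C :=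
  \prod_(k < \dim {: tensor V})
    (\prod_(1 <= j < k.+1) (Gamma (X_num a lam j) / Gamma (X_den a lam j)))
      ^+ sl2_mult V nu a k.

(* No Gamma function in a numerator is evaluated at a pole. *)
Definition Xfun_defined (a : slroot r) (lam : 'M[C]_N) : Prop :=
  forall (k : 'I_(\dim {: tensor V})) (j : nat), (0 < sl2_mult V nu a k)%N ->
    (1 <= j <= k)%N -> ~ Gamma_pole (X_num a lam j).

(* lz k and ld k l are the values of log z_k and log (z_k - z_l). *)
Definition Dfun (x : 'I_r -> 'M[C]_N) (lz : 'I_n -> C) (ld : 'I_n -> 'I_n -> C)
    (lam : 'M[C]_N) : C :=
  (\prod_k expC ((Lambda V nu k lam / kappa - gammak V nu x k / (2 * kappa))
                 * lz k))
  * (\prod_(k < n) \prod_(l < n | (k < l)%N) expC (epsilon V nu x k l / kappa * ld k l))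
  * \prod_(a : 'I_N * 'I_N | posroot a) Xfun a lam.

End Determinant.
End Dynamical.
End ComplexFunctions.

(* Main.v *)
(* On V[nu] both systems have explicit determinants.  Off-diagonal terms
   e_a (x) e_{-a} are traceless on V[nu], so the KZ connection on the top
   exterior power of V[nu] only involves the traces of Omega^0 and lam^(k), and
   has an explicit primitive.  In the string basis of the
   sl_2-decomposition, B^a(lam) is diagonal on V[nu], and by the
   Chu-Vandermonde identity its entry on a vector of W_k^a is
   \prod_(1 <= j <= k) (lam + (nu + j a)/2, a) / (lam - (nu + j a)/2, a);
   the functional equation of Gamma shows that the X_a over the inversions a
   of w_[i], i.e. the a with (omega_i, a) = 1, absorb exactly this factor under
   lam -> lam + kappa omega_i, while the other X_a do not change.  So det(u) and
   D satisfy the same first order equations in z and in lam, and their ratio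
   is constant in z and periodic in lam. *)

(* The solutions need not be independent and [D] may vanish, since [1 / Gamma] does; so [C] is not
   introduced as a quotient, and two points are compared through a common factor [rho] of both
   [det(u)] and [D]. Definedness propagates in one direction only. Passing from
   [lam + kappa omega_i] to [lam] adds 0 or 1 to the arguments of the Gamma functions, hence creates
   no pole, and a vanishing denominator of [B(lam)] would be a pole of [X] at the upper point.
   Lattice steps are therefore taken downwards, and two points of one coset of [kappa P^vee] are
   compared through a point below both. A base point deep in the negative chamber, where [D] is
   nonzero, fixes the constant of the coset. Periodicity then comes from the choice of [C(lam)] in a
   set of admissible constants that depends only on the coset. In [z] a logarithmic derivative is
   avoided for the same reason: Jacobi's formula gives a linear equation for [det(u)], and the
   product of [det(u)] with the inverse of an explicit exponential has zero partial derivatives. *)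
Require Import Defs.
From HB Require Import structures.
From mathcomp Require Import all_boot all_order all_fingroup all_algebra.
From mathcomp Require Import complex.
From mathcomp Require Import zify ring lra.
From mathcomp Require Import all_classical all_reals all_analysis.
Import Order.TTheory GRing.Theory Num.Theory numFieldNormedType.Exports.

Set Implicit Arguments.
Unset Strict Implicit.
Unset Printing Implicit Defensive.

Local Open Scope classical_set_scope.
Local Open Scope ring_scope.
Local Notation rootE := Defs.rootE.

(** * Inversions of w_[i] *)

Section Inversions.
Variable r : nat.
Local Notation N := r.+1.

Definition inversions (w : 'S_N) : {set slroot r} :=
  [set a | posroot a & (w a.2 < w a.1)%N]%SET.

Lemma root_act_refl_inj (i : 'I_r) : injective (root_act (simple_refl i)).
Proof. by move=> [a b] [a' b'] [/perm_inj-> /perm_inj->]. Qed.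

Lemma size_word_roots (s : seq 'I_r) : size (word_roots s) = size s.
Proof. by elim: s => //= i s IH; rewrite size_map IH. Qed.

Lemma word_perm_cons (i : 'I_r) s :
  word_perm (i :: s) = (simple_refl i * word_perm s)%g.
Proof. by rewrite /word_perm big_cons. Qed.

Lemma val_simple_refl (i : 'I_r) (a : 'I_N) :
  simple_refl i a = (if a == i :> nat then i.+1 else
                     if a == i.+1 :> nat then (i : nat) else a) :> nat.
Proof.
rewrite /simple_refl /simple_root /=; case: tpermP => [->|->|n1 n2] /=.
- by rewrite eqxx /bump add1n.
- by rewrite /bump add1n eqxx gtn_eqF.
case: eqP => [e|_]; first by case: n1; apply: val_inj.
by case: eqP => // e; case: n2; apply: val_inj; rewrite /= /bump add1n.
Qed.

Lemma posroot_simple_refl (i : 'I_r) (a : slroot r) : posroot a ->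
  a != simple_root i -> posroot (root_act (simple_refl i) a).
Proof.
case: a => a b; rewrite /posroot /= => ab ne.
have {}ne : ~ (val a = i /\ val b = i.+1).
  by move=> [e1 e2]; case/eqP: ne; congr pair; exact: val_inj.
rewrite !val_simple_refl; move: ne ab => /=.
by repeat case: ifP; lia.
Qed.

Lemma refl_actK (i : 'I_r) : involutive (root_act (simple_refl i)).
Proof. by move=> [a b]; rewrite /root_act /= !tpermK. Qed.

(** [s_i] permutes the positive roots other than [alpha_i], so an inversion of [i :: s] different
    from [alpha_i] is the image under [s_i] of an inversion of [s]. *)
Lemma inversions_word_roots (s : seq 'I_r) :
  {subset inversions (word_perm s) <= word_roots s}.
Proof.
elim: s => [|i s IH] a.
  by rewrite inE /word_perm big_nil !perm1 /posroot => /andP[ab /ltnW]; rewrite leqNgt ab.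
rewrite inE word_perm_cons !permM /= in_cons => /andP[pa inv].
have [//|ne] /= := eqVneq a (simple_root i).
rewrite -[a](refl_actK i); apply: map_f; apply: IH.
by rewrite inE posroot_simple_refl.
Qed.

(** At a descent the reflection embeds the inversions of the shorter element into those of [w] other
    than [alpha_i]. *)
Lemma inversions_refl_lt (w : 'S_N) (i : 'I_r) :
  simple_root i \in inversions w ->
  (#|inversions (simple_refl i * w)%g| < #|inversions w|)%N.
Proof.
move=> ri; rewrite [X in (_ < X)%N](cardsD1 (simple_root i)) ri add1n ltnS.
rewrite -(card_imset (inversions (simple_refl i * w)) (@root_act_refl_inj i)); apply: subset_leq_card.
apply/fintype.subsetP => y /imsetP[a aI ->]; move: aI; rewrite !inE !permM => /andP[pa inv].
have ne : a != simple_root i.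
  apply: contraTneq inv => ->; rewrite /simple_refl tpermL tpermR -leqNgt ltnW //.
  by move: ri; rewrite inE => /andP[].
rewrite posroot_simple_refl //= inv !andbT.
apply: contra_neq ne => e; move: pa; rewrite -[a](refl_actK i) e.
rewrite /root_act /posroot /simple_refl /= tpermL tpermR /=.
by rewrite ltnNge leqW.
Qed.

(** Without descents [w] increases along consecutive indices; [w a >= a] follows upwards from 0 and
    [w a <= a] downwards from [r]. *)
Lemma no_descent_id (w : 'S_N) :
  (forall i : 'I_r, simple_root i \notin inversions w) -> w = 1%g.
Proof.
move=> nd.
have step (i : 'I_r) : (w (simple_root i).1 < w (simple_root i).2)%N.
  move: (nd i); rewrite inE /posroot /= leqnn /= -leqNgt leq_eqVlt.
  case/orP => // /eqP/val_inj/perm_inj/(congr1 val) /=.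
  by rewrite /bump /= => /eqP; rewrite -[X in X == _]add0n eqn_add2r.
have ge (m : nat) (hm : (m < N)%N) : (m <= w (Ordinal hm))%N.
  elim: m hm => // m IH hm; have hm' : (m < r)%N by [].
  have := step (Ordinal hm').
  rewrite (_ : (simple_root _).2 = Ordinal hm); last exact: val_inj.
  rewrite (_ : (simple_root _).1 = Ordinal (ltnW hm)); last exact: val_inj.
  exact/leq_ltn_trans/IH.
have le (a : 'I_N) : (w a <= a)%N.
  have [m le_m] := ubnPleq (r - a); elim: m a le_m => [|m IH] a le_m.
    apply: leq_trans (_ : r <= _)%N; first by rewrite -ltnS ltn_ord.
    by move: le_m; rewrite leqn0 subn_eq0.
  have [ra|ar] := leqP r a; first by rewrite (leq_trans _ ra) // -ltnS ltn_ord.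
  have := step (Ordinal ar).
  rewrite (_ : (simple_root _).1 = a); last exact: val_inj.
  move=> lt; rewrite -ltnS; apply: leq_trans lt _; apply: leq_trans (IH _ _) _;
    rewrite /= /bump; lia.
apply/permP => a; rewrite perm1; apply: val_inj; apply/eqP.
by rewrite eqn_leq le; case: a => m hm; rewrite ge.
Qed.

(** Sorting by adjacent transpositions: each descent that is undone removes at least one
    inversion. *)
Lemma inversion_word (w : 'S_N) : exists2 s : seq 'I_r,
  word_perm s = w & (size s <= #|inversions w|)%N.
Proof.
have [m] := ubnP #|inversions w|; elim: m w => // m IH w lt_m.
have [/existsP[i ri]|] := boolP [exists i, simple_root i \in inversions w].
  have lt := inversions_refl_lt ri.
  have [s sw ss] := IH (simple_refl i * w)%g (leq_trans lt lt_m).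
  exists (i :: s); last exact: leq_ltn_trans lt.
  by rewrite word_perm_cons sw mulgA /simple_refl tperm2 mul1g.
rewrite negb_exists => /forallP /no_descent_id ->; exists [::] => //.
by rewrite /word_perm big_nil.
Qed.

Lemma wlen_le (w : 'S_N) s : word_perm s = w -> (wlen w <= size s)%N.
Proof.
move=> sw; rewrite /wlen; case: ex_minnP => m _; apply.
by apply/existsP; exists (in_tuple s); rewrite /= sw.
Qed.

Lemma card_inversions_le (s : seq 'I_r) :
  (#|inversions (word_perm s)| <= size s)%N.
Proof.
rewrite -size_word_roots cardE; apply: uniq_leq_size; first exact: enum_uniq.
by move=> a; rewrite mem_enum => /inversions_word_roots.
Qed.

Lemma wlenE (w : 'S_N) : wlen w = #|inversions w|.
Proof.
apply/eqP; rewrite eqn_leq; apply/andP; split.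
  have [s sw ss] := inversion_word w; exact: leq_trans (wlen_le sw) ss.
rewrite /wlen; case: ex_minnP => m /existsP[t /eqP tw] _.
by rewrite -tw (leq_trans (card_inversions_le t)) ?size_tuple.
Qed.

(** A reduced word has as many roots as [w] has inversions, and its roots contain all of them; so
    they enumerate the inversions without repetition. *)
Lemma reduced_word_roots (w : 'S_N) s : reduced_word w s ->
  perm_eq (word_roots s) (enum (inversions w)).
Proof.
move=> [sw ss]; have sub : {subset enum (inversions w) <= word_roots s}.
  by move=> a; rewrite mem_enum -sw => /inversions_word_roots.
have sz : (size (word_roots s) <= size (enum (inversions w)))%N.
  by rewrite size_word_roots ss wlenE -cardE.
have [_ eqi] := uniq_min_size (enum_uniq _) sub sz.
rewrite perm_sym; apply: uniq_perm => //; first exact: enum_uniq.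
exact: leq_size_uniq (enum_uniq _) sub sz.
Qed.

Lemma simple_refl_in (J : {set 'I_r}) s : {subset s <= J} ->
  word_perm s \in <<[set simple_refl j | j in J]%SET>>%g.
Proof.
elim: s => [|i s IH] sJ; first by rewrite /word_perm big_nil group1.
rewrite word_perm_cons groupM ?IH //.
  by apply/mem_gen/imset_f/sJ; rewrite mem_head.
by move=> j js; apply: sJ; rewrite in_cons js orbT.
Qed.

Lemma wlen_longest (J : {set 'I_r}) (w : 'S_N) :
  w \in <<[set simple_refl j | j in J]%SET>>%g ->
  (wlen w <= wlen (longest J))%N.
Proof.
by move=> wJ; rewrite /longest; case: arg_maxnP => [|w' _ /(_ _ wJ) //]; rewrite group1.
Qed.

Lemma longest_in (J : {set 'I_r}) :
  longest J \in <<[set simple_refl j | j in J]%SET>>%g.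
Proof. by rewrite /longest; case: arg_maxnP => //; rewrite group1. Qed.

(** Elementwise form of membership in the subgroup generated by the [s_j], [j != i]: the blocks
    [{0..i}] and [{i+1..r}] are preserved. *)
Definition block_stable (i : 'I_r) (w : 'S_N) : bool :=
  [forall a : 'I_N, (w a <= i)%N == (a <= i)%N].

Lemma block_stableP (i : 'I_r) (w : 'S_N) :
  reflect (forall a : 'I_N, (w a <= i)%N = (a <= i)%N) (block_stable i w).
Proof. exact: 'forall_eqP. Qed.

Lemma block_simple_refl (i j : 'I_r) : j != i -> block_stable i (simple_refl j).
Proof.
rewrite -val_eqE /= => ji; apply/block_stableP => a; rewrite val_simple_refl.
by repeat case: ifP; lia.
Qed.

Lemma parabolic_block (i : 'I_r) (w : 'S_N) :
  w \in <<[set simple_refl j | j in [set~ i]]%SET>>%g -> block_stable i w.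
Proof.
have gB : group_set [set w | block_stable i w]%SET.
  apply/group_setP; split; first by rewrite inE; apply/block_stableP => a; rewrite perm1.
  move=> u v; rewrite !inE => /block_stableP uB /block_stableP vB.
  by apply/block_stableP => a; rewrite permM vB uB.
move=> wJ; have : w \in Group gB.
  apply: (fintype.subsetP _ _ wJ); rewrite gen_subG.
  apply/fintype.subsetP => _ /imsetP[j + ->]; rewrite !inE => ji.
  exact: block_simple_refl.
by rewrite inE.
Qed.

(** A block preserving [w] has no descent at [i], so it is sorted by the other reflections alone. *)
Lemma block_parabolic (i : 'I_r) (w : 'S_N) : block_stable i w ->
  w \in <<[set simple_refl j | j in [set~ i]]%SET>>%g.
Proof.
have [m] := ubnP #|inversions w|; elim: m w => // m IH w lt_m wB.
have [/existsP[j rj]|] := boolP [exists i, simple_root i \in inversions w].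
  have ji : j != i.
    apply: contraTneq rj => ->; rewrite inE negb_and -leqNgt; apply/orP; right.
    move/block_stableP: wB => wB.
    apply: (@leq_trans i); first by rewrite wB.
    by apply: ltnW; rewrite ltnNge wB -ltnNge.
  have -> : w = (simple_refl j * (simple_refl j * w))%g.
    by rewrite mulgA /simple_refl tperm2 mul1g.
  rewrite groupM //; first by apply/mem_gen/imset_f; rewrite !inE.
  apply: IH; first exact: leq_trans (inversions_refl_lt rj) lt_m.
  have /block_stableP jB := block_simple_refl ji.
  by apply/block_stableP => a; rewrite permM (block_stableP _ _ wB) jB.
by rewrite negb_exists => /forallP /no_descent_id ->; exact: group1.
Qed.

(** Determines the inversions of [longest J] from an upper bound [A] and any element of the subgroup
    that inverts all of [A]: maximality of the length turns the inclusion into an equality by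
    counting. *)
Lemma card_posroot_inversions (J : {set 'I_r}) (w : 'S_N) (A : {set slroot r}) :
  w \in <<[set simple_refl j | j in J]%SET>>%g ->
  (A \subset inversions w) ->
  inversions (longest J) \subset A -> inversions (longest J) = A.
Proof.
move=> wJ Aw lA; apply/eqP; rewrite eqEcard lA.
rewrite (leq_trans (subset_leq_card Aw)) // -!wlenE; exact: wlen_longest.
Qed.

Lemma inversions_longest_all :
  inversions (longest [set: 'I_r]%SET) = [set a | posroot a]%SET.
Proof.
pose w : 'S_N := perm rev_ord_inj.
apply: (@card_posroot_inversions _ w).
- have [s <- _] := inversion_word w.
  by apply: simple_refl_in => j _; rewrite inE.
- apply/fintype.subsetP => -[a b]; rewrite !inE /posroot /= => ab; rewrite ab /=.
  by rewrite !permE /=; have := ltn_ord b; move: ab; lia.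
- by apply/fintype.subsetP => a; rewrite !inE => /andP[].
Qed.

Lemma inversions_longest_block (i : 'I_r) :
  inversions (longest [set~ i]%SET)
  = [set a : slroot r | posroot a & (a.1 <= i)%N == (a.2 <= i)%N]%SET.
Proof.
(* The witness reverses each of the blocks [{0..i}] and [{i+1..r}]. *)
pose f (a : 'I_N) : nat := (if a <= i then i - a else i.+1 + (r - a))%N.
have fN a : (f a < N)%N.
  rewrite /f; case: ifP => ai; have := ltn_ord a; have := ltn_ord i; lia.
have fI : injective (fun a => Ordinal (fN a)).
  move=> a b [] /eqP; rewrite /f => e; apply: val_inj => /=; move: e.
  by have := ltn_ord a; have := ltn_ord b; case: ifP; case: ifP; lia.
apply: (@card_posroot_inversions _ (perm fI)).
- apply: block_parabolic; apply/block_stableP => a; rewrite permE /= /f.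
  by case: ifP => ai; lia.
- apply/fintype.subsetP => -[a b]; rewrite !inE /posroot /= => /andP[ab /eqP e].
  rewrite ab /= !permE /= /f e; have := ltn_ord a; have := ltn_ord b.
  by case: ifP; move: ab e; lia.
- apply/fintype.subsetP => -[a b]; rewrite !inE /posroot /= => /andP[ab inv].
  rewrite ab /=; have /parabolic_block/block_stableP wB := longest_in [set~ i]%SET.
  have := wB a; have := wB b; move: inv ab; lia.
Qed.

(** The factor [w_0] reverses the whole order, so a pair [a < b] is inverted by the product exactly
    when [w_0^i] does not invert it, that is when [a] and [b] lie in different blocks. *)
Lemma inversions_w_bracket (i : 'I_r) :
  inversions (w_bracket i) = [set a : slroot r | (a.1 <= i)%N && (i < a.2)%N]%SET.
Proof.
apply/setP => -[a b]; rewrite !inE /= /w_bracket !permM.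
have /parabolic_block/block_stableP wB := longest_in [set~ i]%SET.
set p := longest _ in wB *; set q := longest _.
have qE (c e : 'I_N) : (q e < q c)%N = (c < e)%N.
  have h (c' e' : 'I_N) : (c' < e')%N -> (q e' < q c')%N.
    move=> ce; have /setP/(_ (c', e')) := inversions_longest_all.
    by rewrite !inE /posroot /= ce.
  have [/h//|] := ltnP c e.
  rewrite leq_eqVlt => /orP[/eqP/val_inj->|/h]; first exact: ltnn.
  by move=> /ltnW; rewrite leqNgt => /negbTE.
rewrite qE /posroot /=.
have pE : (a < b)%N -> (p b < p a)%N = ((a <= i)%N == (b <= i)%N).
  move=> ab; have /setP/(_ (a, b)) := inversions_longest_block i.
  by rewrite !inE /posroot /= ab.
case: (ltnP a b) => [ab|ba] /=; last by move: ba; lia.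
have := pE ab; have : p a != p b :> nat.
  by apply: contraTneq ab => /val_inj/perm_inj->; rewrite ltnn.
by move: ab; lia.
Qed.

Lemma w_bracket_word_roots (i : 'I_r) s : reduced_word (w_bracket i) s ->
  perm_eq (word_roots s)
    (enum [pred a : slroot r | (a.1 <= i)%N && (i < a.2)%N]).
Proof.
move=> /reduced_word_roots; rewrite inversions_w_bracket => /permPl ->.
rewrite (eq_enum (B := [pred a : slroot r | (a.1 <= i)%N && (i < a.2)%N])) //.
by move=> a; rewrite !inE.
Qed.

End Inversions.

(** * Simultaneous eigenvectors *)

Section LinearAlgebra.
Variables (C : fieldType) (T : vectType C).

(** The product of the operators [f - c] over [rs]. For distinct [c] its vanishing expresses that
    [f] is diagonalisable. *)
Definition split_iter (f : T -> T) (rs : seq C) (v : T) : T :=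
  foldr (fun c w => f w - c *: w) v rs.

Lemma split_iter_cons f c rs v : split_iter f (c :: rs) v
  = f (split_iter f rs v) - c *: split_iter f rs v.
Proof. by []. Qed.

Lemma split_iter_linear (f : {linear T -> T}) rs : linear (split_iter f rs).
Proof.
elim: rs => // c rs IH a v w; rewrite !split_iter_cons IH linearP scalerDr !scalerA scalerBr.
by rewrite scalerA [c * a]mulrC opprD addrACA.
Qed.
HB.instance Definition _ (f : {linear T -> T}) rs :=
  GRing.isLinear.Build C T T _ (split_iter f rs) (split_iter_linear f rs).

Lemma split_iter_stable (f : T -> T) (W : {vspace T}) rs v :
  (forall x, x \in W -> f x \in W) -> v \in W -> split_iter f rs v \in W.
Proof.
by move=> fW vW; elim: rs => // c rs IH; rewrite split_iter_cons memvB ?memvZ ?fW.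
Qed.

Lemma split_iter_comm (f g : {linear T -> T}) rs v :
  (forall x, f (g x) = g (f x)) -> split_iter f rs (g v) = g (split_iter f rs v).
Proof.
move=> fg; elim: rs => // c rs IH; rewrite !split_iter_cons IH fg linearB.
by rewrite [in RHS]linearZ.
Qed.

Lemma split_iter_eigen (f : {linear T -> T}) rs c v : f v = c *: v ->
  split_iter f rs v = (\prod_(b <- rs) (c - b)) *: v.
Proof.
move=> fv; elim: rs => [|b rs IH]; first by rewrite big_nil scale1r.
by rewrite split_iter_cons IH linearZ /= fv big_cons !scalerA -scalerBl mulrC -mulrBl.
Qed.

Lemma split_iter_eigen0 (f : {linear T -> T}) rs c v : f v = c *: v ->
  c \in rs -> split_iter f rs v = 0.
Proof.
move=> fv crs; rewrite (split_iter_eigen _ fv) (big_rem c) //=.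
by rewrite subrr mul0r scale0r.
Qed.

(** The components of [f v - c0 v], divided by [c - c0], are those of [v] outside the eigenvalue
    [c0]; what remains of [v] is an eigenvector for [c0]. *)
Lemma eigen_decomposition (f : {linear T -> T}) (W : {vspace T}) rs v :
  uniq rs -> (forall x, x \in W -> f x \in W) -> v \in W ->
  split_iter f rs v = 0 ->
  exists2 g : C -> T, v = \sum_(c <- rs) g c &
    forall c, c \in rs -> g c \in W /\ f (g c) = c *: g c.
Proof.
move=> + fW; elim: rs v => [|c0 rs IH] v.
  by move=> _ _ /= ->; exists (fun=> 0); rewrite ?big_nil.
rewrite cons_uniq => /andP[c0rs urs] vW.
have -> : split_iter f (c0 :: rs) v = split_iter f rs (f v - c0 *: v).
  by rewrite split_iter_cons [RHS]linearB [X in _ = _ - X]linearZ /=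
             split_iter_comm.
move=> h.
have [|g gE gP] := IH (f v - c0 *: v) urs _ h; first by rewrite memvB ?memvZ ?fW.
pose g1 c := (c - c0)^-1 *: g c.
exists (fun c => if c == c0 then v - \sum_(c <- rs) g1 c else g1 c).
  rewrite big_cons eqxx -[LHS](subrK (\sum_(c <- rs) g1 c)); congr (_ + _).
  by apply: eq_big_seq => c crs; rewrite ifN //; apply: contraNneq c0rs => <-.
have g1P c : c \in rs -> g1 c \in W /\ f (g1 c) = c *: g1 c.
  move=> /gP[gW fg]; rewrite memvZ //; split=> //.
  by rewrite linearZ /= fg !scalerA mulrC.
move=> c; rewrite in_cons => /orP[/eqP->|crs]; last first.
  by rewrite ifN; [exact: g1P|apply: contraNneq c0rs => <-].
rewrite eqxx; split.
  by rewrite memvB // big_seq memv_suml // => c' /g1P[].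
have fvE : f v = \sum_(c <- rs) g c + c0 *: v by rewrite -gE subrK.
set S := \sum_(c <- rs) g1 c; have fSE : f S = \sum_(c <- rs) g c + c0 *: S.
  rewrite linear_sum scaler_sumr -big_split /=; apply: eq_big_seq => c' c'rs.
  have [_ ->] := g1P _ c'rs; apply/eqP; rewrite -subr_eq -scalerBl scalerA.
  rewrite divff ?scale1r //.
  by rewrite subr_eq0; apply: contraNneq c0rs => <-.
by rewrite linearB fvE fSE opprD addrACA subrr add0r scalerBr.
Qed.

(** Being an eigenvector is not a linear condition, so spanning by such vectors is stated through
    finite sums. *)
Definition sumof (Q : T -> Prop) (v : T) : Prop :=
  exists2 s : seq T, v = \sum_(x <- s) x & forall x, x \in s -> Q x.

Lemma sumof_sum (I : eqType) (r : seq I) (F : I -> T) Q :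
  (forall i, i \in r -> sumof Q (F i)) -> sumof Q (\sum_(i <- r) F i).
Proof.
elim: r => [|i r IH] h; first by exists [::]; rewrite ?big_nil.
have [s1 E1 Q1] := h _ (mem_head i r).
have [|s2 E2 Q2] := IH; first by move=> j jr; apply: h; rewrite in_cons jr orbT.
exists (s1 ++ s2); first by rewrite big_cons big_cat -E1 -E2.
by move=> x; rewrite mem_cat => /orP[/Q1|/Q2].
Qed.

Lemma sumof_id (Q : T -> Prop) v : Q v -> sumof Q v.
Proof. by exists [:: v]; [rewrite big_seq1|move=> x; rewrite inE => /eqP->]. Qed.

Lemma sumofD (Q : T -> Prop) v w : sumof Q v -> sumof Q w -> sumof Q (v + w).
Proof.
move=> [s1 -> Q1] [s2 -> Q2]; exists (s1 ++ s2); first by rewrite big_cat.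
by move=> x; rewrite mem_cat => /orP[/Q1|/Q2].
Qed.

Lemma sumofW (Q Q' : T -> Prop) v :
  (forall x, Q x -> Q' x) -> sumof Q v -> sumof Q' v.
Proof. by move=> QQ' [s E Qs]; exists s => // x /Qs/QQ'. Qed.

Lemma sumof0 (Q : T -> Prop) (f : {linear T -> T}) v :
  (forall x, Q x -> f x = 0) -> sumof Q v -> f v = 0.
Proof.
by move=> f0 [s -> Qs]; rewrite raddf_sum big_seq big1 // => x /Qs/f0.
Qed.

Lemma spanning_basis (W : {vspace T}) (Q : T -> Prop) :
  (forall v, v \in W -> sumof (fun x => x \in W /\ Q x) v) ->
  exists2 b : seq T, basis_of W b & forall x, x \in b -> Q x.
Proof.
move=> WQ; have [s sW sQ] : exists2 s : seq T, << s >>%VS = W & forall x, x \in s -> Q x.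
  suff : forall X : seq T, {subset X <= W} -> exists2 s : seq T,
      (<<X>> <= << s >>)%VS & forall x, x \in s -> x \in W /\ Q x.
    move=> /(_ (vbasis W))[|s sub sQ]; first by move=> x; exact: vbasis_mem.
    exists s; last by move=> x /sQ[].
    apply/eqP; rewrite eqEsubv -{2}(span_basis (vbasisP W)) sub andbT.
    by apply/span_subvP => x /sQ[].
  elim=> [|v X IH] sub; first by exists [::]; rewrite ?subvv.
  have [|s1 sub1 Q1] := IH; first by move=> x xX; rewrite sub // in_cons xX orbT.
  have [s2 vE Q2] := WQ v (sub _ (mem_head _ _)).
  exists (s2 ++ s1); last by move=> x; rewrite mem_cat => /orP[/Q2|/Q1].
  rewrite span_cons span_cat addvS // -memvE vE big_seq memv_suml //.
  by move=> x; exact: memv_span.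
have [b bf [bs bE]] : exists2 b : seq T, free b &
    {subset b <= s} /\ <<b>>%VS = << s >>%VS.
  elim: s {sW sQ} => [|v s [b bf [bs bE]]]; first by exists [::]; rewrite ?nil_free.
  have [vb|vb] := boolP (v \in <<b>>%VS).
    exists b => //; split; first by move=> x /bs xs; rewrite in_cons xs orbT.
    rewrite span_cons bE; apply/esym/addv_idPr.
    by rewrite -memvE -bE.
  exists (v :: b); first by rewrite free_cons vb.
  split; last by rewrite !span_cons bE.
  by move=> x; rewrite !in_cons => /orP[->//|/bs->]; rewrite orbT.
exists b; first by rewrite basisEfree bf bE sW subvv /= -(eqP bf) bE sW.
by move=> x /bs/sQ.
Qed.

Definition split_op (f : T -> T) : Prop :=
  exists2 rs, uniq rs & forall v, split_iter f rs v = 0.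

(** Each eigenspace [W'] of [f i] in [W] is stable under the other operators by commutation, and the
    induction continues inside it. *)
Lemma joint_eigen_sumof (I : eqType) (f : I -> {linear T -> T}) (r : seq I)
    (W : {vspace T}) v :
  (forall i j x, f i (f j x) = f j (f i x)) -> (forall i, split_op (f i)) ->
  (forall i x, x \in W -> f i x \in W) -> v \in W ->
  sumof (fun x => x \in W /\ forall i, i \in r -> exists c, f i x = c *: x) v.
Proof.
move=> fC fS; elim: r W v => [|i r IH] W v fW vW; first exact: sumof_id.
have [rs urs rs0] := fS i.
have [g -> gP] := eigen_decomposition urs (fW i) vW (rs0 v).
apply: sumof_sum => c /gP[gW fg].
pose h := [the {linear T -> T} of (f i \- (c *: (idfun : T -> T)))].
pose W' := (W :&: lker (linfun h))%VS.
have W'E x : (x \in W') = (x \in W) && (f i x == c *: x).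
  by rewrite memv_cap memv_ker lfunE /= subr_eq0.
apply: sumofW (IH W' (g c) _ _).
- move=> x []; rewrite W'E => /andP[xW /eqP fx] hx; split=> // j.
  by rewrite in_cons => /orP[/eqP->|/hx//]; exists c.
- by move=> j x; rewrite !W'E => /andP[xW /eqP fx]; rewrite fW //= fC fx linearZ.
- by rewrite W'E gW fg /=.
Qed.

Lemma joint_eigenbasis (I : finType) (f : I -> {linear T -> T}) (W : {vspace T}) :
  (forall i j x, f i (f j x) = f j (f i x)) -> (forall i, split_op (f i)) ->
  (forall i x, x \in W -> f i x \in W) ->
  exists2 b : seq T, basis_of W b &
    forall x, x \in b -> forall i, exists c, f i x = c *: x.
Proof.
move=> fC fS fW; apply: spanning_basis => v vW.
apply: sumofW (joint_eigen_sumof (enum I) fC fS fW vW) => x [xW h]; split=> // i.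
by apply: h; rewrite mem_enum.
Qed.

Lemma eigen_free (f : {linear T -> T}) (c : nat -> C) (v : nat -> T) (s : seq nat) :
  injective c -> uniq s -> (forall k, k \in s -> f (v k) = c k *: v k) ->
  (forall k, k \in s -> v k != 0) -> free [seq v k | k <- s].
Proof.
move=> cI; elim: s => [|k s IH] /=; first by rewrite nil_free.
move=> /andP[ks us] fv v0; rewrite free_cons IH // ?andbT; last 2 first.
- by move=> j js; apply: fv; rewrite in_cons js orbT.
- by move=> j js; apply: v0; rewrite in_cons js orbT.
apply/negP => vs; have vE := @coord_span _ _ _ (in_tuple [seq v k | k <- s]) _ vs.
have : split_iter f [seq c j | j <- s] (v k) = 0.
  rewrite vE linear_sum big1 // => i _; rewrite linearZ /=.
  have is_ : (i < size s)%N by rewrite -(size_map v).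
  rewrite (nth_map 0%N) // (split_iter_eigen0 (c := c s`_i)) ?scaler0 //.
    by apply: fv; rewrite in_cons mem_nth ?orbT.
  by rewrite map_f // mem_nth.
rewrite (split_iter_eigen _ (fv k (mem_head _ _))) => /eqP.
rewrite scaler_eq0 (negbTE (v0 k (mem_head _ _))) orbF prodf_seq_eq0.
move=> /hasP[_ /mapP[j js ->]] /=; rewrite subr_eq0 => /eqP/cI kj.
by rewrite kj js in ks.
Qed.

(** Nonzero eigenvectors for infinitely many eigenvalues would exceed the dimension; applied to the
    powers of [E] under [ad H] this gives nilpotency. *)
Lemma eigen_bound (f : {linear T -> T}) (c : nat -> C) (v : nat -> T) :
  injective c -> (forall k, f (v k) = c k *: v k) -> exists k, v k = 0.
Proof.
move=> cI fv; apply: contrapT => /forallNP v0.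
have : free [seq v k | k <- iota 0 (\dim {:T}).+1].
  by apply: (eigen_free cI) => //; [exact: iota_uniq|move=> k _; apply/eqP/v0].
move=> /eqP; rewrite size_map size_iota => e.
by have := dimvS (subvf <<[seq v k | k <- iota 0 (\dim {:T}).+1]>>); rewrite e ltnn.
Qed.

End LinearAlgebra.

(** * Representations of sl_2 *)

Section Sl2Triple.
Variables (C : numFieldType) (T : vectType C).

(** Reduces a vector identity to a scalar one for a generic linear form, where [ring] applies. *)
Lemma vec_ext (v w : T) :
  (forall phi : T -> C, {morph phi : x y / x + y} -> {morph phi : x / - x} ->
     (forall a x, phi (a *: x) = a * phi x) -> phi v = phi w) -> v = w.
Proof.
move=> h; rewrite (coord_vbasis (memvf v)) (coord_vbasis (memvf w)).
apply: eq_bigr => i _; congr (_ *: _); apply: h => [x y|x|a x].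
- exact: linearD.
- exact: linearN.
- exact: linearZ.
Qed.

Definition sl2_triple (E F H : T -> T) : Prop :=
  [/\ forall v, H (E v) = E (H v) + 2 *: E v,
      forall v, H (F v) = F (H v) - 2 *: F v
    & forall v, E (F v) = F (E v) + H v].

(** [E^k] satisfies the eigenvector equation of [ad H] on [End T] for the eigenvalue [2k]; these are
    distinct in characteristic 0, so some power of [E] vanishes. *)
Lemma sl2_nilpotent (E H : {linear T -> T}) :
  (forall v, H (E v) = E (H v) + 2 *: E v) ->
  exists K, forall v, iter K E v = 0.
Proof.
move=> HE; pose h : 'Hom(T, T) := linfun H; pose e : 'Hom(T, T) := linfun E.
pose ad (f : 'Hom(T, T)) : 'Hom(T, T) := ((h \o f) - (f \o h))%VF.
have adL : linear ad.
  move=> a f g; apply/lfunP => v.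
  rewrite !(add_lfunE, opp_lfunE, scale_lfunE, comp_lfunE) !lfunE /=.
  by rewrite linearP scalerBr opprD addrACA.
pose adl : {linear 'Hom(T, T) -> 'Hom(T, T)} :=
  HB.pack ad (GRing.isLinear.Build C _ _ _ ad adL).
pose f (k : nat) : 'Hom(T, T) := iter k (comp_lfun e) \1%VF.
have fE k v : f k v = iter k E v.
  by rewrite /f; elim: k => /= [|k IH]; rewrite ?id_lfunE // comp_lfunE lfunE /= IH.
have Hk k v : H (iter k E v) = iter k E (H v) + (2 * k%:R) *: iter k E v.
  elim: k => [|k IH] /=; first by rewrite mulr0 scale0r addr0.
  rewrite HE IH linearD [E (_ *: _)]linearZ; apply: vec_ext => phi pD pN pZ.
  by rewrite !(pD, pZ) /=; ring.
have [||k f0] := @eigen_bound _ _ adl (fun k => 2 * k%:R : C) f.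
- move=> i j eij; apply/eqP; rewrite -(eqr_nat C); apply/eqP.
  by apply: mulfI eij; rewrite pnatr_eq0.
- by move=> k; apply/lfunP => v; rewrite /= /ad
    !(add_lfunE, opp_lfunE, scale_lfunE, comp_lfunE) !lfunE /= !fE Hk addrC addKr.
by exists k => v; rewrite -fE f0 lfunE.
Qed.

Section Theory.
Variables (E F H : {linear T -> T}).
Hypothesis sl2 : sl2_triple E F H.

Let HE v : H (E v) = E (H v) + 2 *: E v. Proof. by case: sl2. Qed.
Let HF v : H (F v) = F (H v) - 2 *: F v. Proof. by case: sl2. Qed.
Let EF v : E (F v) = F (E v) + H v. Proof. by case: sl2. Qed.

Lemma H_iterE k v : H (iter k E v) = iter k E (H v) + (2 * k)%:R *: iter k E v.
Proof.
elim: k => [|k IH] /=; first by rewrite muln0 scale0r addr0.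
rewrite HE IH linearD [E (_ *: _)]linearZ; apply: vec_ext => phi pD pN pZ.
by rewrite !(pD, pZ) /=; ring.
Qed.

Lemma H_iterF k v : H (iter k F v) = iter k F (H v) - (2 * k)%:R *: iter k F v.
Proof.
elim: k => [|k IH] /=; first by rewrite muln0 scale0r subr0.
rewrite HF IH linearB [F (_ *: _)]linearZ; apply: vec_ext => phi pD pN pZ.
by rewrite !(pD, pZ, pN) /=; ring.
Qed.

(* F E E^j = E^j (F E - j H - j (j + 1)); the joint eigenvectors of H and F E
   killed by the last factor are those with exactly j vectors above them. *)
Definition FE_shift (j : nat) (v : T) : T :=
  F (E v) - j%:R *: H v - (j * j.+1)%:R *: v.

Lemma FE_shift_linear j : linear (FE_shift j).
Proof.
move=> a v w; rewrite /FE_shift !linearP; apply: vec_ext => phi pD pN pZ.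
by rewrite !(pD, pZ, pN) /= ; ring.
Qed.
HB.instance Definition _ j :=
  GRing.isLinear.Build C T T _ (FE_shift j) (FE_shift_linear j).

Lemma FE_comm_H v : F (E (H v)) = H (F (E v)).
Proof.
rewrite HF HE linearD [F (_ *: _)]linearZ; apply: vec_ext => phi pD pN pZ.
by rewrite !(pD, pZ, pN) /=; ring.
Qed.

Lemma FE_iterE k v : F (E (iter k E v)) = iter k E (FE_shift k v).
Proof.
elim: k v => [|k IH] v.
  by rewrite /= /FE_shift mul0n !scale0r !subr0.
have -> : FE_shift k.+1 v = FE_shift k v - H v - (2 * k.+1)%:R *: v.
  rewrite /FE_shift; apply: vec_ext => phi pD pN pZ.
  by rewrite !(pD, pZ, pN) /=; ring.
have FEE w : F (E (E w)) = E (F (E w)) - H (E w) by rewrite EF addrK.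
rewrite iterS FEE IH -!iterS H_iterE.
have iB (x y : T) : iter k.+1 E (x - y) = iter k.+1 E x - iter k.+1 E y.
  by elim: (k.+1) => //= m ->; rewrite linearB.
have iZ c (x : T) : iter k.+1 E (c *: x) = c *: iter k.+1 E x.
  by elim: (k.+1) => //= m ->; rewrite linearZ.
by rewrite !(iB, iZ) opprD addrA.
Qed.

Definition FE_shift_prod (S : seq nat) (v : T) : T := foldr FE_shift v S.

(** Each term [F^k E^k] of the dynamical operator thus becomes a polynomial in the commuting
    operators [H] and [F E]. *)
Lemma iterF_iterE k v :
  iter k F (iter k E v) = FE_shift_prod (iota 0 k) v.
Proof.
elim: k v => [|k IH] v //.
rewrite -addn1 iotaD add0n /FE_shift_prod foldr_cat /= -/(FE_shift_prod _ _).
by rewrite -IH addn1 iterSr iterS FE_iterE.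
Qed.

Lemma FE_shift_prod_linear S : linear (FE_shift_prod S).
Proof.
elim: S => [|j S IH] a v w //=.
by rewrite /FE_shift_prod /= -!/(FE_shift_prod _ _) IH linearP.
Qed.
HB.instance Definition _ S := GRing.isLinear.Build C T T _
  (FE_shift_prod S) (FE_shift_prod_linear S).

Lemma FE_shift_prod_cons j S v :
  FE_shift_prod (j :: S) v = FE_shift j (FE_shift_prod S v).
Proof. by []. Qed.

End Theory.

Lemma triple_swap (E F H : {linear T -> T}) : sl2_triple E F H ->
  sl2_triple F E (\- H).
Proof.
case=> HE HF EF; split=> v /=.
- by rewrite HF linearN opprB addrC.
- by rewrite HE linearN opprD.
- by rewrite EF addrK.
Qed.

Section Weights.
Variables (E F H : {linear T -> T}).
Hypothesis sl2 : sl2_triple E F H.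

(* Joint eigenvectors of H and F E lying in a string of length k + l + 1, with
   k vectors above them and l below. *)
Definition string_vector (K k l : nat) (x : T) : Prop :=
  [/\ (k < K)%N, (l < K)%N, H x = (l%:R - k%:R) *: x
    & F (E x) = (k * l.+1)%:R *: x].

Lemma FE_shift_string j K k l x : string_vector K k l x ->
  FE_shift E F H j x = ((k%:R - j%:R) * (l + j).+1%:R) *: x.
Proof.
move=> [_ _ hH hX]; rewrite /FE_shift hH hX; apply: vec_ext => phi pD pN pZ.
by rewrite !(pD, pZ, pN) /=; ring.
Qed.

Lemma FE_shift_comm_H j v : FE_shift E F H j (H v) = H (FE_shift E F H j v).
Proof.
by rewrite /FE_shift (FE_comm_H sl2) !linearB -!linearZ_LR.
Qed.

Lemma FE_shiftC i j v :
  FE_shift E F H i (FE_shift E F H j v) = FE_shift E F H j (FE_shift E F H i v).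
Proof.
have hB := (linearB E, linearB F, linearB H).
have hZ := (linearZ_LR E, linearZ_LR F, linearZ_LR H).
rewrite /FE_shift !(hB, hZ) !(FE_comm_H sl2); apply: vec_ext => phi pD pN pZ.
by rewrite !(pD, pZ, pN) /=; ring.
Qed.

(** On the kernel of [FE_shift k] the operator [F E] equals [k H + k (k + 1)], and the [l]-th factor
    for the swapped triple becomes [(k + l + 1) (H - (l - k))]. The product over [S] therefore
    diagonalises [H] on this kernel. *)
Lemma FE_shift_single (S : seq nat) k K v : (k < K)%N -> (forall l, l \in S -> (l < K)%N) ->
  uniq S ->
  FE_shift E F H k v = 0 -> FE_shift_prod F E (\- H) S v = 0 ->
  sumof (fun x => exists l, string_vector K k l x) v.
Proof.
move=> kK SK uS kv0 Sv0; case: sl2 => HE HF EF.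
pose W := lker (linfun (FE_shift E F H k)).
have WE x : (x \in W) = (FE_shift E F H k x == 0) by rewrite memv_ker lfunE.
have WH x : x \in W -> H x \in W.
  by rewrite !WE FE_shift_comm_H => /eqP->; rewrite linear0.
have WX x : x \in W -> F (E x) = k%:R *: H x + (k * k.+1)%:R *: x.
  by rewrite WE /FE_shift subr_eq0 subr_eq => /eqP->; rewrite addrC.
pose rs : seq C := [seq l%:R - k%:R | l <- S].
have urs : uniq rs.
  rewrite map_inj_uniq // => i j /addIr /eqP.
  by rewrite eqr_nat => /eqP.
have vW : v \in W by rewrite WE kv0.
have v0 : split_iter H rs v = 0.
  suff : exists2 c : C, c != 0 &
      FE_shift_prod F E (\- H) S v = c *: split_iter H rs v.
    by move=> [c c0]; rewrite Sv0 => /esym/eqP; rewrite scaler_eq0 (negbTE c0) => /eqP.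
  rewrite /rs {Sv0 SK uS urs rs}; elim: S => [|l S [c c0 IH]].
    by exists 1; rewrite ?oner_eq0 // scale1r.
  exists (c * (k + l).+1%:R); first by rewrite mulf_neq0 // pnatr_eq0.
  rewrite FE_shift_prod_cons map_cons split_iter_cons IH; set w := split_iter _ _ _.
  have wW : w \in W by apply: split_iter_stable.
  rewrite /FE_shift !linearZ EF /= (WX _ wW); apply: vec_ext => phi pD pN pZ.
  by rewrite !(pD, pZ, pN) /=; ring.
have [g gE gP] := eigen_decomposition urs WH vW v0.
rewrite gE; apply: sumof_sum => c crs; apply: sumof_id.
have [gW hg] := gP c crs; move/mapP: crs => [l lS cE]; exists l; split=> //.
- exact: SK.
- by rewrite hg cE.
- rewrite WX // hg cE; apply: vec_ext => phi pD pN pZ.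
  by rewrite !(pD, pZ, pN) /=; ring.
Qed.

(** By [E^K = 0] the product of the [FE_shift j], [j < K], vanishes. Its factors are peeled off one
    at a time: on a string vector with [j != k] vectors above it and [l] below, [FE_shift k] is the
    nonzero scalar [(j - k) (l + k + 1)]. *)
Lemma string_decomposition K v : (forall v, iter K E v = 0) ->
  (forall v, iter K F v = 0) ->
  sumof (fun x => exists k l, string_vector K k l x) v.
Proof.
move=> EK FK.
have FEv : FE_shift_prod E F H (iota 0 K) v = 0.
  by rewrite -(iterF_iterE sl2) EK; elim: K {EK FK} => //= K ->; rewrite linear0.
have EFv w : FE_shift_prod F E (\- H) (iota 0 K) w = 0.
  have := iterF_iterE (triple_swap sl2) K w; rewrite FK => <-.
  by elim: K {EK FK FEv} => //= K ->; rewrite linear0.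
suff main S : uniq S -> (forall j, j \in S -> (j < K)%N) ->
    FE_shift_prod E F H S v = 0 ->
    sumof (fun x => exists2 j, j \in S & exists l, string_vector K j l x) v.
  apply: sumofW (main _ (iota_uniq 0 K) _ FEv) => [x [j _ [l]]|j]; last first.
    by rewrite mem_iota.
  by exists j, l.
elim: S v {FEv} => [|k S IH] v; first by move=> _ _ /= ->; exists [::]; rewrite ?big_nil.
rewrite cons_uniq => /andP[kS uS] SK FEv.
pose Q x := exists2 j, j \in S & exists l, string_vector K j l x.
have [s sE sQ] : sumof Q (FE_shift E F H k v).
  have sC U w : FE_shift_prod E F H U (FE_shift E F H k w)
              = FE_shift E F H k (FE_shift_prod E F H U w).
    by elim: U => // i U IHU; rewrite !FE_shift_prod_cons IHU FE_shiftC.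
  have tl j : j \in S -> (j < K)%N by move=> jS; apply: SK; rewrite in_cons jS orbT.
  by apply: IH => //; rewrite sC.
(* Dividing each string vector by its nonzero scalar gives [u] with [v - u] in the kernel of
   [FE_shift k]. *)
have [u uE uQ] : exists2 u, FE_shift E F H k u = FE_shift E F H k v & sumof Q u.
  rewrite sE {sE}; elim: s sQ => [|x s IHs] sQ.
    by exists 0; rewrite ?linear0 ?big_nil //; exists [::]; rewrite ?big_nil.
  have [|u uE uQ] := IHs; first by move=> y ys; apply: sQ; rewrite in_cons ys orbT.
  have [j jS [l hx]] := sQ x (mem_head _ _).
  have a0 : (j%:R - k%:R) * (l + k).+1%:R != 0 :> C.
    rewrite mulf_neq0 ?pnatr_eq0 // subr_eq0 eqr_nat.
    by apply: contraNneq kS => <-.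
  exists (((j%:R - k%:R) * (l + k).+1%:R)^-1 *: x + u).
    rewrite big_cons linearD /= uE linearZ /= (FE_shift_string _ hx) scalerA mulVf //.
    by rewrite scale1r.
  apply: sumofD uQ; apply: sumof_id; exists j => //; exists l.
  by case: hx => h1 h2 h3 h4; split=> //; rewrite !linearZ /= (h3, h4) !scalerA mulrC.
rewrite -(subrK u v); apply: sumofD.
  apply: (@sumofW _ _ (fun x => exists l, string_vector K k l x)) => [x [l hx]|].
    by exists k; [exact: mem_head|exists l].
  apply: (@FE_shift_single (iota 0 K)) => //.
  - by apply: SK; rewrite mem_head.
  - by move=> l; rewrite mem_iota.
  - exact: iota_uniq.
  - by rewrite linearB /= uE subrr.
by apply: sumofW uQ => x [j jS hx]; exists j; rewrite // in_cons jS orbT.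
Qed.

End Weights.
End Sl2Triple.

(** * Strings and highest weight modules *)

Section Sl2Modules.
Variables (C : numFieldType) (T : vectType C).
Variables (E F H : {linear T -> T}).
Hypothesis sl2 : sl2_triple E F H.

Let HE v : H (E v) = E (H v) + 2 *: E v. Proof. by case: sl2. Qed.
Let HF v : H (F v) = F (H v) - 2 *: F v. Proof. by case: sl2. Qed.
Let EF v : E (F v) = F (E v) + H v. Proof. by case: sl2. Qed.

Lemma sl2_nilpotents :
  exists K, (forall v, iter K E v = 0) /\ (forall v, iter K F v = 0).
Proof.
have [K1 E0] := sl2_nilpotent HE.
have [|K2 F0] := @sl2_nilpotent _ _ F (\- H).
  by case: (triple_swap sl2).
have it0 (f : {linear T -> T}) m : iter m f 0 = 0.
  by elim: m => //= m ->; rewrite linear0.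
exists (K1 + K2)%N; split=> v; first by rewrite addnC iterD E0 it0.
by rewrite iterD F0 it0.
Qed.

Lemma sumof_split_op (f : {linear T -> T}) (rs : seq C) :
  (forall v, sumof (fun x => exists2 c, c \in rs & f x = c *: x) v) -> split_op f.
Proof.
move=> fs; exists (undup rs); first exact: undup_uniq.
move=> v; apply: (sumof0 (f := split_iter f (undup rs))) (fs v) => x [c crs fx].
by rewrite /= (split_iter_eigen0 fx) // mem_undup.
Qed.

Lemma H_split_op : split_op H.
Proof.
have [K [EK FK]] := sl2_nilpotents.
apply: (@sumof_split_op _ [seq l%:R - k%:R | k <- iota 0 K, l <- iota 0 K]) => v.
apply: sumofW (string_decomposition sl2 v EK FK) => x [k [l [kK lK hx _]]].
exists (l%:R - k%:R) => //; apply/allpairsP; exists (k, l).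
by rewrite !mem_iota.
Qed.

Lemma FE_split_op : split_op (F \o E).
Proof.
have [K [EK FK]] := sl2_nilpotents.
apply: (@sumof_split_op _ [seq (k * l.+1)%:R | k <- iota 0 K, l <- iota 0 K]) => v.
apply: sumofW (string_decomposition sl2 v EK FK) => x [k [l [kK lK _ hx]]].
exists ((k * l.+1)%:R) => //; apply/allpairsP; exists (k, l).
by rewrite !mem_iota.
Qed.

Lemma last_iter (f : {linear T -> T}) K x : iter K f x = 0 -> x != 0 ->
  exists2 k, iter k f x != 0 & iter k.+1 f x = 0.
Proof.
elim: K => [/= -> /eqP//|K IH fK x0].
have [/IH/(_ x0)//|fK0] := eqVneq (iter K f x) 0; by exists K.
Qed.

Lemma iterZ (f : {linear T -> T}) k c x : iter k f (c *: x) = c *: iter k f x.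
Proof. by elim: k => //= k ->; rewrite linearZ. Qed.

(** The equations [E^{k+1} x = 0] at the top and [F^{l+1} x = 0] at the bottom of the string are two
    linear relations between [h] and [c], which determine both. *)
Lemma string_ends (h c : C) x : x != 0 -> H x = h *: x -> F (E x) = c *: x ->
  exists k l, [/\ iter k E x != 0, iter k.+1 E x = 0, iter l F x != 0,
    iter l.+1 F x = 0 & h = l%:R - k%:R /\ c = (k * l.+1)%:R].
Proof.
move=> x0 Hx Xx; have [K [EK FK]] := sl2_nilpotents.
have [k Ek Ek1] := last_iter (EK x) x0.
have [l Fl Fl1] := last_iter (FK x) x0.
have c1 : c - k%:R * h - (k * k.+1)%:R = 0.
  have := FE_iterE sl2 k x; rewrite -iterS Ek1 linear0 /FE_shift Xx Hx scalerA.
  rewrite -!scalerBl iterZ => /esym/eqP; rewrite scaler_eq0 (negbTE Ek) orbF.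
  by move/eqP.
have c2 : c + h + l%:R * h - (l * l.+1)%:R = 0.
  have := FE_iterE (triple_swap sl2) l x.
  rewrite -iterS Fl1 linear0 /FE_shift EF Xx /= Hx scalerN opprK scalerA.
  rewrite -!scalerDl -!scalerBl iterZ => /esym/eqP.
  by rewrite scaler_eq0 (negbTE Fl) orbF => /eqP.
have hE : h = l%:R - k%:R.
  (* The difference of the left sides of [c2] and [c1] factors in this way. *)
  have : (k + l).+1%:R * (h - (l%:R - k%:R)) = 0 :> C.
    rewrite -[RHS](subrr 0) -{1}c2 -{1}c1; ring.
  move/eqP; rewrite mulf_eq0 pnatr_eq0 /= subr_eq0 => /eqP//.
exists k, l; split=> //; split=> //.
by apply/eqP; rewrite -subr_eq0 -c1 hE; apply/eqP; ring.
Qed.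

Definition sl2_invariant (U : {vspace T}) : Prop :=
  forall v, v \in U -> [/\ H v \in U, E v \in U & F v \in U].

Lemma invariant_iterF U k v : sl2_invariant U -> v \in U -> iter k F v \in U.
Proof. by move=> Ui vU; elim: k => //= k /Ui[]. Qed.

Lemma invariant_iterE U k v : sl2_invariant U -> v \in U -> iter k E v \in U.
Proof. by move=> Ui vU; elim: k => //= k /Ui[]. Qed.

Lemma invariant_sum (I : finType) (P : pred I) (L : I -> {vspace T}) :
  (forall i, P i -> sl2_invariant (L i)) -> sl2_invariant (\sum_(i | P i) L i)%VS.
Proof.
move=> Li v /memv_sumP[u uL ->].
by split; rewrite linear_sum memv_suml // => i iP; case: (Li _ iP _ (uL _ iP)) => *;
  apply: (subvP (sumv_sup _ iP (subvv _))).
Qed.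

Lemma invariant_cap U U' :
  sl2_invariant U -> sl2_invariant U' -> sl2_invariant (U :&: U')%VS.
Proof.
move=> Ui Ui' v; rewrite memv_cap => /andP[/Ui[h1 h2 h3] /Ui'[h4 h5 h6]].
by rewrite !memv_cap h1 h2 h3 h4 h5 h6.
Qed.

Definition highest_vector (v : T) (p : nat) : Prop :=
  [/\ E v = 0, H v = p%:R *: v, iter p F v != 0 & iter p.+1 F v = 0].

Definition hw_module (v : T) (p : nat) : {vspace T} :=
  <<[seq iter j F v | j <- iota 0 p.+1]>>%VS.

Lemma E_iterF c j v : E v = 0 -> H v = c *: v ->
  E (iter j.+1 F v) = (j.+1%:R * (c - j%:R)) *: iter j F v.
Proof.
move=> Ev Hv; have hH k : H (iter k F v) = (c - (2 * k)%:R) *: iter k F v.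
  by rewrite (H_iterF sl2) Hv iterZ scalerBl.
elim: j => [|j IH]; first by rewrite /= EF Ev linear0 add0r Hv mul1r subr0.
rewrite iterS EF hH IH linearZ -scalerDl; congr (_ *: _).
ring.
Qed.

Lemma highest_vector_exists c v : v != 0 -> E v = 0 -> H v = c *: v ->
  exists2 p : nat, c = p%:R & highest_vector v p.
Proof.
move=> v0 Ev Hv; have [K [_ FK]] := sl2_nilpotents.
have [p Fp Fp1] := last_iter (FK v) v0.
have := E_iterF p Ev Hv; rewrite Fp1 linear0 => /esym/eqP.
rewrite scaler_eq0 (negbTE Fp) orbF mulf_eq0 pnatr_eq0 /= subr_eq0 => /eqP cE.
by exists p => //; split=> //; rewrite Hv cE.
Qed.

Section HighestVector.
Variables (v : T) (p : nat).
Hypothesis hv : highest_vector v p.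

Lemma iterF_hw_neq0 j : (j <= p)%N -> iter j F v != 0.
Proof.
case: hv => _ _ Fp _ jp; apply: contraNneq Fp => Fj.
rewrite -(subnK jp) iterD Fj; elim: (p - j)%N => //= m /eqP->.
by rewrite linear0.
Qed.

Lemma H_hw j : H (iter j F v) = (p%:R - (2 * j)%:R) *: iter j F v.
Proof. by case: hv => _ Hv _ _; rewrite (H_iterF sl2) Hv iterZ scalerBl. Qed.

Lemma mem_hw_module j : iter j F v \in hw_module v p.
Proof.
case: (leqP j p) => jp.
  by apply/memv_span/mapP; exists j; rewrite // mem_iota.
case: hv => _ _ _ Fp; rewrite -(subnK jp) iterD Fp.
by rewrite [iter _ _ _](_ : _ = 0) ?mem0v //; elim: (_ - _)%N => //= m ->; exact: linear0.
Qed.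

Lemma hw_moduleP y : y \in hw_module v p ->
  exists a : nat -> C, y = \sum_(j < p.+1) a j *: iter j F v.
Proof.
set X := [seq iter j F v | j <- iota 0 p.+1] => yX.
have sX : size X = p.+1 by rewrite size_map size_iota.
have yE := @coord_span _ _ _ (in_tuple X) _ yX.
exists (fun j => oapp (fun i => coord (in_tuple X) i y) 0 (insub j)).
rewrite {1}yE -sX; apply: eq_bigr => i _; rewrite valK /= (nth_map 0%N).
  by rewrite nth_iota -?sX.
by rewrite size_iota -sX.
Qed.

Lemma hw_module_invariant : sl2_invariant (hw_module v p).
Proof.
move=> y /hw_moduleP[a ->]; split; rewrite linear_sum memv_suml // => j _;
  rewrite linearZ memvZ //.
- by rewrite H_hw memvZ // mem_hw_module.
- case: hv => Ev Hv _ _; case: (nat_of_ord j) => [|i]; first by rewrite /= Ev mem0v.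
  by rewrite (E_iterF _ Ev Hv) memvZ // mem_hw_module.
- exact: (mem_hw_module j.+1).
Qed.

Lemma hw_module_min U : sl2_invariant U -> v \in U -> (hw_module v p <= U)%VS.
Proof.
by move=> Ui vU; apply/span_subvP => _ /mapP[j _ ->]; exact: invariant_iterF.
Qed.

Lemma iterE_iterF_lt i j : (j < i)%N -> iter i E (iter j F v) = 0.
Proof.
case: hv => Ev Hv _ _; elim: j i => [|j IH] [|i] // ji.
  by rewrite iterSr Ev; elim: i {ji} => //= i ->; rewrite linear0.
by rewrite iterSr (E_iterF _ Ev Hv) iterZ IH // scaler0.
Qed.

Lemma iterE_iterF j : (j <= p)%N ->
  exists2 c : C, c != 0 & iter j E (iter j F v) = c *: v.
Proof.
case: hv => Ev Hv _ _; elim: j => [|j IH] jp; first by exists 1; rewrite ?oner_neq0 ?scale1r.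
have [c c0 cE] := IH (ltnW jp); exists (j.+1%:R * (p%:R - j%:R) * c).
  by rewrite !mulf_neq0 ?pnatr_eq0 // subr_eq0 eqr_nat gtn_eqF.
by rewrite iterSr (E_iterF _ Ev Hv) iterZ cE scalerA.
Qed.

(** If [J] is the largest index occurring in a nonzero vector of [U], then [E^J] maps this vector to
    a nonzero multiple of [v], which generates the module. *)
Lemma hw_module_irreducible U : sl2_invariant U -> (U <= hw_module v p)%VS ->
  U = 0%VS \/ U = hw_module v p.
Proof.
move=> Ui UL; have [->|U0] := eqVneq U 0%VS; [by left|right].
have y0 : vpick U != 0 by rewrite vpick0.
have yU := memv_pick U; have [a yE] := hw_moduleP (subvP UL _ yU).
have [J JP Jmax] : exists2 J, (J < p.+1)%N && (a J != 0) &
    forall j, (j < p.+1)%N && (a j != 0) -> (j <= J)%N.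
  have ex : exists j, (j < p.+1)%N && (a j != 0).
    apply: contrapT => /forallNP aN; case/eqP: y0; rewrite yE big1 // => j _.
    by have := aN j; rewrite ltn_ord /= => /negP; rewrite negbK => /eqP->; rewrite scale0r.
  case: (ex_maxnP ex (m := p)) => [j /andP[]//|J h1 h2]; by exists J.
move/andP: JP => [Jp aJ]; have [c c0 cE] := iterE_iterF (j := J) Jp.
have EJ : iter J E (vpick U) = (a J * c) *: v.
  have iS (s : seq 'I_p.+1) g : iter J E (\sum_(j <- s) g j) = \sum_(j <- s) iter J E (g j).
    by elim: J {Jp aJ c c0 cE Jmax} => //= J ->; rewrite linear_sum.
  rewrite yE iS (bigD1 (Ordinal Jp)) //= iterZ cE scalerA big1 ?addr0 // => j jJ.
  rewrite iterZ; have [->|aj] := eqVneq (a j) 0; first by rewrite scale0r.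
  rewrite iterE_iterF_lt ?scaler0 // ltn_neqAle Jmax ?ltn_ord // andbT.
  by move: jJ; rewrite -val_eqE.
apply/eqP; rewrite eqEsubv UL hw_module_min //.
have := invariant_iterE J Ui yU; rewrite EJ => /(memvZ (a J * c)^-1).
by rewrite scalerA mulVf ?scale1r // mulf_neq0.
Qed.

(* The product of the H - c over the weights c <> weight of F^k v projects
   onto the line of F^k v. *)
Lemma hw_module_projection (rs : seq C) (k : nat) y :
  (forall j, (j <= p)%N -> j != k -> p%:R - (2 * j)%:R \in rs) ->
  y \in hw_module v p -> exists c, split_iter H rs y = c *: iter k F v.
Proof.
move=> rsP /hw_moduleP[a ->]; rewrite linear_sum /=.
have [kp|pk] := leqP k p.
  exists (a k * (\prod_(b <- rs) (p%:R - (2 * k)%:R - b))).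
  rewrite (bigD1 (Ordinal (kp : (k < p.+1)%N))) //= linearZ /= (split_iter_eigen _ (H_hw k)).
  rewrite scalerA [X in _ + X]big1 ?addr0 // => j jk; rewrite linearZ /=.
  by rewrite (split_iter_eigen0 (H_hw j)) ?scaler0 // rsP // -ltnS ltn_ord.
exists 0; rewrite scale0r big1 // => j _; rewrite linearZ /=.
rewrite (split_iter_eigen0 (H_hw j)) ?scaler0 // rsP ?(leq_trans _ pk) //.
  by rewrite -ltnS.
by rewrite neq_ltn (leq_trans (ltn_ord j) pk).
Qed.

End HighestVector.
End Sl2Modules.

(** * Decomposition of the module generated by a weight space *)

Section Sl2Decomposition.
Variables (C : numFieldType) (T : vectType C).
Variables (E F H : {linear T -> T}).
Hypothesis sl2 : sl2_triple E F H.

Local Notation invariant := (sl2_invariant E F H).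
Local Notation highest_vector := (highest_vector E F H).

Definition sl2_simple (c : C) (L : {vspace T}) : Prop :=
  [/\ invariant L,
      forall L', invariant L' -> (L' <= L)%VS -> L' = 0%VS \/ L' = L
    & exists2 v, v \in L & [/\ v != 0, E v = 0 & H v = c *: v]].

Definition sl2_span (W M : {vspace T}) : Prop :=
  [/\ (W <= M)%VS, invariant M
    & forall M', invariant M' -> (W <= M')%VS -> (M <= M')%VS].

Lemma sl2_simple_hw c L : sl2_simple c L -> exists v p,
  [/\ highest_vector v p, p%:R = c & L = hw_module F v p].
Proof.
move=> [Li Lirr [v vL [v0 Ev Hv]]].
have [p cE hv] := highest_vector_exists sl2 v0 Ev Hv.
exists v, p; split=> //; have sub := hw_module_min p Li vL.
have [L0|//] := Lirr _ (hw_module_invariant sl2 hv) sub.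
have := mem_hw_module hv 0; rewrite /= L0 memv0 => /eqP v00.
by rewrite v00 eqxx in v0.
Qed.

(** The factors of the scalar are [(k - j) (l + j + 1)] with [j < k]. *)
Lemma iterF_iterE_string K k l x : string_vector E F H K k l x ->
  exists2 s : C, s != 0 & iter k F (iter k E x) = s *: x.
Proof.
move=> hx; rewrite (iterF_iterE sl2).
have : forall j, j \in iota 0 k -> (j < k)%N by move=> j; rewrite mem_iota.
elim: (iota 0 k) => [|j S IH] Sk; first by exists 1; rewrite ?oner_neq0 ?scale1r.
have [|s s0 sE] := IH; first by move=> i iS; rewrite Sk // in_cons iS orbT.
rewrite FE_shift_prod_cons sE linearZ /= (FE_shift_string _ hx) scalerA.
eexists; last by reflexivity.
by rewrite !mulf_neq0 ?pnatr_eq0 // subr_eq0 eqr_nat gtn_eqF // Sk // mem_head.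
Qed.

Lemma string_hw (h c : C) x : x != 0 -> H x = h *: x -> F (E x) = c *: x ->
  exists (v : T) (k p : nat) (s : C),
    [/\ highest_vector v p, p%:R = h + (2 * k)%:R, s != 0, iter k F v = s *: x
      & v = iter k E x].
Proof.
move=> x0 Hx Xx; have [k [l [Ek Ek1 Fl Fl1 [hE cE]]]] := string_ends sl2 x0 Hx Xx.
have hs : string_vector E F H (k + l).+1 k l x.
  by split; rewrite ?ltnS ?leq_addr ?leq_addl // ?Hx ?Xx ?hE ?cE.
have [s s0 sE] := iterF_iterE_string hs.
have ph : (k + l)%:R = h + (2 * k)%:R by rewrite hE; ring.
exists (iter k E x), k, (k + l)%N, s; split=> //; split=> //.
- by rewrite (H_iterE sl2) Hx iterZ -scalerDl ph.
- by rewrite addnC iterD sE iterZ scaler_eq0 negb_or s0.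
- by rewrite addnC -addSn iterD sE iterZ Fl1 scaler0.
Qed.

(** The vectors [v, F v, ..., F^k v] have distinct weights. This justifies cutting the sums over [k]
    at the dimension. *)
Lemma hw_string_lt_dim (v : T) (p k : nat) : highest_vector v p ->
  iter k F v != 0 -> (k < \dim {:T})%N.
Proof.
move=> hv Fk; have fr : free [seq iter j F v | j <- iota 0 k.+1].
  apply: (@eigen_free _ _ H (fun j => p%:R - (2 * j)%:R)) => [i j|||].
  - move=> /addrI/oppr_inj/eqP; rewrite eqr_nat eqn_mul2l => /eqP//.
  - exact: iota_uniq.
  - by move=> j _; exact: (H_hw sl2 hv).
  - move=> j; rewrite mem_iota ltnS /= => jk; apply: contraNneq Fk => Fj.
    rewrite -(subnK jk) iterD Fj; elim: (k - j)%N => //= m /eqP->.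
    by rewrite linear0.
have := dimvS (subvf <<[seq iter j F v | j <- iota 0 k.+1]>>).
by rewrite (eqP fr) size_map size_iota.
Qed.

(** Each vector of an eigenbasis of [F E] on [W] yields one irreducible module, through the top of
    its string. Directness reduces to freeness of the basis: by irreducibility, a module meeting the
    sum of the others would lie in it together with its basis vector. *)
Lemma sl2_decomposition_exists (h : C) (W : {vspace T}) :
  (forall w, w \in W -> H w = h *: w) -> (forall w, w \in W -> F (E w) \in W) ->
  exists (d : nat) (L : 'I_d -> {vspace T}) (k : 'I_d -> nat),
    [/\ sl2_span W (\sum_i L i)%VS,
        forall i, sl2_simple (h + (2 * k i)%:R) (L i),
        forall i, (k i < \dim {:T})%N & directv (\sum_i L i)%VS].
Proof.
move=> WH WX.
have [|||b bW bX] := @joint_eigenbasis _ _ unit (fun=> F \o E) W.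
- by [].
- by move=> _; exact: FE_split_op sl2.
- by move=> _; exact: WX.
have bfree := basis_free bW; have bmem i : (i < size b)%N -> b`_i \in W.
  by move=> ib; apply: (basis_mem bW); exact: mem_nth.
have data (i : 'I_(size b)) : exists t : T * nat * nat * C,
    [/\ highest_vector t.1.1.1 t.1.2, t.1.2%:R = h + (2 * t.1.1.2)%:R, t.2 != 0,
        iter t.1.1.2 F t.1.1.1 = t.2 *: b`_i & t.1.1.1 = iter t.1.1.2 E b`_i].
  have [c Xx] := bX _ (mem_nth 0 (ltn_ord i)) tt.
  have x0 : b`_i != 0 := free_not0 bfree (mem_nth 0 (ltn_ord i)).
  have [v [k [p [s hv]]]] := string_hw x0 (WH _ (bmem i (ltn_ord i))) Xx.
  by exists (v, k, p, s).
have [t tP] := choice data.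
pose v i := (t i).1.1.1; pose k i := (t i).1.1.2; pose p i := (t i).1.2.
pose s i := (t i).2.
have hv i : highest_vector (v i) (p i) by case: (tP i).
have pE i : (p i)%:R = h + (2 * k i)%:R by case: (tP i).
have s0 i : s i != 0 by case: (tP i).
have Fk i : iter (k i) F (v i) = s i *: b`_i by case: (tP i).
have vE i : v i = iter (k i) E b`_i by case: (tP i).
pose L i := hw_module F (v i) (p i).
have Li i : invariant (L i) by exact: (hw_module_invariant sl2 (hv i)).
have bL (i : 'I_(size b)) : b`_i \in L i.
  have := mem_hw_module (hv i) (k i); rewrite Fk => /(memvZ (s i)^-1).
  by rewrite scalerA mulVf // scale1r.
exists (size b), L, k; split.
- split.
  + rewrite -(span_basis bW); apply/span_subvP => x /(nthP 0)[i ib <-].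
    exact: (subvP (sumv_sup (Ordinal ib) _ (subvv _))) (bL (Ordinal ib)).
  + by apply: invariant_sum => i _; exact: Li.
  + move=> M Mi WM; apply/subv_sumP => i _; apply: (hw_module_min (p i) Mi).
    by rewrite vE; apply: (invariant_iterE _ Mi); exact: (subvP WM _ (bmem i _)).
- move=> i; split; first exact: Li.
    by move=> L'; exact: (hw_module_irreducible sl2 (hv i)).
  exists (v i); first exact: (mem_hw_module (hv i) 0).
  by split; [exact: (iterF_hw_neq0 (hv i) (leq0n _))|case: (hv i)|rewrite -pE; case: (hv i)].
- move=> i; apply: hw_string_lt_dim (hv i) _; rewrite Fk scaler_eq0 negb_or s0 /=.
  exact: free_not0 bfree (mem_nth 0 (ltn_ord i)).
apply/directv_sumP => i _; apply: contrapT => cap0.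
have capI : invariant (L i :&: \sum_(j | true && (j != i)) L j)%VS.
  by apply: invariant_cap => //; apply: invariant_sum => j _; exact: Li.
have [//|capE] := hw_module_irreducible sl2 (hv i) capI (capvSl _ _).
have : b`_i \in (\sum_(j | true && (j != i)) L j)%VS.
  by have := bL i; rewrite /L -capE memv_cap => /andP[].
move=> /memv_sumP[u uL biE].
(* All weights of the modules except [h]: the product of the corresponding [H - c] sends [L j] into
   the line of the [j]-th basis vector. *)
pose rs := [seq c <- [seq (p j)%:R - (2 * m)%:R | j <- enum 'I_(size b), m <- iota 0 (p j).+1] | c != h].
have /choice[a aP] : forall j : 'I_(size b), exists c : C, j != i ->
    split_iter H rs (u j) = c *: b`_j.
  move=> j.
  case: (boolP (j != i)) => [ji|]; last by exists 0.
  have [|c cE] := @hw_module_projection _ _ _ _ _ sl2 _ _ (hv j) rs (k j) _ _ (uL j ji).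
    move=> m mp mk; rewrite mem_filter pE; apply/andP; split.
      rewrite -subr_eq0 addrAC [h + _]addrC addrK subr_eq0 eqr_nat eqn_mul2l /=.
      by rewrite eq_sym.
    by rewrite -pE; apply/allpairsPdep; exists j, m; rewrite mem_enum mem_iota ltnS mp.
  by exists (c * s j); rewrite cE Fk scalerA.
have := congr1 (split_iter H rs) biE.
rewrite (split_iter_eigen _ (WH _ (bmem i (ltn_ord i)))) linear_sum /=.
set q := \prod_(_ <- _) _ => eqq.
have q0 : q != 0.
  rewrite prodf_seq_neq0; apply/allP => c; rewrite mem_filter subr_eq0 => /andP[ch _].
  by rewrite eq_sym.
have := elimT (@freeP _ _ _ (in_tuple b)) bfree.
move=> /(_ (fun j => if j == i then - q else a j)) /(_ _ i); rewrite eqxx.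
move=> h0; case/eqP: q0; apply/eqP; rewrite -oppr_eq0 h0 //.
rewrite (bigD1 i) //= eqxx scaleNr eqq addrC; apply/eqP; rewrite subr_eq0; apply/eqP.
by apply: eq_bigr => j ji; rewrite (negbTE ji) aP.
Qed.

(** Stated for an arbitrary decomposition, because [sl2_mult] comes from one selected by choice.
    Each summand meets [W] in a line, spanned by the vector [k] steps below its highest vector. *)
Lemma sl2_decomposition_basis (I : finType) (L : I -> {vspace T}) (k : I -> nat)
    (h : C) (W : {vspace T}) :
  sl2_span W (\sum_i L i)%VS -> (forall i, sl2_simple (h + (2 * k i)%:R) (L i)) ->
  directv (\sum_i L i)%VS -> (forall w, w \in W -> H w = h *: w) ->
  (forall w, w \in (\sum_i L i)%VS -> H w = h *: w -> w \in W) ->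
  exists (v : I -> T) (p : I -> nat),
    [/\ forall i, highest_vector (v i) (p i),
        forall i, (p i)%:R = h + (2 * k i)%:R,
        forall i, iter (k i) F (v i) \in W,
        forall w, w \in W -> exists a, w = \sum_i a i *: iter (k i) F (v i)
      & forall a, \sum_i a i *: iter (k i) F (v i) = 0 -> forall i, a i = 0].
Proof.
move=> [WM Mi Mmin] Lirr Ld WH MW.
have data i : exists t : T * nat, [/\ highest_vector t.1 t.2,
    t.2%:R = h + (2 * k i)%:R & L i = hw_module F t.1 t.2].
  by have [v [p [? ? ?]]] := sl2_simple_hw (Lirr i); exists (v, p).
have [t tP] := choice data; pose v i := (t i).1; pose p i := (t i).2.
have hv i : highest_vector (v i) (p i) by case: (tP i).
have pE i : (p i)%:R = h + (2 * k i)%:R by case: (tP i).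
have LE i : L i = hw_module F (v i) (p i) by case: (tP i).
pose y i := iter (k i) F (v i).
have yL i : y i \in L i by rewrite LE; exact: mem_hw_module.
have Hy i : H (y i) = h *: y i.
  by rewrite (H_hw sl2 (hv i)) pE addrK.
have LM i : (L i <= \sum_i L i)%VS by exact: (sumv_sup i).
have yW i : y i \in W by apply: MW (Hy i); exact: (subvP (LM i)).
have gen w : w \in W -> exists a, w = \sum_i a i *: y i.
  move=> wW; have /memv_sumP[u uL wE] := subvP WM _ wW.
  pose rs := [seq c <- [seq (p j)%:R - (2 * m)%:R | j <- enum I, m <- iota 0 (p j).+1] | c != h].
  have /choice[a aP] j : exists c : C, split_iter H rs (u j) = c *: y j.
    have uLj := uL j isT; rewrite LE in uLj.
    apply: (@hw_module_projection _ _ _ _ _ sl2 _ _ (hv j) rs (k j) _ _ uLj).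
    move=> m mp mk; rewrite mem_filter pE; apply/andP; split.
      rewrite -subr_eq0 addrAC [h + _]addrC addrK subr_eq0 eqr_nat eqn_mul2l /=.
      by rewrite eq_sym.
    by rewrite -pE; apply/allpairsPdep; exists j, m; rewrite mem_enum mem_iota ltnS mp.
  have := congr1 (split_iter H rs) wE.
  rewrite (split_iter_eigen _ (WH _ wW)) linear_sum /=.
  set q := \prod_(_ <- _) _ => eqq.
  have q0 : q != 0.
    rewrite prodf_seq_neq0; apply/allP => c; rewrite mem_filter subr_eq0 => /andP[ch _].
    by rewrite eq_sym.
  exists (fun i => q^-1 * a i); rewrite -[LHS]scale1r -(mulVf q0) -scalerA eqq.
  by rewrite scaler_sumr; apply: eq_bigr => i _; rewrite aP scalerA.
have v0 i : v i != 0 := iterF_hw_neq0 (hv i) (leq0n _).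
(* If [y i] vanished, the other modules would already contain [W], hence by minimality also [L i],
   against directness. *)
have y0 i : y i != 0.
  apply/negP => /eqP yi0.
  have /directv_sumP/(_ i isT) := Ld.
  have sub : (\sum_i L i <= \sum_(j | true && (j != i)) L j)%VS.
    apply: Mmin; first by apply: invariant_sum => j _; case: (Lirr j).
    apply/subvP => w /gen[a ->]; apply: memv_suml => j _; rewrite memvZ //.
    have [->|ji] := eqVneq j i; first by rewrite yi0 mem0v.
    by apply: subvP (yL j); apply: (sumv_sup j).
  move=> /eqP; rewrite (capv_idPl (subv_trans (LM i) sub)) => /eqP L0.
  have := mem_hw_module (hv i) 0; rewrite -LE L0 memv0 => /eqP vi0.
  by case/eqP: (v0 i).
exists v, p; split=> // a a0 i.
have ay j : a j *: y j = 0.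
  have /directv_sum_independent/(_ (fun j => a j *: y j)) := Ld.
  by apply=> // l _; rewrite memvZ.
by have /eqP := ay i; rewrite scaler_eq0 (negbTE (y0 i)) orbF => /eqP.
Qed.

End Sl2Decomposition.

(** * Matrices of operators in a basis of a subspace *)

Lemma det_rect_conj (C : fieldType) d m (P : 'M[C]_(d, m)) (Q : 'M[C]_(m, d)) (D : 'M[C]_m) :
  P *m Q = 1%:M -> Q *m P = 1%:M -> \det (P *m D *m Q) = \det D.
Proof.
move=> PQ QP; have e : d = m.
  by apply/eqP; rewrite eqn_leq (mulmx1_min PQ) (mulmx1_min QP).
subst m; rewrite !det_mulmx mulrAC -det_mulmx PQ det1 mul1r //.
Qed.

Section OperatorMatrix.
Variables (C : fieldType) (T : vectType C) (W : {vspace T}).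

(** Row [i] holds the coordinates of [f v_i], just as row [i] of [(u_{i,j})] holds those of [u_i].
    Applying an operator to all solutions thus multiplies [(u_{i,j})] on the right, and composition
    reverses the order of the matrices. *)
Definition opmx d (v : d.-tuple T) (f : T -> T) : 'M[C]_d :=
  \matrix_(i, j) coord v j (f v`_i).

Section Basis.
Variables (d : nat) (v : d.-tuple T).
Hypothesis bv : basis_of W v.

Lemma basis_nth (i : 'I_d) : v`_i \in W.
Proof. by apply: (basis_mem bv); rewrite mem_nth ?size_tuple. Qed.

Lemma opmxE (f : T -> T) (i : 'I_d) : f v`_i \in W ->
  f v`_i = \sum_j opmx v f i j *: v`_j.
Proof.
move=> /(coord_basis bv) {1}->.
by apply: eq_bigr => j _; rewrite mxE.
Qed.

Lemma opmx_uniq (f : T -> T) (M : 'M[C]_d) :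
  (forall i : 'I_d, f v`_i = \sum_j M i j *: v`_j) -> opmx v f = M.
Proof.
move=> fE; apply/matrixP => i j; rewrite mxE fE linear_sum (bigD1 j) //=.
rewrite linearZ /= coord_free ?(basis_free bv) // eqxx mulr1 big1 ?addr0 // => l lj.
by rewrite linearZ /= coord_free ?(basis_free bv) // (negbTE lj) mulr0.
Qed.

Lemma opmx_sum (f : {linear T -> T}) (a : 'I_d -> C) :
  (forall x, x \in W -> f x \in W) ->
  f (\sum_i a i *: v`_i) = \sum_j (\sum_i a i * opmx v f i j) *: v`_j.
Proof.
move=> fW; under [RHS]eq_bigr do rewrite scaler_suml.
rewrite exchange_big linear_sum; apply: eq_bigr => i _.
rewrite linearZ /= opmxE ?fW ?basis_nth // scaler_sumr.
by apply: eq_bigr => j _; rewrite scalerA.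
Qed.

Lemma opmx_comp (f : T -> T) (g : {linear T -> T}) :
  (forall x, x \in W -> f x \in W) -> (forall x, x \in W -> g x \in W) ->
  opmx v (g \o f) = opmx v f *m opmx v g.
Proof.
move=> fW gW; apply: opmx_uniq => i /=; rewrite (opmxE (fW _ (basis_nth i))).
by rewrite opmx_sum //; apply: eq_bigr => j _; rewrite mxE.
Qed.

Lemma opmx1 : opmx v idfun = 1%:M.
Proof.
apply: opmx_uniq => i /=; rewrite (bigD1 i) //= mxE eqxx scale1r big1 ?addr0 //.
by move=> j ji; rewrite mxE eq_sym (negbTE ji) scale0r.
Qed.

(** [P] and [Q] stay rectangular because the two families have equal size only up to a proof;
    [det_rect_conj] removes the conjugation. *)
Lemma change_basis m (y : 'I_m -> T) :
  (forall k, y k \in W) -> (forall w, w \in W -> exists a, w = \sum_k a k *: y k) ->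
  (forall a, \sum_k a k *: y k = 0 -> forall k, a k = 0) ->
  exists P Q, [/\ P *m Q = 1%:M :> 'M[C]_d, Q *m P = 1%:M :> 'M[C]_m &
    forall (f : {linear T -> T}) (D : 'M[C]_m),
      (forall k, f (y k) = \sum_l D k l *: y l) -> opmx v f = P *m D *m Q].
Proof.
move=> yW ygen yfree.
have /choice[p pE] (i : 'I_d) : exists a, v`_i = \sum_k a k *: y k.
  exact: ygen (basis_nth i).
pose P : 'M[C]_(d, m) := \matrix_(i, k) p i k.
pose Q : 'M[C]_(m, d) := \matrix_(k, j) coord v j (y k).
have vE (i : 'I_d) : v`_i = \sum_k P i k *: y k.
  by rewrite pE; apply: eq_bigr => k _; rewrite mxE.
have yE (k : 'I_m) : y k = \sum_j Q k j *: v`_j.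
  by rewrite {1}(coord_basis bv (yW k)); apply: eq_bigr => j _; rewrite mxE.
have swap (n1 n2 : nat) (z : 'I_n2 -> T) (a : 'I_n1 -> C) (A : 'M[C]_(n1, n2)) :
    \sum_i a i *: (\sum_j A i j *: z j) = \sum_j (\sum_i a i * A i j) *: z j.
  under [RHS]eq_bigr do rewrite scaler_suml.
  rewrite exchange_big /=; apply: eq_bigr => i _; rewrite scaler_sumr.
  by apply: eq_bigr => j _; rewrite scalerA.
clearbody P Q; exists P, Q; split.
- rewrite -opmx1; symmetry; apply: opmx_uniq => i /=; rewrite {1}vE.
  under [LHS]eq_bigr do rewrite yE.
  by rewrite swap; apply: eq_bigr => j _; rewrite mxE.
- apply/matrixP => k l; apply/eqP; rewrite -subr_eq0; apply/eqP.
  apply: (yfree (fun l => (Q *m P) k l - 1%:M k l)).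
  under eq_bigr do rewrite scalerBl.
  rewrite sumrB; apply/eqP; rewrite subr_eq0; apply/eqP.
  rewrite [RHS](bigD1 k) //= [1%:M k k]mxE eqxx scale1r.
  rewrite [X in _ = _ + X]big1 ?addr0 => [|j jk].
    rewrite {1}yE; under [RHS]eq_bigr do rewrite vE.
    by rewrite swap; apply: eq_bigr => j _; rewrite mxE.
  by rewrite mxE eq_sym (negbTE jk) scale0r.
- move=> f D fE; apply: opmx_uniq => i; rewrite {1}vE linear_sum.
  under [LHS]eq_bigr do rewrite linearZ /= fE.
  rewrite swap; under [LHS]eq_bigr do rewrite yE.
  rewrite swap; apply: eq_bigr => j _; congr (_ *: _); rewrite mxE.
  by apply: eq_bigr => l _; rewrite mxE.
Qed.

Lemma opmx_eigen (I : finType) (y : I -> T) (s : I -> C) (f : {linear T -> T}) :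
  (forall k, y k \in W) -> (forall w, w \in W -> exists a, w = \sum_k a k *: y k) ->
  (forall a, \sum_k a k *: y k = 0 -> forall k, a k = 0) ->
  (forall k, f (y k) = s k *: y k) ->
  \det (opmx v f) = \prod_k s k /\ \tr (opmx v f) = \sum_k s k.
Proof.
move=> yW ygen yfree fy.
pose z (i : 'I_#|I|) := y (enum_val i).
have zE (a : 'I_#|I| -> C) : \sum_k a k *: z k = \sum_k a (enum_rank k) *: y k.
  rewrite [RHS](reindex _ (onW_bij _ (enum_val_bij I))) /=.
  by apply: eq_bigr => k _; rewrite enum_valK.
have [|||P [Q [PQ QP /(_ f)]]] := @change_basis _ z.
- by move=> k; exact: yW.
- move=> w /ygen[a ->]; exists (a \o enum_val); rewrite zE /=.
  by apply: eq_bigr => k _; rewrite enum_rankK.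
- move=> a; rewrite zE => /yfree h k; have := h (enum_val k).
  by rewrite enum_valK.
move=> /(_ (diag_mx (\row_k s (enum_val k))))->; last first.
  move=> k; rewrite /z fy (bigD1 k) //= !mxE eqxx big1 ?addr0 // => l lk.
  by rewrite mxE eq_sym (negbTE lk) mulr0n scale0r.
split.
  rewrite (det_rect_conj _ PQ QP) det_diag; under eq_bigr do rewrite mxE.
  by rewrite [RHS](reindex _ (onW_bij _ (enum_val_bij I))).
rewrite -mulmxA mxtrace_mulC -mulmxA QP mulmx1 mxtrace_diag.
under eq_bigr do rewrite mxE.
by rewrite [RHS](reindex _ (onW_bij _ (enum_val_bij I))).
Qed.

End Basis.

Lemma basis_gen d (v : d.-tuple T) w : basis_of W v -> w \in W ->
  exists a : 'I_d -> C, w = \sum_i a i *: v`_i.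
Proof. by move=> bv /(coord_basis bv) {1}->; eexists. Qed.

Lemma basis_indep d (v : d.-tuple T) (a : 'I_d -> C) : basis_of W v ->
  \sum_i a i *: v`_i = 0 -> forall i, a i = 0.
Proof. by move=> bv; exact: (elimT (@freeP _ _ _ v) (basis_free bv)). Qed.

Lemma opmx_trace d d' (v : d.-tuple T) (b : d'.-tuple T) (f : {linear T -> T}) :
  basis_of W v -> basis_of W b -> (forall x, x \in W -> f x \in W) ->
  \tr (opmx v f) = \tr (opmx b f).
Proof.
move=> bv bb fW.
have [|||P [Q [PQ QP /(_ f)]]] := @change_basis _ _ bv _ (fun i : 'I_d' => b`_i).
- by move=> k; exact: basis_nth bb k.
- by move=> w; exact: basis_gen.
- by move=> a; exact: basis_indep.
move=> /(_ (opmx b f)) ->; first by rewrite -mulmxA mxtrace_mulC -mulmxA QP mulmx1.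
by move=> k; rewrite {1}(opmxE bb) // fW // (basis_nth bb).
Qed.
End OperatorMatrix.

(** * Tensor products and weight subspaces *)

Section TensorOperators.
Variables (C : numClosedFieldType) (r n : nat) (V : 'I_n -> slMod C r).
Local Notation N := r.+1.
Local Notation tensor := (tensor V).

Lemma tset_same (t : tidx V) k (a : 'I_(sldim (V k))) : tset t a k = a.
Proof. by rewrite /tset ffunE dfwithin. Qed.

Lemma tset_other (t : tidx V) k l (a : 'I_(sldim (V k))) : k != l ->
  tset t a l = t l.
Proof. by move=> kl; rewrite /tset ffunE dfwithout. Qed.

Lemma tset_tset (t : tidx V) k (a b : 'I_(sldim (V k))) :
  tset (tset t a) b = tset t b.
Proof.
apply/ffunP => j; have [<-|kj] := eqVneq k j; first by rewrite !tset_same.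
by rewrite !tset_other.
Qed.

Lemma tset_swap (t : tidx V) k l (a : 'I_(sldim (V k))) (b : 'I_(sldim (V l))) :
  k != l -> tset (tset t a) b = tset (tset t b) a.
Proof.
move=> kl; apply/ffunP => j; have [jk|kj] := eqVneq k j.
  by subst j; rewrite tset_same tset_other 1?eq_sym // tset_same.
have [jl|lj] := eqVneq l j; first by subst j; rewrite tset_same tset_other // tset_same.
by rewrite !tset_other.
Qed.

Lemma factor_op_mul k (A B : 'M[C]_(sldim (V k))) (v : tensor) :
  factor_op (A *m B) v = factor_op A (factor_op B v).
Proof.
apply/ffunP => t; rewrite !ffunE.
under eq_bigr do rewrite mxE mulr_suml.
rewrite exchange_big; apply: eq_bigr => b _ /=; rewrite ffunE tset_same mulr_sumr.
by apply: eq_bigr => a _; rewrite tset_tset mulrA.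
Qed.

Lemma factor_opC k l (A : 'M[C]_(sldim (V k))) (B : 'M[C]_(sldim (V l)))
    (v : tensor) : k != l ->
  factor_op A (factor_op B v) = factor_op B (factor_op A v).
Proof.
move=> kl; apply/ffunP => t; rewrite !ffunE.
under eq_bigr do rewrite ffunE mulr_sumr.
under [RHS]eq_bigr do rewrite ffunE mulr_sumr.
rewrite exchange_big; apply: eq_bigr => b _; apply: eq_bigr => a _ /=.
by rewrite tset_swap // !tset_other // 1?eq_sym // mulrCA.
Qed.

HB.instance Definition _ k (A : 'M[C]_(sldim (V k))) :=
  GRing.isLinear.Build C tensor tensor _ (factor_op A) (factor_op_linear A).

Lemma act_at_linear k X : linear (@act_at C r n V k X).
Proof. exact: factor_op_linear. Qed.
HB.instance Definition _ k X :=
  GRing.isLinear.Build C tensor tensor _ (@act_at C r n V k X) (act_at_linear k X).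
HB.instance Definition _ X :=
  GRing.isLinear.Build C tensor tensor _ (@tact C r n V X) (tact_linear (V := V) X).

Lemma act_at_lin k (c : C) (A B : 'M[C]_N) (v : tensor) : \tr A = 0 -> \tr B = 0 ->
  act_at k (c *: A + B) v = c *: act_at k A v + act_at k B v.
Proof.
move=> hA hB; apply/ffunP => t; rewrite !ffunE slact_lin // scaler_sumr.
rewrite -big_split /=; apply: eq_bigr => a _.
by rewrite !mxE /GRing.scale /= mulrDl mulrA.
Qed.

Lemma act_at0 k (v : tensor) : act_at k 0 v = 0.
Proof.
have := @act_at_lin k (-1) 0 0 v (mxtrace0 _ _) (mxtrace0 _ _).
by rewrite scaler0 addr0 scaleN1r addNr.
Qed.

Lemma act_atZ k c A (v : tensor) : \tr A = 0 -> act_at k (c *: A) v = c *: act_at k A v.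
Proof. by move=> hA; rewrite -[_ *: A]addr0 act_at_lin ?mxtrace0 // act_at0 addr0. Qed.

Lemma act_atC k l X Y (v : tensor) : k != l ->
  act_at k X (act_at l Y v) = act_at l Y (act_at k X v).
Proof. exact: factor_opC. Qed.

Lemma act_at_bracket k X Y (v : tensor) : \tr X = 0 -> \tr Y = 0 ->
  act_at k X (act_at k Y v) - act_at k Y (act_at k X v)
  = act_at k (X *m Y - Y *m X) v.
Proof.
move=> hX hY; rewrite /act_at -!factor_op_mul slact_bracket //.
apply/ffunP => t; rewrite !ffunE -sumrN -big_split /=.
by apply: eq_bigr => a _; rewrite !mxE mulrBl.
Qed.

Lemma act_at_tact_bracket k X Y (v : tensor) : \tr X = 0 -> \tr Y = 0 ->
  tact X (act_at k Y v) - act_at k Y (tact X v) = act_at k (X *m Y - Y *m X) v.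
Proof.
move=> hX hY; rewrite /tact linear_sum -sumrB (bigD1 k) //= act_at_bracket //.
by rewrite big1 ?addr0 // => l lk; rewrite act_atC // subrr.
Qed.

Lemma tact_bracket X Y (v : tensor) : \tr X = 0 -> \tr Y = 0 ->
  tact X (tact Y v) - tact Y (tact X v) = tact (X *m Y - Y *m X) v.
Proof.
move=> hX hY; rewrite {2 4 5}/tact linear_sum -sumrB.
by apply: eq_bigr => k _; rewrite act_at_tact_bracket.
Qed.

Lemma tr_delta (i j : 'I_N) : i != j -> \tr (delta_mx i j : 'M[C]_N) = 0.
Proof.
move=> ij; rewrite /mxtrace big1 // => k _; rewrite mxE.
by case: eqP => // ->; rewrite (negbTE ij).
Qed.

Lemma cartan_tr (h : 'M[C]_N) : cartan h -> \tr h = 0.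
Proof. by case/andP => _ /eqP. Qed.

Lemma cartan_delta (h : 'M[C]_N) i j : cartan h ->
  h *m delta_mx i j - delta_mx i j *m h = (h i i - h j j) *: delta_mx i j.
Proof.
case/andP => /is_diag_mxP hd _; apply/matrixP => a b; rewrite !mxE.
rewrite (bigD1 i) //= mxE eqxx big1 => [|c ci]; last by rewrite mxE (negbTE ci) mulr0.
rewrite (bigD1 j) //= [X in _ - (X * _ + _)]mxE eqxx.
rewrite [X in _ - (_ + X)]big1 => [|c cj]; last by rewrite mxE (negbTE cj) andbF mul0r.
rewrite !addr0 andbT /=; have [->|ai] := eqVneq a i; last first.
  by rewrite (hd a i) // !(mul0r, mulr0) subr0.
have [->|bj] := eqVneq b j; first by rewrite !mulr1 mul1r.
by rewrite (hd j b) 1?eq_sym // !(mul0r, mulr0) subr0.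
Qed.

Lemma gformC (A B : 'M[C]_N) : gform A B = gform B A.
Proof. exact: mxtrace_mulC. Qed.

Lemma gform_delta (A : 'M[C]_N) i : gform A (delta_mx i i) = A i i.
Proof.
rewrite /gform /mxtrace (bigD1 i) //= big1 ?addr0 => [|k ki].
  rewrite mxE (bigD1 i) //= mxE !eqxx mulr1 big1 ?addr0 // => k ki.
  by rewrite mxE (negbTE ki) mulr0.
by rewrite mxE big1 // => l _; rewrite mxE (negbTE ki) andbF mulr0.
Qed.

Lemma gform_rootH (A : 'M[C]_N) a : gform A (rootH C a) = A a.1 a.1 - A a.2 a.2.
Proof. by rewrite -!gform_delta /gform /rootH mulmxBr raddfB. Qed.

Lemma gformDl (A B D : 'M[C]_N) : gform (A + B) D = gform A D + gform B D.
Proof. by rewrite /gform mulmxDl mxtraceD. Qed.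
Lemma gformBl (A B D : 'M[C]_N) : gform (A - B) D = gform A D - gform B D.
Proof. by rewrite /gform mulmxBl raddfB. Qed.
Lemma gformZl c (A D : 'M[C]_N) : gform (c *: A) D = c * gform A D.
Proof. by rewrite /gform -scalemxAl mxtraceZ. Qed.

Lemma gform_rootHH (a : slroot r) : a.1 != a.2 -> gform (rootH C a) (rootH C a) = 2.
Proof.
move=> ne; rewrite gform_rootH !mxE !eqxx (negbTE ne) eq_sym (negbTE ne) /=.
by ring.
Qed.

Section Root.
Variable a : slroot r.
Hypothesis a12 : a.1 != a.2.

Let a21 : a.2 != a.1. Proof. by rewrite eq_sym. Qed.

Lemma tr_rootE : \tr (rootE C a) = 0. Proof. exact: tr_delta. Qed.
Lemma tr_rootF : \tr (rootF C a) = 0. Proof. exact: tr_delta. Qed.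

Lemma cartan_rootE h : cartan h ->
  h *m rootE C a - rootE C a *m h = gform h (rootH C a) *: rootE C a.
Proof. by move=> hc; rewrite cartan_delta // gform_rootH. Qed.

Lemma cartan_rootF h : cartan h ->
  h *m rootF C a - rootF C a *m h = - gform h (rootH C a) *: rootF C a.
Proof. by move=> hc; rewrite cartan_delta // gform_rootH opprB. Qed.

Lemma rootEF : rootE C a *m rootF C a - rootF C a *m rootE C a = rootH C a.
Proof. by rewrite /rootE /rootF !mul_delta_mx. Qed.

Lemma sl2_triple_act_at k :
  sl2_triple (@act_at C r n V k (rootE C a)) (act_at k (rootF C a))
    (act_at k (rootH C a)).
Proof.
have hc := rootH_cartan C a; have ht := tr_rootH C a.
split=> v.
- have := act_at_bracket k v ht tr_rootE; rewrite cartan_rootE // gform_rootHH //.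
  by rewrite act_atZ ?tr_rootE // => <-; rewrite addrC subrK.
- have := act_at_bracket k v ht tr_rootF; rewrite cartan_rootF // gform_rootHH //.
  by rewrite act_atZ ?tr_rootF // scaleNr => <-; rewrite addrC subrK.
- have := act_at_bracket k v tr_rootE tr_rootF; rewrite rootEF => <-.
  by rewrite addrC subrK.
Qed.

Lemma tactZ c A (v : tensor) : \tr A = 0 -> tact (c *: A) v = c *: tact A v.
Proof.
by move=> hA; rewrite /tact scaler_sumr; apply: eq_bigr => k _; rewrite act_atZ.
Qed.

Lemma sl2_triple_tact :
  sl2_triple (@tact C r n V (rootE C a)) (tact (rootF C a)) (tact (rootH C a)).
Proof.
have hc := rootH_cartan C a; have ht := tr_rootH C a.
split=> v.
- have := tact_bracket v ht tr_rootE; rewrite cartan_rootE // gform_rootHH //.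
  by rewrite tactZ ?tr_rootE // => <-; rewrite addrC subrK.
- have := tact_bracket v ht tr_rootF; rewrite cartan_rootF // gform_rootHH //.
  by rewrite tactZ ?tr_rootF // scaleNr => <-; rewrite addrC subrK.
- have := tact_bracket v tr_rootE tr_rootF; rewrite rootEF => <-.
  by rewrite addrC subrK.
Qed.

Lemma tact_cartan_E h (v : tensor) : cartan h ->
  tact h (tact (rootE C a) v)
  = tact (rootE C a) (tact h v) + gform h (rootH C a) *: tact (rootE C a) v.
Proof.
move=> hc; have := tact_bracket v (cartan_tr hc) tr_rootE.
rewrite cartan_rootE // tactZ ?tr_rootE // => <-.
by rewrite addrC subrK.
Qed.

Lemma tact_cartan_F h (v : tensor) : cartan h ->
  tact h (tact (rootF C a) v)
  = tact (rootF C a) (tact h v) - gform h (rootH C a) *: tact (rootF C a) v.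
Proof.
move=> hc; have := tact_bracket v (cartan_tr hc) tr_rootF.
rewrite cartan_rootF // tactZ ?tr_rootF // scaleNr => <-.
by rewrite addrC subrK.
Qed.

Lemma act_at_cartan_E k h (v : tensor) : cartan h ->
  tact h (act_at k (rootE C a) v)
  = act_at k (rootE C a) (tact h v) + gform h (rootH C a) *: act_at k (rootE C a) v.
Proof.
move=> hc; have := act_at_tact_bracket k v (cartan_tr hc) tr_rootE.
by rewrite cartan_rootE // act_atZ ?tr_rootE // => <-; rewrite addrC subrK.
Qed.

Lemma act_at_cartan_F k h (v : tensor) : cartan h ->
  tact h (act_at k (rootF C a) v)
  = act_at k (rootF C a) (tact h v) - gform h (rootH C a) *: act_at k (rootF C a) v.
Proof.
move=> hc; have := act_at_tact_bracket k v (cartan_tr hc) tr_rootF.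
by rewrite cartan_rootF // act_atZ ?tr_rootF // scaleNr => <-; rewrite addrC subrK.
Qed.

End Root.

Lemma cartanC (h h' : 'M[C]_N) : cartan h -> cartan h' -> h *m h' - h' *m h = 0.
Proof.
case/andP => /diag_mxP[d ->] _ /andP[/diag_mxP[d' ->] _].
by rewrite diag_mxC subrr.
Qed.

Lemma act_at_cartanC k l h h' (v : tensor) : cartan h -> cartan h' ->
  act_at k h (act_at l h' v) = act_at l h' (act_at k h v).
Proof.
move=> hc hc'; have [<-|kl] := eqVneq k l; last exact: act_atC.
apply/eqP; rewrite -subr_eq0 act_at_bracket ?cartan_tr // cartanC //.
by rewrite act_at0.
Qed.

Lemma tact_act_at_cartan k h h' (v : tensor) : cartan h -> cartan h' ->
  tact h (act_at k h' v) = act_at k h' (tact h v).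
Proof.
move=> hc hc'; rewrite /tact linear_sum.
by apply: eq_bigr => l _; rewrite act_at_cartanC.
Qed.

Variable nu : 'M[C]_N.
Local Notation W := (wspace V nu).

Lemma wspace_stable (f : {linear tensor -> tensor}) :
  (forall h v, cartan h -> tact h (f v) = f (tact h v)) ->
  forall v, v \in W -> f v \in W.
Proof.
move=> fC v /mem_wspace vW; apply/mem_wspace => h hc.
by rewrite fC // vW // linearZ.
Qed.

Lemma wspace_act_at k h : cartan h -> forall v, v \in W -> act_at k h v \in W.
Proof.
by move=> hc; apply: wspace_stable => h' v hc'; rewrite tact_act_at_cartan.
Qed.

Lemma wspace_FE (a : slroot r) : a.1 != a.2 -> forall v, v \in W ->
  tact (rootF C a) (tact (rootE C a) v) \in W.
Proof.
move=> a12; apply: (@wspace_stable (tact (rootF C a) \o tact (rootE C a))).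
move=> h v hc /=; rewrite tact_cartan_F // tact_cartan_E // linearD.
by rewrite /= [tact _ (_ *: _)]linearZ /= addrK.
Qed.

Lemma wspace_act_EF k l (a : slroot r) : a.1 != a.2 -> forall v, v \in W ->
  act_at k (rootE C a) (act_at l (rootF C a) v) \in W.
Proof.
move=> a12.
apply: (@wspace_stable (act_at k (rootE C a) \o act_at l (rootF C a))) => h v hc /=.
rewrite act_at_cartan_E // act_at_cartan_F // linearB.
by rewrite /= [act_at k _ (_ *: _)]linearZ /= subrK.
Qed.

Lemma wspace_act_FE k l (a : slroot r) : a.1 != a.2 -> forall v, v \in W ->
  act_at k (rootF C a) (act_at l (rootE C a) v) \in W.
Proof.
move=> a12.
apply: (@wspace_stable (act_at k (rootF C a) \o act_at l (rootE C a))) => h v hc /=.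
rewrite act_at_cartan_F // act_at_cartan_E // linearD.
by rewrite /= [act_at k _ (_ *: _)]linearZ /= addrK.
Qed.

End TensorOperators.

(** * The dynamical operators *)

(** Chu-Vandermonde, rising in [b] and falling in [c]. By Pascal's rule the sum for [k + 1] splits
    into [c - k] times the sum for [k] at [(b, c)] and [b] times the sum for [k] at
    [(b + 1, c - 1)]. *)
Lemma vandermonde_rising (C : comRingType) k (b c : C) :
  \sum_(i < k.+1) 'C(k, i)%:R * (\prod_(j < i) (b + j%:R))
      * \prod_(i <= j < k) (c - j%:R)
  = \prod_(j < k) (c + b - j%:R).
Proof.
elim: k b c => [|k IH] b c.
  by rewrite big_ord1 !big_ord0 big_geq // bin0 !mulr1.
pose G i := (\prod_(j < i) (b + j%:R)) * \prod_(i <= j < k.+1) (c - j%:R).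
have GE i : 'C(k.+1, i)%:R * (\prod_(j < i) (b + j%:R)) * \prod_(i <= j < k.+1) (c - j%:R)
    = 'C(k.+1, i)%:R * G i by rewrite mulrA.
under eq_bigr do rewrite GE.
rewrite [LHS]big_ord_recl /= ?bin0.
under eq_bigr do rewrite /bump add1n binS natrD mulrDl.
rewrite big_split /= addrA.
have -> : 1%:R * G 0%N + \sum_(i < k.+1) 'C(k, i.+1)%:R * G i.+1
        = (c - k%:R) * \prod_(j < k) (c + b - j%:R).
  transitivity (\sum_(i < k.+2) 'C(k, i)%:R * G i).
    by rewrite [RHS]big_ord_recl ?bin0.
  rewrite big_ord_recr /= bin_small // mul0r addr0 -IH mulr_sumr.
  apply: eq_bigr => i _; rewrite /G big_nat_recr /=; last by rewrite -ltnS.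
  by rewrite !mulrA mulrC !mulrA.
have -> : \sum_(i < k.+1) 'C(k, i)%:R * G i.+1
        = b * \prod_(j < k) (c + b - j%:R).
  have -> : \prod_(j < k) (c + b - j%:R) = \prod_(j < k) (c - 1 + (b + 1) - j%:R).
    by apply: eq_bigr => j _; ring.
  rewrite -IH mulr_sumr; apply: eq_bigr => i _; rewrite /G big_ord_recl big_add1 /=.
  under eq_bigr do rewrite /bump add1n mulrS addrA.
  under [X in _ * (_ * X) = _]eq_bigr do rewrite mulrS opprD addrA.
  rewrite addr0; ring.
rewrite -mulrDl [RHS]big_ord_recr /= mulrC; congr (_ * _); ring.
Qed.

(** * Multiplicities of the [sl_2]-decomposition of [V[nu]_a] *)

Section Sl2Multiplicity.
Variables (C : numClosedFieldType) (r n : nat) (V : 'I_n -> slMod C r).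
Local Notation N := r.+1.
Local Notation tensor := (tensor V).
Variables (nu : 'M[C]_N) (a : slroot r).
Hypothesis a12 : a.1 != a.2.
Local Notation W := (wspace V nu).
Local Notation E := (@tact C r n V (rootE C a)).
Local Notation F := (@tact C r n V (rootF C a)).
Local Notation H := (@tact C r n V (rootH C a)).
Local Notation h := (gform nu (rootH C a)).
Local Notation D := (\dim {: tensor}).

Let sl2 := @sl2_triple_tact C r n V a a12.

Lemma wspace_rootH w : w \in W -> H w = h *: w.
Proof. by move=> /mem_wspace; apply; exact: rootH_cartan. Qed.

Lemma gform_string (k : nat) :
  gform (nu + k%:R *: rootH C a) (rootH C a) = h + (2 * k)%:R.
Proof. by rewrite gformDl gformZl gform_rootHH // natrM mulrC. Qed.

(** Passes between a family graded by [k] and the double family that [sl2_decomposition] asks for; a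
    general commutative monoid covers the sum of the subspaces and that of their dimensions. *)
Lemma big_regroup (R : Type) (idx : R) (op : Monoid.com_law idx) d (k : 'I_d -> 'I_D)
    (G : 'I_d -> R) :
  let m := [ffun K => #|[set i | k i == K]%SET|] in
  \big[op/idx]_(K < D) \big[op/idx]_(j < m K)
     G (enum_val (cast_ord (ffunE (fun K => #|[set i | k i == K]%SET|) K) j))
  = \big[op/idx]_i G i.
Proof.
move=> m; rewrite [RHS](partition_big k xpredT) //=; apply: eq_bigr => K _.
rewrite (eq_bigl (mem [set i | k i == K]%SET)); last by move=> i; rewrite !inE.
rewrite [RHS]big_enum_val; set e := ffunE _ _.
rewrite (reindex (cast_ord (esym e))) /=; last first.
  by exists (cast_ord e) => j _; rewrite ?cast_ordK ?cast_ordKV.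
by apply: eq_bigr => j _; rewrite cast_ordKV.
Qed.

(** A decomposition exists, so [xget] does not return its default value. *)
Lemma sl2_multP : sl2_decomposition nu a (sl2_mult V nu a).
Proof.
have [d [L [k [Lspan Lirr kD Ld]]]] :=
  sl2_decomposition_exists sl2 wspace_rootH (@wspace_FE _ _ _ V nu a a12).
pose k' i := Ordinal (kD i).
pose m := [ffun K => #|[set i | k' i == K]%SET|].
apply: (@xgetPex _ _ [set d | sl2_decomposition nu a d]); exists m.
pose L' (K : 'I_D) (j : 'I_(m K)) :=
  L (enum_val (cast_ord (ffunE (fun K => #|[set i | k' i == K]%SET|) K) j)).
have LE : (\sum_K \sum_j L' K j)%VS = (\sum_i L i)%VS.
  exact: (big_regroup _ k' L).
exists (\sum_i L i)%VS, L'; split.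
- exact: Lspan.
- move=> K j; rewrite gform_string /L'; set i := enum_val _.
  have : i \in [set i | k' i == K]%SET by exact: enum_valP.
  rewrite inE => /eqP ki; have := Lirr i.
  by rewrite (_ : k i = K) // -ki.
- by rewrite LE.
- move: Ld; rewrite !directvE /= LE => /eqP->.
  by apply/eqP; rewrite (big_regroup _ k' (fun i => \dim (L i))).
Qed.

Definition mult_index : Type := {k : 'I_D & 'I_(sl2_mult V nu a k)}.
HB.instance Definition _ := Finite.on mult_index.
Definition mult_deg (i : mult_index) : nat := tag i.

Lemma sl2_mult_basis : exists (v : mult_index -> tensor) p,
    [/\ forall i, highest_vector E F H (v i) (p i),
        forall i, (p i)%:R = h + (2 * mult_deg i)%:R,
        forall i, iter (mult_deg i) F (v i) \in W,
        forall w, w \in W -> exists c, w = \sum_i c i *: iter (mult_deg i) F (v i)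
      & forall c, \sum_i c i *: iter (mult_deg i) F (v i) = 0 -> forall i, c i = 0].
Proof.
have [M [L [Mspan Lirr ME Ld]]] := sl2_multP.
pose L' (i : mult_index) := L (tag i) (tagged i).
have LE : (\sum_k \sum_j L k j)%VS = (\sum_i L' i)%VS by rewrite sig_big_dep.
apply: (sl2_decomposition_basis sl2 (L := L') (k := mult_deg)).
- by rewrite -LE -ME; exact: Mspan.
- by move=> i; rewrite -gform_string; exact: Lirr.
- by move: Ld; rewrite !directvE /= LE sig_big_dep.
- exact: wspace_rootH.
- rewrite -LE -ME => w wM Hw; apply/mem_wspace => g gc.
  (* [g] is split into a multiple of [H_a] and a part [g'] orthogonal to [a], the 2 being [(a, a)].
     The part [g'] commutes with the [sl_2]-subalgebra, hence acts on the whole generated module by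
     the scalar that it has on [V[nu]]. *)
  pose c := gform g (rootH C a) / 2.
  pose g' := g - c *: rootH C a.
  have gE : g = c *: rootH C a + g' by rewrite addrC subrK.
  have ct : \tr (rootH C a) = 0 by exact: tr_rootH.
  have gt : \tr g' = 0 by rewrite raddfB /= mxtraceZ ct mulr0 subr0 cartan_tr.
  have g'c : cartan g'.
    rewrite /cartan gt eqxx andbT; apply/is_diag_mxP => i j ij.
    have /andP[/is_diag_mxP g0 _] := gc; have /andP[/is_diag_mxP r0 _] := rootH_cartan C a.
    rewrite /g' mxE [X in _ + X]mxE [X in - X]mxE.
    by rewrite g0 // r0 // mulr0 subr0.
  have g'a : gform g' (rootH C a) = 0.
    by rewrite gformBl gformZl gform_rootHH // divfK ?subrr.
  have : w \in lker (linfun (@tact C r n V g' \- (gform nu g' \*: (idfun : tensor -> tensor)))).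
    apply: (subvP _ _ wM); case: Mspan => WM Mst Mmin; apply: Mmin.
      move=> y; rewrite !memv_ker !lfunE /= !subr_eq0 => /eqP gy.
      rewrite tact_cartan_E // tact_cartan_F // g'a !scale0r addr0 subr0 gy.
      have -> : tact g' (H y) = H (tact g' y).
        apply/eqP; rewrite -subr_eq0 tact_bracket // cartanC ?rootH_cartan //.
        by rewrite /tact big1 // => k _; rewrite act_at0.
      by rewrite gy ![tact _ (_ *: _)]linearZ.
    apply/subvP => y /mem_wspace yW; rewrite memv_ker lfunE /= subr_eq0.
    by rewrite yW.
  rewrite memv_ker lfunE /= subr_eq0 => /eqP g'w.
  rewrite {1}gE tact_lin_l // Hw g'w scalerA -scalerDl; congr (_ *: _).
  by rewrite [in RHS]gE [RHS]gformC gformDl gformZl ![gform _ nu]gformC.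
Qed.

End Sl2Multiplicity.

Section DynamicalOperator.
Variables (C : numClosedFieldType) (r n : nat) (V : 'I_n -> slMod C r).
Local Notation N := r.+1.
Local Notation tensor := (tensor V).
Local Notation D := (\dim {: tensor}).

Lemma pfun_linear t m (a : slroot r) : linear (@pfun C r n V t m a).
Proof.
move=> c v w; rewrite /pfun scaler_sumr -big_split /=; apply: eq_bigr => i _.
have itL (f : {linear tensor -> tensor}) k x y :
    iter k f (c *: x + y) = c *: iter k f x + iter k f y.
  by elim: k => //= k ->; rewrite linearP.
by rewrite !itL scalerDr !scalerA [_ * c]mulrC.
Qed.
HB.instance Definition _ t m a :=
  GRing.isLinear.Build C tensor tensor _ (@pfun C r n V t m a) (pfun_linear t m a).

Lemma Bop_linear (nu lam : 'M[C]_N) a : linear (@Bop C r n V nu lam a).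
Proof. exact: pfun_linear. Qed.
HB.instance Definition _ nu lam a :=
  GRing.isLinear.Build C tensor tensor _ (@Bop C r n V nu lam a)
    (Bop_linear nu lam a).

Variable nu : 'M[C]_N.
Local Notation W := (wspace V nu).

Section OneRoot.
Variable a : slroot r.
Hypothesis a12 : a.1 != a.2.
Local Notation E := (@tact C r n V (rootE C a)).
Local Notation F := (@tact C r n V (rootF C a)).
Local Notation H := (@tact C r n V (rootH C a)).
Local Notation h := (gform nu (rootH C a)).

Let sl2 := @sl2_triple_tact C r n V a a12.

(** [half_shift] and [half_unshift] are the numerators and denominators in the eigenvalues of [B].
    The Gamma functions of [X] have the argument [1 - half_unshift / kappa] in the numerator and
    [1 - half_shift / kappa] in the denominator. *)
Definition half_shift (lam : 'M[C]_N) (j : nat) : C :=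
  gform (lam + 2^-1 *: (nu + j%:R *: rootH C a)) (rootH C a).
Definition half_unshift (lam : 'M[C]_N) (j : nat) : C :=
  gform (lam - 2^-1 *: (nu + j%:R *: rootH C a)) (rootH C a).

Lemma half_shiftE lam j :
  half_shift lam j = gform lam (rootH C a) + h / 2 + j%:R.
Proof.
rewrite /half_shift gformDl gformZl gform_string // natrM mulrDr mulrA.
by rewrite mulVf ?pnatr_eq0 // mul1r addrA [h / 2]mulrC.
Qed.

Lemma half_unshiftE lam j :
  half_unshift lam j = gform lam (rootH C a) - h / 2 - j%:R.
Proof.
rewrite /half_unshift gformBl gformZl gform_string // natrM mulrDr mulrA.
by rewrite mulVf ?pnatr_eq0 // mul1r opprD addrA [h / 2]mulrC.
Qed.

Lemma Bop_wspace lam v : v \in W -> Bop nu lam a v \in W.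
Proof.
move=> vW; apply: memv_suml => i _; rewrite memvZ // (iterF_iterE sl2).
elim: (iota 0 i) => // j S IH; rewrite FE_shift_prod_cons.
set w := FE_shift_prod _ _ _ _ _ in IH *; rewrite /FE_shift /=.
rewrite (wspace_rootH a IH); apply: memvB; last exact: memvZ.
by apply: memvB; [exact: wspace_FE|rewrite !memvZ].
Qed.

Lemma highest_vector_string v p k : highest_vector E F H v p -> (k <= p)%N ->
  let y := iter k F v in
  H y = (p%:R - (2 * k)%:R) *: y /\ F (E y) = (k * (p - k).+1)%:R *: y.
Proof.
move=> hv kp y; split; first exact: (H_hw sl2 hv).
have [Ev Hv _ _] := hv; rewrite /y; case: k kp y => [|k] kp y.
  by rewrite /= Ev linear0 mul0n scale0r.
rewrite (E_iterF sl2 _ Ev Hv) linearZ /= natrM; congr (_ * _ *: _).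
by rewrite -natrB ?(ltnW kp) // subnS prednK // subn_gt0.
Qed.

Lemma iterF_iterE_hw v p k i : highest_vector E F H v p -> (k <= p)%N ->
  let y := iter k F v in
  iter i F (iter i E y)
  = (\prod_(j < i) ((k%:R - j%:R) * (p - k + j).+1%:R)) *: y.
Proof.
move=> hv kp y; have [Hy Xy] := highest_vector_string hv kp.
have ys : string_vector E F H p.+1 k (p - k) y.
  split; rewrite ?ltnS ?leq_subr //.
  by rewrite /y /= Hy natrB // mul2n -addnn natrD opprD addrA.
rewrite (iterF_iterE sl2); elim: i => [|i IH].
  by rewrite big_ord0 scale1r.
rewrite -addn1 iotaD /FE_shift_prod foldr_cat add0n /= (FE_shift_string _ ys).
have := linearZ_LR (FE_shift_prod E F H (iota 0 i)); rewrite /= /FE_shift_prod => ->.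
by rewrite addn1 big_ord_recr /= -/(FE_shift_prod _ _ _ _ _) IH scalerA mulrC.
Qed.

Lemma falling_binomial k i : (i <= k)%N ->
  (i`!)%:R^-1 * \prod_(j < i) (k%:R - j%:R) = 'C(k, i)%:R :> C.
Proof.
move=> ik; have -> : \prod_(j < i) (k%:R - j%:R) = (k ^_ i)%:R :> C.
  rewrite ffact_prod natr_prod; apply: eq_bigr => j _; rewrite natrB //.
  exact: leq_trans (ltnW (ltn_ord j)) ik.
by rewrite -bin_ffact natrM mulrC mulfK // pnatr_eq0 -lt0n fact_gt0.
Qed.

(** With [b = h + k + 1] and [c = (lam, a) - h / 2 - 1], the term of index [i] is ['C(k, i)] times
    the product of the [(b + j) / (c - j)], [j < i]; terms with [i > k] vanish. Multiplied by the
    product of the [c - j], [j < k], the sum is the left side of [vandermonde_rising]. *)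
Lemma Bop_hw lam v p k : highest_vector E F H v p -> p%:R = h + (2 * k)%:R ->
  iter k F v != 0 -> (forall j, (1 <= j <= k)%N -> half_unshift lam j != 0) ->
  Bop nu lam a (iter k F v)
  = (\prod_(1 <= j < k.+1) (half_shift lam j / half_unshift lam j)) *: iter k F v.
Proof.
move=> hv pE Fk0 B0; have kD := hw_string_lt_dim sl2 hv Fk0.
have kp : (k <= p)%N.
  rewrite leqNgt; apply: contra Fk0 => pk; have [_ _ _ Fp] := hv.
  rewrite -(subnK pk) iterD Fp; elim: (k - p.+1)%N => //= m /eqP->.
  by rewrite linear0.
have hE : h = p%:R - (2 * k)%:R by rewrite pE addrK.
rewrite /Bop /pfun.
set t := gform (lam + _) _ - 1.
pose b : C := h + k%:R + 1; pose c := t - h.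
have tE : t = gform lam (rootH C a) + h / 2 - 1.
  by rewrite /t gformDl gformZl [2^-1 * _]mulrC.
have cE j : c - j%:R = half_unshift lam j.+1.
  rewrite half_unshiftE /c tE mulrS.
  by field.
have c0 j : (j < k)%N -> c - j%:R != 0 by move=> jk; rewrite cE B0.
under [LHS]eq_bigr do rewrite (iterF_iterE_hw _ hv kp) scalerA.
rewrite -scaler_suml; congr (_ *: _).
pose G i := 'C(k, i)%:R * (\prod_(j < i) (b + j%:R)) * \prod_(j < i) (c - j%:R)^-1.
transitivity (\sum_(i < k.+1) G i).
  rewrite (big_ord_widen _ G kD) [RHS]big_mkcond; apply: eq_bigr => i _.
  rewrite ltnS; case: leqP => ik; last first.
    by rewrite (bigD1 (Ordinal ik)) // [X in _ * X](bigD1 (Ordinal ik)) //= subrr !(mul0r, mulr0).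
  rewrite big_split /= /G -(falling_binomial ik) /c.
  have -> : \prod_(j < i) (p - k + j).+1%:R = \prod_(j < i) (b + j%:R).
    apply: eq_bigr => j _; rewrite /b hE -natr1 natrD natrB // mul2n -addnn natrD.
    ring.
  by rewrite mulrAC -!mulrA; congr (_ * _); rewrite mulrCA mulrC -mulrA.
have P0 : \prod_(j < k) (c - j%:R) != 0.
  by apply/prodf_neq0 => j _; exact: c0.
apply: (mulIf P0); rewrite mulr_suml.
transitivity (\prod_(j < k) (c + b - j%:R)).
  rewrite -[RHS]vandermonde_rising; apply: eq_bigr => i _.
  have ik : (i <= k)%N by rewrite -ltnS.
  rewrite /G -!mulrA; congr (_ * (_ * _)).
  rewrite -!(big_mkord xpredT (fun j => c - j%:R)) -(big_mkord xpredT (fun j => (c - j%:R)^-1)).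
  rewrite [X in _ * X = _](big_cat_nat _ (n := i)) //= mulrA -big_split /=
    big_nat big1 ?mul1r // => j /andP[_ ji].
  by rewrite mulVf // c0 // (leq_trans ji).
rewrite -(big_mkord xpredT (fun j => c - j%:R)) big_add1 /= -big_split /= big_mkord.
(* The left product runs downwards: its factor [c + b - j] is [half_shift] at [k - j]. *)
rewrite (reindex_inj rev_ord_inj) /=; apply: eq_bigr => j _.
rewrite -cE divfK ?c0 // half_shiftE /c /b tE.
rewrite natrB // -addn1 natrD; ring.
Qed.

Lemma mult_deg_lt (i : mult_index V nu a) : (0 < sl2_mult V nu a (tag i))%N.
Proof. by case: i => k j /=; apply: leq_ltn_trans (ltn_ord j). Qed.

Lemma Bop_det lam d (v : d.-tuple tensor) : basis_of W v ->
  (forall (k : 'I_D) j, (0 < sl2_mult V nu a k)%N -> (1 <= j <= k)%N ->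
     half_unshift lam j != 0) ->
  \det (opmx v (Bop nu lam a))
  = \prod_(k < D) (\prod_(1 <= j < k.+1) (half_shift lam j / half_unshift lam j))
      ^+ sl2_mult V nu a k.
Proof.
move=> bv B0; have [w [p [hw pE yW ygen yfree]]] := sl2_mult_basis V nu a12.
have y0 i : iter (mult_deg i) F (w i) != 0.
  apply/negP => /eqP y0; have := yfree (fun j => (j == i)%:R) _ i.
  rewrite eqxx (bigD1 i) //= eqxx y0 scaler0 add0r big1 => [|j /negbTE->].
    by move=> /(_ erefl)/eqP; rewrite oner_eq0.
  by rewrite scale0r.
pose s (i : mult_index V nu a) :=
  \prod_(1 <= j < (mult_deg i).+1) (half_shift lam j / half_unshift lam j).
have [||||-> _] := opmx_eigen bv (y := fun i => iter (mult_deg i) F (w i)) (s := s) (f := Bop nu lam a).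
- exact: yW.
- exact: ygen.
- exact: yfree.
- move=> i; apply: (Bop_hw (hw i) (pE i) (y0 i)) => j jk.
  exact: (B0 (tag i) j (mult_deg_lt i) jk).
transitivity (\prod_(k < D) \prod_(j < sl2_mult V nu a k)
    \prod_(1 <= j < k.+1) (half_shift lam j / half_unshift lam j)).
  by rewrite sig_big_dep.
by apply: eq_bigr => k _; rewrite prodr_const card_ord.
Qed.

(** If [E^k] is nonzero on [V[nu]], some string has at least [k] vectors above [V[nu]]; a
    denominator with [j < k] is then a [half_unshift] at [j + 1] covered by the hypothesis. *)
Lemma Bop_definedP lam :
  (forall (k : 'I_D) j, (0 < sl2_mult V nu a k)%N -> (1 <= j <= k)%N ->
     half_unshift lam j != 0) ->
  Bop_defined V nu lam a.
Proof.
move=> B0 k j jk [w wW Ek0].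
have [v [p [hv pE yW ygen yfree]]] := sl2_mult_basis V nu a12.
have [i ki] : exists i : mult_index V nu a, (k <= mult_deg i)%N.
  apply: contrapT => /forallNP kN; case/eqP: Ek0.
  have [c ->] := ygen _ wW.
  have itS (s : seq (mult_index V nu a)) g :
      iter k E (\sum_(i <- s) g i) = \sum_(i <- s) iter k E (g i).
    by elim: k {jk kN} => //= k ->; rewrite linear_sum.
  rewrite itS big1 // => i _; rewrite iterZ (iterE_iterF_lt sl2 (hv i)) ?scaler0 //.
  by rewrite ltnNge; apply/negP; exact: kN.
have := B0 (tag i) j.+1 (mult_deg_lt i); rewrite /= (leq_trans jk ki) => /(_ isT).
rewrite half_unshiftE gformDl gformZl -natr1.
by congr (_ != 0); field.
Qed.

End OneRoot.
End DynamicalOperator.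

(** * Products of dynamical operators and traces on [V[nu]] *)

Section WordsAndTraces.
Variables (C : numClosedFieldType) (r n : nat) (V : 'I_n -> slMod C r).
Local Notation N := r.+1.
Local Notation tensor := (tensor V).
Variable nu : 'M[C]_N.
Local Notation W := (wspace V nu).

Definition Broots (lam : 'M[C]_N) (s : seq (slroot r)) (v : tensor) : tensor :=
  foldl (fun v' a => Bop nu lam a v') v s.

Lemma Broots_linear lam s : linear (Broots lam s).
Proof. by elim: s => //= a s IH c v w; rewrite /Broots /= linearP; exact: IH. Qed.
HB.instance Definition _ lam s :=
  GRing.isLinear.Build C tensor tensor _ (Broots lam s) (Broots_linear lam s).

Lemma Broots_wspace lam s : {in s, forall a, a.1 != a.2} ->
  forall v, v \in W -> Broots lam s v \in W.
Proof.
elim: s => //= a s IH sP v vW; apply: IH => [b bs|].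
  by apply: sP; rewrite in_cons bs orbT.
by apply: Bop_wspace => //; apply: sP; rewrite mem_head.
Qed.

Lemma Broots_det lam s d (v : d.-tuple tensor) : basis_of W v ->
  {in s, forall a, a.1 != a.2} ->
  \det (opmx v (Broots lam s)) = \prod_(a <- s) \det (opmx v (Bop nu lam a)).
Proof.
move=> bv; elim: s => [|a s IH] sP.
  have -> : Broots lam [::] = idfun by [].
  by rewrite (opmx1 bv) det1 big_nil.
have -> : Broots lam (a :: s) = Broots lam s \o Bop nu lam a by [].
have s'P : {in s, forall a, a.1 != a.2}.
  by move=> b bs; apply: sP; rewrite in_cons bs orbT.
rewrite (opmx_comp bv) ?det_mulmx ?IH ?big_cons //.
- by move=> w; apply: Bop_wspace; apply: sP; rewrite mem_head.
- exact: Broots_wspace.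
Qed.

Local Notation tr := (@trace_on C r n V W).

Lemma trace_onD f g : tr (fun v => f v + g v) = tr f + tr g.
Proof.
by rewrite /trace_on -big_split; apply: eq_bigr => i _; rewrite linearD.
Qed.

Lemma trace_onZ c f : tr (fun v => c *: f v) = c * tr f.
Proof.
by rewrite /trace_on mulr_sumr; apply: eq_bigr => i _; rewrite linearZ.
Qed.

Lemma trace_on_sum (I : Type) (s : seq I) (P : pred I) (f : I -> tensor -> tensor) :
  tr (fun v => \sum_(i <- s | P i) f i v) = \sum_(i <- s | P i) tr (f i).
Proof.
rewrite /trace_on exchange_big /=; apply: eq_bigr => i _.
by rewrite linear_sum.
Qed.

Lemma trace_onE f : tr f = \tr (opmx (vbasis W) f).
Proof. by apply: eq_bigr => i _; rewrite mxE. Qed.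

Lemma trace_on_ext f g : f =1 g -> tr f = tr g.
Proof. by move=> fg; apply: eq_bigr => i _; rewrite fg. Qed.

Lemma trace_on_comm (f g : {linear tensor -> tensor}) :
  (forall v, v \in W -> f v \in W) -> (forall v, v \in W -> g v \in W) ->
  tr (g \o f) = tr (f \o g).
Proof.
move=> fW gW; rewrite !trace_onE (opmx_comp (vbasisP W) fW gW) (opmx_comp (vbasisP W) gW fW).
exact: mxtrace_mulC.
Qed.

(** The commutator with [H_a] on the factor [k] multiplies this operator by 2, and a commutator of
    operators preserving [V[nu]] has trace 0. *)
Lemma trace_act_EF k l (a : slroot r) : k != l -> a.1 != a.2 ->
  tr (fun v => act_at k (rootE C a) (act_at l (rootF C a) v)) = 0.
Proof.
move=> kl a12; have [HE _ _] := sl2_triple_act_at V a12 k.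
pose X : {linear tensor -> tensor} := act_at k (rootE C a) \o act_at l (rootF C a).
pose h : {linear tensor -> tensor} := act_at k (rootH C a).
have hc := rootH_cartan C a.
have := @trace_on_comm X h (wspace_act_EF (V := V) (nu := nu) k l a12)
  (wspace_act_at (V := V) (nu := nu) k hc).
have -> : tr (h \o X) = tr (X \o h) + 2 * tr X.
  rewrite -trace_onZ -trace_onD; apply: trace_on_ext => v /=.
  by rewrite HE [act_at k (rootH C a) (act_at l _ _)]act_atC.
by move/eqP; rewrite -subr_eq0 addrAC subrr add0r mulf_eq0 pnatr_eq0 /= => /eqP.
Qed.

Lemma trace_act_FE k l (a : slroot r) : k != l -> a.1 != a.2 ->
  tr (fun v => act_at k (rootF C a) (act_at l (rootE C a) v)) = 0.
Proof.
move=> kl a12; rewrite -(trace_act_EF (k := l) (l := k) _ a12) 1?eq_sym //.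
by apply: trace_on_ext => v; rewrite act_atC.
Qed.

Lemma posroot_neq (a : slroot r) : posroot a -> a.1 != a.2.
Proof. by rewrite /posroot -val_eqE; case: ltngtP. Qed.

Variable x : 'I_r -> 'M[C]_N.

Lemma trace_OmegaP k l : k != l -> tr (OmegaP x k l) = tr (Omega0 x k l).
Proof.
move=> kl; rewrite /OmegaP trace_onD trace_on_sum big1 ?addr0 // => a /posroot_neq.
exact: trace_act_EF.
Qed.

Lemma trace_OmegaM k l : k != l -> tr (OmegaM x k l) = tr (Omega0 x k l).
Proof.
move=> kl; rewrite /OmegaM trace_onD trace_on_sum big1 ?addr0 // => a /posroot_neq.
exact: trace_act_FE.
Qed.

Lemma epsilonE k l : k != l -> epsilon V nu x k l = 2 * tr (Omega0 x k l).
Proof.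
move=> kl; rewrite /epsilon /Omega trace_onD trace_OmegaP // trace_OmegaM //.
by rewrite mulr_natl mulr2n.
Qed.

Lemma epsilonC k l : k != l -> epsilon V nu x k l = epsilon V nu x l k.
Proof.
move=> kl; rewrite !epsilonE // 1?eq_sym //; congr (_ * _).
apply: trace_on_ext => v; congr (_ *: _); apply: eq_bigr => i _.
exact: act_atC.
Qed.

Lemma trace_rmat z k l : k != l ->
  tr (rmat x z k l) = (z + 1) / (z - 1) * (epsilon V nu x k l / 2).
Proof.
move=> kl; rewrite /rmat trace_onZ trace_onD trace_onZ trace_OmegaP // trace_OmegaM //.
rewrite epsilonE // [2 * _]mulrC mulfK ?pnatr_eq0 //.
ring.
Qed.

End WordsAndTraces.

(** * The complex exponential and the powers [z^omega] *)

Section ExpC.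
Variable R : realType.
Local Notation C := (CC R).

Lemma expCD (z w : C) : expC (z + w) = expC z * expC w.
Proof.
case: z => a b; case: w => c d; rewrite /expC /= expRD cosD sinD.
by apply/eqP; rewrite eq_complex /=; apply/andP; split; apply/eqP; ring.
Qed.

Lemma expC0 : expC (0 : C) = 1.
Proof. by rewrite /expC /= expR0 cos0 sin0 mulr1 mulr0. Qed.

Lemma expC_neq0 (z : C) : expC z != 0.
Proof.
apply/eqP => e0; have := expCD z (- z); rewrite subrr expC0 e0 mul0r => /eqP.
by rewrite oner_eq0.
Qed.

Lemma expC_sum (I : Type) (s : seq I) (P : pred I) (f : I -> C) :
  expC (\sum_(i <- s | P i) f i) = \prod_(i <- s | P i) expC (f i).
Proof. exact: (big_morph _ expCD expC0). Qed.

End ExpC.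

(** Functional calculus on eigenvectors, by interpolation at the roots of the characteristic
    polynomial. It provides the matrix that [zpow_mx] selects. *)
Lemma matrix_function (C : numClosedFieldType) D (A : 'M[C]_D) (e : C -> C) :
  exists Q : 'M[C]_D, forall c (y : 'cV[C]_D), A *m y = c *: y -> Q *m y = e c *: y.
Proof.
(* [Q] acts by some scalar on every eigenspace of [A], and by the prescribed one for the eigenvalues
   in [rs]. *)
pose good (rs : seq C) (Q : 'M[C]_D) := forall c, exists q : C,
  (forall y : 'cV[C]_D, A *m y = c *: y -> Q *m y = q *: y)
  /\ (c \in rs -> q = e c).
have interp rs : uniq rs -> exists Q, good rs Q.
  elim: rs => [|c0 rs IH] /=; first by exists 0 => c; exists 0; split=> // y _; rewrite mul0mx scale0r.
  move=> /andP[c0rs /IH[Q gQ]].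
  have [q0 [q0E _]] := gQ c0.
  pose P := foldr (fun c M => (A - c%:M) *m M) 1%:M rs.
  have PE c (y : 'cV[C]_D) : A *m y = c *: y -> P *m y = (\prod_(b <- rs) (c - b)) *: y.
    move=> Ay; rewrite /P; elim: (rs) => [|b s IHs] /=; first by rewrite mul1mx big_nil scale1r.
    rewrite -mulmxA IHs -scalemxAr mulmxBl Ay mul_scalar_mx -scalerBl scalerA big_cons.
    by rewrite mulrC.
  have p0 : \prod_(b <- rs) (c0 - b) != 0.
    rewrite prodf_seq_neq0; apply/allP => b brs; rewrite subr_eq0.
    by apply: contraNneq c0rs => ->.
  exists (Q + ((e c0 - q0) / \prod_(b <- rs) (c0 - b)) *: P) => c.
  have [q [qE qe]] := gQ c.
  exists (if c == c0 then e c0 else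
    q + (e c0 - q0) / \prod_(b <- rs) (c0 - b) * \prod_(b <- rs) (c - b)); split.
    move=> y Ay; rewrite mulmxDl -scalemxAl (PE _ _ Ay).
    case: eqP => [cc0|_]; last by rewrite (qE _ Ay) scalerA -scalerDl.
    by rewrite -cc0 in q0E *; rewrite (q0E _ Ay) cc0 scalerA divfK // -scalerDl addrC subrK.
  rewrite in_cons; case: eqP => [->//|_] /= crs; rewrite (qe crs).
  by rewrite [X in _ * X](big_rem c) //= subrr mul0r mulr0 addr0.
(* The transpose appears because [eigenvalue] refers to row vectors. *)
have [rs rsE] := closed_field_poly_normal (char_poly A^T).
have [Q gQ] := interp (undup rs) (undup_uniq _); exists Q => c y Ay.
have [->|y0] := eqVneq y 0; first by rewrite mulmx0 scaler0.
have [q [qE]] := gQ c; rewrite (qE _ Ay) => -> //.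
have : root (char_poly A^T) c.
  rewrite -eigenvalue_root_char; apply/eigenvalueP; exists y^T.
    by rewrite -trmx_mul Ay linearZ.
  by rewrite trmx_eq0.
rewrite rsE rootZ ?lead_coef_eq0 ?monic_neq0 ?char_poly_monic //.
by rewrite root_prod_XsubC mem_undup.
Qed.

Section ZPower.
Variables (R : realType) (r n : nat) (V : 'I_n -> slMod (CC R) r).
Local Notation C := (CC R).
Local Notation N := r.+1.
Local Notation tensor := (tensor V).

Lemma zpow_mxP (M : slMod C r) (om : 'M[C]_N) (lz : C) : cartan om ->
  forall (mu : 'M[C]_N) (y : 'cV[C]_(sldim M)), cartan mu ->
  (forall h, cartan h -> slact M h *m y = gform mu h *: y) ->
  zpow_mx M om lz *m y = expC (gform om mu * lz) *: y.
Proof.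
move=> omc; rewrite /zpow_mx.
apply: (@xgetPex _ 0 [set Q : 'M[C]_(sldim M) |
    forall (mu : 'M[C]_N) (y : 'cV[C]_(sldim M)), cartan mu ->
      (forall h, cartan h -> slact M h *m y = gform mu h *: y) ->
      Q *m y = expC (gform om mu * lz) *: y]).
have [Q QE] := matrix_function (slact M om) (fun c => expC (c * lz)).
exists Q => mu y muc yE; rewrite (QE (gform om mu)) // yE //.
by rewrite gformC.
Qed.

(** [v] is seen as a family of vectors of [V_k], one for each choice of the remaining indices;
    [factor_op] then becomes matrix multiplication. *)
Definition slice k (t : tidx V) (v : tensor) : 'cV[C]_(sldim (V k)) :=
  \col_a v (tset t a).

Lemma factor_op_slice k (A : 'M[C]_(sldim (V k))) (v : tensor) t :
  factor_op A v t = (A *m slice k t v) (t k) 0.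
Proof. by rewrite ffunE mxE; apply: eq_bigr => a _; rewrite mxE. Qed.

Lemma slice_factor_op k (A : 'M[C]_(sldim (V k))) (v : tensor) t :
  slice k t (factor_op A v) = A *m slice k t v.
Proof.
apply/colP => b; rewrite mxE factor_op_slice tset_same.
by rewrite !mxE; apply: eq_bigr => a _; rewrite !mxE tset_tset.
Qed.

Lemma slice_eigen k (A : 'M[C]_(sldim (V k))) (v : tensor) c :
  factor_op A v = c *: v <-> forall t, A *m slice k t v = c *: slice k t v.
Proof.
split=> [Av t|Av]; first by rewrite -slice_factor_op Av; apply/colP => a; rewrite !mxE !ffunE.
apply/ffunP => t; rewrite factor_op_slice Av !mxE ffunE; congr (_ * v _).
apply/ffunP => j; have [<-|kj] := eqVneq k j; first by rewrite tset_same.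
by rewrite tset_other.
Qed.

(** Subtracting the mean of [c] makes the diagonal matrix traceless and leaves its pairing with
    traceless matrices unchanged. *)
Lemma cartan_functional (c : 'I_N -> C) : exists2 mu : 'M[C]_N, cartan mu &
  forall h, cartan h -> gform mu h = \sum_a h a a * c a.
Proof.
pose m := (\sum_a c a) / N%:R.
have gd (d : 'rV[C]_N) (h : 'M[C]_N) : gform (diag_mx d) h = \sum_a h a a * d 0 a.
  rewrite /gform /mxtrace; apply: eq_bigr => a _.
  by rewrite mul_diag_mx mxE mulrC.
exists (diag_mx (\row_a (c a - m))).
  rewrite /cartan diag_mx_is_diag mxtrace_diag /=.
  under eq_bigr do rewrite mxE; rewrite sumrB sumr_const card_ord.
  by rewrite -[m *+ _]mulr_natr /m divfK ?pnatr_eq0 // subrr.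
move=> h hc; rewrite gd; under eq_bigr do rewrite mxE mulrBr.
by rewrite sumrB -mulr_suml (cartan_tr hc : \sum_a h a a = 0) mul0r subr0.
Qed.

Variable nu : 'M[C]_N.
Local Notation W := (wspace V nu).

Lemma zpow_op_linear om lz : linear (@zpow_op R r n V om lz).
Proof.
move=> c v w; rewrite /zpow_op; elim: (enum 'I_n) => //= k s ->.
by rewrite linearP.
Qed.
HB.instance Definition _ om lz :=
  GRing.isLinear.Build C tensor tensor _ (@zpow_op R r n V om lz)
    (zpow_op_linear om lz).

(** Joint eigenvectors of the [H_{(a,0)}] on the single factors, each diagonalisable by its
    [sl_2]-triple. These elements span the Cartan subalgebra, so a joint eigenvector has a weight in
    every factor. *)
Lemma weight_basis : exists (d : nat) (y : d.-tuple tensor) (mu : 'I_d -> 'I_n -> 'M[C]_N),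
  [/\ basis_of W y, forall i k, cartan (mu i k) &
    forall (i : 'I_d) k h, cartan h -> act_at k h y`_i = gform (mu i k) h *: y`_i].
Proof.
pose f (p : 'I_n * 'I_N) : {linear tensor -> tensor} :=
  act_at p.1 (rootH C (p.2, ord0)).
have fc p := rootH_cartan C (p, ord0 : 'I_N).
have [|||b bW bE] := @joint_eigenbasis _ _ _ f W.
- by move=> p q v; exact: act_at_cartanC.
- move=> [k a]; rewrite /f /=; have [->|a0] := eqVneq a ord0.
    exists [:: 0] => // v /=.
    by rewrite /rootH subrr act_at0 scale0r subr0.
  exact: (H_split_op (sl2_triple_act_at V (a := (a, ord0)) a0 k)).
- by move=> p v; exact: wspace_act_at.
have /choice[c cE] (p : 'I_(size b) * 'I_n * 'I_N) : exists c : C,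
    act_at p.1.2 (rootH C (p.2, ord0)) b`_p.1.1 = c *: b`_p.1.1.
  by apply: (bE _ (mem_nth 0 (ltn_ord p.1.1)) (p.1.2, p.2)).
have /choice[mu muE] (p : 'I_(size b) * 'I_n) : exists mu : 'M[C]_N, cartan mu /\
    forall h, cartan h -> gform mu h = \sum_a h a a * c (p, a).
  by have [mu muc muE] := cartan_functional (fun a => c (p, a)); exists mu.
exists (size b), (in_tuple b), (fun i k => mu (i, k)); split=> //.
- by move=> i k; case: (muE (i, k)).
- move=> i k h hc; have [_ ->] := muE (i, k); rewrite // scaler_suml.
  rewrite {1}(cartanE hc).
  have trH a : \tr (rootH C (a, ord0 : 'I_N)) = 0 by exact: tr_rootH.
  suff [] : act_at k (\sum_a h a a *: rootH C (a, ord0)) b`_i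
      = \sum_a (h a a * c (i, k, a)) *: b`_i
      /\ \tr (\sum_a h a a *: rootH C (a, ord0)) = 0 by [].
  apply: (big_ind2 (fun A w => act_at k A b`_i = w /\ \tr A = 0)).
  + by rewrite act_at0 mxtrace0.
  + move=> A w B w' [<- tA] [<- tB]; rewrite mxtraceD tA tB addr0; split=> //.
    by rewrite -[A]scale1r act_at_lin // !scale1r.
  + move=> a _; rewrite mxtraceZ trH mulr0; split=> //.
    by rewrite act_atZ // (cE (i, k, a)) scalerA.
Qed.

Lemma zpow_op_weight om lz (y : tensor) (mu : 'I_n -> 'M[C]_N) : cartan om ->
  (forall k, cartan (mu k)) ->
  (forall k h, cartan h -> act_at k h y = gform (mu k) h *: y) ->
  zpow_op om lz y = (\prod_k expC (gform om (mu k) * lz k)) *: y.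
Proof.
move=> omc muc yE; rewrite /zpow_op -big_enum.
elim: (enum 'I_n) => [|k s IH] /=; first by rewrite big_nil scale1r.
rewrite IH linearZ /= big_cons mulrC -scalerA; congr (_ *: _).
apply/slice_eigen => t; apply: zpow_mxP => // h hc.
exact: (iffLR (slice_eigen _ _ _) (yE k h hc)).
Qed.

Lemma zpow_op_wspace om lz : cartan om ->
  forall v, v \in W -> zpow_op om lz v \in W.
Proof.
move=> omc v; have [d [y [mu [yW muc yE]]]] := weight_basis.
move=> /(basis_gen yW)[a ->]; rewrite linear_sum memv_suml // => i _.
rewrite linearZ memvZ //= (zpow_op_weight _ omc (muc i) (yE i)) memvZ //.
exact: basis_nth.
Qed.

(** Over a basis of weight tensors, the pairings of [om] with the weights in the factor [k] add up
    to the trace of [om] acting there. *)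
Lemma zpow_op_det om lz d (v : d.-tuple tensor) : cartan om -> basis_of W v ->
  \det (opmx v (zpow_op om lz)) = \prod_k expC (Lambda V nu k om * lz k).
Proof.
move=> omc bv; have [d' [y [mu [yW muc yE]]]] := weight_basis.
have yg w := @basis_gen _ _ W _ y w yW; have yf a := @basis_indep _ _ W _ y a yW.
have [|-> _] := @opmx_eigen _ _ _ _ _ bv _ (fun i : 'I_d' => y`_i) _ (zpow_op om lz) _ yg yf
  (fun i => zpow_op_weight lz omc (muc i) (yE i)).
- by move=> k; exact: basis_nth.
rewrite exchange_big /=; apply: eq_bigr => k _.
rewrite -expC_sum -mulr_suml; congr (expC (_ * _)).
have := @opmx_eigen _ _ _ _ _ (vbasisP W) _ (fun i : 'I_d' => y`_i) _ (act_at k om) (basis_nth yW) yg yf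
  (fun i => yE i k om omc).
rewrite /Lambda trace_onE => -[_ ->].
by apply: eq_bigr => i _; rewrite gformC.
Qed.

End ZPower.

(** * Complex derivatives *)

Section ComplexDerivative.
Local Open Scope complex_scope.
Variable R : realType.
Local Notation C := (CC R).
Local Notation nc := (@Normc.normc R).

(** The norm of [CC R] is complex valued; estimates use the real modulus [nc], which [lra] and [nra]
    can handle. *)
Lemma normCE (z : C) : `|z| = (nc z)%:C.
Proof. by case: z => a b; rewrite normc_def. Qed.

Lemma nc_ge0 (z : C) : 0 <= nc z.
Proof. by case: z => a b; rewrite /Normc.normc sqrtr_ge0. Qed.

Lemma ncD (z w : C) : nc (z + w) <= nc z + nc w.
Proof. exact: le_normcD. Qed.

Lemma ncN (z : C) : nc (- z) = nc z.
Proof. exact: normcN. Qed.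

Lemma ncB (z w : C) : nc (z - w) <= nc z + nc w.
Proof. by rewrite -(ncN w) ncD. Qed.

Lemma ncM (z w : C) : nc (z * w) = nc z * nc w.
Proof. exact: Normc.normcM. Qed.

Lemma ncV (z : C) : nc z^-1 = (nc z)^-1.
Proof. exact: Normc.normcV. Qed.

Lemma nc0 : nc (0 : C) = 0. Proof. exact: Normc.normc0. Qed.
Lemma nc1 : nc (1 : C) = 1. Proof. exact: Normc.normc1. Qed.

Lemma nc_eq0 (z : C) : (nc z == 0) = (z == 0).
Proof.
apply/eqP/eqP => [|->]; last exact: nc0.
exact: Normc.eq0_normc.
Qed.

Lemma nc_gt0 (z : C) : (0 < nc z) = (z != 0).
Proof. by rewrite lt_def nc_ge0 andbT nc_eq0. Qed.

Lemma nc_real (x : R) : nc (x%:C : C) = `|x|.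
Proof. by rewrite /Normc.normc /= expr0n /= addr0 sqrtr_sqr. Qed.

Lemma nc_Re (z : C) : `|complex.Re (z : R[i])| <= nc z.
Proof. by have := normc_ge_Re (z : R[i]); rewrite (normCE z) lecR. Qed.

Lemma nc_Im (z : C) : `|complex.Im (z : R[i])| <= nc z.
Proof.
by case: z => a b; rewrite /Normc.normc /= -(sqrtr_sqr b) ler_wsqrtr // lerDr sqr_ge0.
Qed.

Lemma nc_le (z : C) : nc z <= `|complex.Re (z : R[i])| + `|complex.Im (z : R[i])|.
Proof.
case: z => a b /=; rewrite -[leRHS]ger0_norm ?addr_ge0 // -sqrtr_sqr.
rewrite ler_wsqrtr // sqrrD !real_normK ?num_real // addrAC lerDl.
by rewrite mulrn_wge0 // mulr_ge0.
Qed.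

Lemma sin_mvt (b : R) : exists2 c, `|c| <= `|b| & sin b = b * cos c.
Proof.
have [|c + e] := @MVT_segment R sin cos 0 `|b| (normr_ge0 b).
  by apply: continuous_subspaceT => x; exact: continuous_sin.
rewrite in_itv /= => /andP[c0 cb]; exists c; first by rewrite ger0_norm.
move: e; rewrite sin0 !subr0 => e.
have [b0|b0] := lerP 0 b; first by move: e; rewrite ger0_norm // mulrC.
by move: e; rewrite ltr0_norm // sinN mulrN mulrC => /oppr_inj.
Qed.

Lemma sin_le_norm (b : R) : `|sin b| <= `|b|.
Proof.
by have [c _ ->] := sin_mvt b; rewrite normrM ler_piMr // cos_max.
Qed.

Lemma cos_estimate (b : R) : `|cos b - 1| <= b ^+ 2.
Proof.
have -> : cos b - 1 = - 2 * sin (b / 2) ^+ 2.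
  have -> : cos b = cos ((b / 2) *+ 2) by congr cos; rewrite -mulr_natr divfK ?pnatr_eq0.
  have e : cos (b / 2) ^+ 2 = 1 - sin (b / 2) ^+ 2.
    by apply/eqP; rewrite eq_sym subr_eq cos2Dsin2.
  by rewrite cos_mulr2n e; ring.
have : sin (b / 2) ^+ 2 <= (b / 2) ^+ 2.
  by rewrite -[leLHS]real_normK ?num_real // -[leRHS]real_normK ?num_real // lerXn2r ?nnegrE // sin_le_norm.
have s0 := sqr_ge0 (sin (b / 2)); move: s0; set s := sin _ ^+ 2 => s0 sb.
by rewrite ler_norml; apply/andP; split; nra.
Qed.

Lemma sin_estimate (b : R) : `|b| <= 1 -> `|sin b - b| <= b ^+ 2.
Proof.
move=> b1; have [c cb ->] := sin_mvt b.
rewrite -{2}[b]mulr1 -mulrBr normrM.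
apply: (@le_trans _ _ (`|b| * `|c| ^+ 2)).
  by rewrite ler_wpM2l // real_normK ?num_real // cos_estimate.
rewrite -[leRHS]real_normK ?num_real //.
have := normr_ge0 c; have := normr_ge0 b; nra.
Qed.

Lemma expR_estimate (a : R) : `|a| <= 2^-1 ->
  [/\ `|expR a - 1 - a| <= 2 * a ^+ 2, `|expR a - 1| <= 2 * `|a| & expR a <= 2].
Proof.
move=> a2; have E1 := expR_ge1Dx a; have E2 := expR_ge1Dx (- a).
have E0 := expR_gt0 a.
have E3 : expR a * (1 - a) <= 1.
  by move: E2; rewrite expRN -(ler_pM2l E0) mulfV ?gt_eqF.
have /andP[an ap] : - 2^-1 <= a <= 2^-1 by rewrite -ler_norml.
have h1 : expR a - 1 - a <= 2 * a ^+ 2 by nra.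
have h0 : 0 <= expR a - 1 - a by lra.
split; last by nra.
  by rewrite ger0_norm.
have -> : expR a - 1 = (expR a - 1 - a) + a by ring.
apply: le_trans (ler_normD _ _) _; rewrite ger0_norm //.
rewrite -[a ^+ 2]real_normK ?num_real // in h1.
have := normr_ge0 a; nra.
Qed.

(** The real and imaginary parts of the remainder are at most [4 |w|^2] and [3 |w|^2]. This bound
    serves the derivative of [expC], that of a branch of the logarithm, and the convergence of the
    Gauss product. *)
Lemma expC_estimate (w : C) : nc w <= 2^-1 ->
  nc (expC w - 1 - w) <= 8 * nc w ^+ 2.
Proof.
move=> w2; have wa := nc_Re w; have wb := nc_Im w; apply: le_trans (nc_le _) _.
have /andP[an ap] : 0 <= nc w <= 2^-1 by rewrite nc_ge0.
move: wa wb an ap {w2}; case: w => a b; set q := nc _ => /= wa wb q0 q2.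
have [e1 e2 e3] := expR_estimate (le_trans wa q2).
have e4 := cos_estimate b; have e6 := sin_le_norm b.
have e5 : `|sin b - b| <= b ^+ 2 by apply: sin_estimate; lra.
have -> : expR a * cos b - 1 - a = (expR a - 1 - a) + expR a * (cos b - 1) by ring.
have -> : expR a * sin b - 0 - b = (expR a - 1) * sin b + (sin b - b) by ring.
have n1 : `|expR a - 1 - a + expR a * (cos b - 1)| <= 2 * q ^+ 2 + 2 * q ^+ 2.
  apply: le_trans (ler_normD _ _) _; apply: lerD.
    apply: le_trans e1 _; rewrite -[a ^+ 2]real_normK ?num_real //.
    have := normr_ge0 a; nra.
  rewrite normrM ger0_norm ?expR_ge0 //.
  apply: (@le_trans _ _ (2 * b ^+ 2)).
    have := expR_ge0 a; have := normr_ge0 (cos b - 1); nra.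
  rewrite -[b ^+ 2]real_normK ?num_real //; have := normr_ge0 b; nra.
have n2 : `|(expR a - 1) * sin b + (sin b - b)| <= 2 * q ^+ 2 + q ^+ 2.
  apply: le_trans (ler_normD _ _) _; apply: lerD.
    rewrite normrM; have := normr_ge0 a; have := normr_ge0 b.
    have := normr_ge0 (expR a - 1); have := normr_ge0 (sin b); nra.
  apply: le_trans e5 _.
  rewrite -[b ^+ 2]real_normK ?num_real //; have := normr_ge0 b; nra.
have := sqr_ge0 q; lra.
Qed.

End ComplexDerivative.

Section ComplexDerivativeRules.
Local Open Scope complex_scope.
Variable R : realType.
Local Notation C := (CC R).
Local Notation nc := (@Normc.normc R).

(** The complex derivative through a remainder bound free of division, in terms of real moduli. *)
Definition cderiv (f : C -> C) (z d : C) : Prop :=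
  forall e : R, 0 < e -> exists2 delta : R, 0 < delta &
    forall h : C, nc h < delta -> nc (f (z + h) - f z - d * h) <= e * nc h.

Lemma pos_complex (e : C) : 0 < e -> exists2 x : R, 0 < x & e = x%:C.
Proof.
case: e => a b; rewrite ltcE /= => /andP[/eqP -> a0]; by exists a.
Qed.

Lemma derivable_cderiv (f : C -> C) z : derivable f z 1 -> cderiv f z ('D_1 f z).
Proof.
move=> df e e0.
have /cvgrPdist_le/(_ e%:C) : (fun h : C => h^-1 *: ((f \o shift z) (h *: (1 : C)) - f z))
    @ 0^' --> 'D_1 f z by exact: df.
rewrite ltcR => /(_ e0) /nbhs_ballP[d /= /pos_complex[x x0 ->] hd].
exists x => // h hx; have [->|h0] := eqVneq h 0.
  by rewrite addr0 subrr mulr0 subr0 nc0 mulr0.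
have := hd h; rewrite /ball /= sub0r normrN normCE ltcR => /(_ hx h0).
rewrite normCE lecR [h *: _]mulr1 [h + z]addrC => le_e.
have -> : f (z + h) - f z - 'D_1 f z * h
   = - h * ('D_1 f z - h^-1 * (f (z + h) - f z)).
  by rewrite mulNr mulrBr mulVKf // opprB [h * _]mulrC.
by rewrite ncM ncN [leLHS]mulrC ler_wpM2r // nc_ge0.
Qed.

Lemma cderiv_near (f g : C -> C) z d (delta : R) : 0 < delta ->
  (forall h, nc h < delta -> f (z + h) = g (z + h)) ->
  cderiv f z d -> cderiv g z d.
Proof.
move=> d0 fg df e /df[d1 d10 h1]; exists (Num.min delta d1).
  by rewrite lt_min d0.
move=> h; rewrite lt_min => /andP[hd hd1].
rewrite -fg // -[in g z](addr0 z) -fg ?nc0 // addr0; exact: h1.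
Qed.

Lemma cderiv_cst c z : cderiv (fun=> c) z 0.
Proof.
by move=> e e0; exists 1 => // h _; rewrite mul0r !subrr nc0 mulr_ge0 ?nc_ge0 // ltW.
Qed.

Lemma cderivD f g z df dg : cderiv f z df -> cderiv g z dg ->
  cderiv (fun s => f s + g s) z (df + dg).
Proof.
move=> hf hg e e0; have e20 : 0 < e / 2 by rewrite divr_gt0.
have [d1 d10 h1] := hf _ e20; have [d2 d20 h2] := hg _ e20.
exists (Num.min d1 d2); first by rewrite lt_min d10.
move=> h; rewrite lt_min => /andP[/h1 n1 /h2 n2].
have -> : f (z + h) + g (z + h) - (f z + g z) - (df + dg) * h
   = (f (z + h) - f z - df * h) + (g (z + h) - g z - dg * h) by ring.
by apply: le_trans (ncD _ _) _; lra.
Qed.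

Lemma cderivM f g z df dg : cderiv f z df -> cderiv g z dg ->
  cderiv (fun s => f s * g s) z (f z * dg + df * g z).
Proof.
move=> hf hg e e0.
(* Each error term is at most [e1 |h|] times a summand of [K]; the product of the two increments
   uses [|h| < e1]. The final 1 keeps [K] positive. *)
pose K := nc (f z) + nc (g z) + (nc df + 1) * (nc dg + 1) + 1.
have f0 := nc_ge0 (f z); have g0 := nc_ge0 (g z).
have df0 := nc_ge0 df; have dg0 := nc_ge0 dg.
have K0 : 0 < K by rewrite /K; nra.
pose e1 := Num.min 1 (e / K).
have e10 : 0 < e1 by rewrite lt_min ltr01 divr_gt0.
have e1K : e1 * K <= e by rewrite -ler_pdivlMr // /e1 ge_min lexx orbT.
have e11 : e1 <= 1 by rewrite /e1 ge_min lexx.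
clearbody e1.
have [d1 d10 h1] := hf _ e10; have [d2 d20 h2] := hg _ e10.
exists (Num.min (Num.min d1 d2) e1); first by rewrite !lt_min d10 d20.
move=> h; rewrite !lt_min => /andP[/andP[/h1 n1 /h2 n2] he].
set rf := f (z + h) - _ - _ in n1; set rg := g (z + h) - _ - _ in n2.
have -> : f (z + h) * g (z + h) - f z * g z - (f z * dg + df * g z) * h
   = f z * rg + g z * rf + (df * h + rf) * (dg * h + rg) by rewrite /rf /rg; ring.
have q0 := nc_ge0 h; set q := nc h in n1 n2 he q0 *.
have m1 : nc (df * h + rf) <= (nc df + 1) * q.
  apply: le_trans (ncD _ _) _; rewrite ncM -/q; nra.
have m2 : nc (dg * h + rg) <= (nc dg + 1) * q.
  apply: le_trans (ncD _ _) _; rewrite ncM -/q; nra.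
have m3 : nc ((df * h + rf) * (dg * h + rg)) <= (nc df + 1) * (nc dg + 1) * e1 * q.
  rewrite ncM; apply: le_trans (ler_pM (nc_ge0 _) (nc_ge0 _) m1 m2) _.
  have A0 : 0 <= (nc df + 1) * (nc dg + 1) by nra.
  have : q * q <= e1 * q by rewrite ler_wpM2r // ltW.
  by move=> /(ler_wpM2l A0); rewrite mulrACA !mulrA.
apply: le_trans (ncD _ _) _.
have m4 : nc (f z * rg + g z * rf) <= (nc (f z) + nc (g z)) * e1 * q.
  apply: le_trans (ncD _ _) _; rewrite !ncM.
  have := ler_wpM2l f0 n2; have := ler_wpM2l g0 n1; nra.
have -> : e * q = (e - e1 * K) * q + e1 * K * q by ring.
have : 0 <= (e - e1 * K) * q by rewrite mulr_ge0 // subr_ge0.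
have : e1 * K * q = (nc (f z) + nc (g z)) * e1 * q + (nc df + 1) * (nc dg + 1) * e1 * q + e1 * q.
  by rewrite /K; ring.
have : 0 <= e1 * q by rewrite mulr_ge0 // ltW.
lra.
Qed.

Lemma cderivZ c f z df : cderiv f z df -> cderiv (fun s => c * f s) z (c * df).
Proof.
move=> /(cderivM (cderiv_cst c z)); rewrite mul0r addr0; exact.
Qed.

Lemma cderiv_sum (I : Type) (s : seq I) (P : pred I) (f : I -> C -> C)
    (d : I -> C) z :
  (forall i, P i -> cderiv (f i) z (d i)) ->
  cderiv (fun w => \sum_(i <- s | P i) f i w) z (\sum_(i <- s | P i) d i).
Proof.
move=> fd; elim: s => [|i s IH].
  rewrite big_nil; apply: (cderiv_near ltr01) (cderiv_cst 0 z) => h _.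
  by rewrite big_nil.
rewrite big_cons; case: ifP => Pi; last first.
  by apply: (cderiv_near ltr01) IH => h _; rewrite big_cons Pi.
apply: (cderiv_near ltr01) (cderivD (fd i Pi) IH) => h _.
by rewrite big_cons Pi.
Qed.

Lemma cderiv_prod (I : eqType) (s : seq I) (f : I -> C -> C) (d : I -> C) z :
  uniq s -> (forall i, cderiv (f i) z (d i)) ->
  cderiv (fun w => \prod_(i <- s) f i w) z
    (\sum_(i <- s) \prod_(j <- s) (if j == i then d j else f j z)).
Proof.
move=> + fd; elim: s => [|i s IH].
  move=> _; rewrite big_nil; apply: (cderiv_near ltr01) (cderiv_cst 1 z) => h _.
  by rewrite big_nil.
rewrite cons_uniq => /andP[is_ us].
have := cderivM (fd i) (IH us).
have -> : f i z * (\sum_(k <- s) \prod_(j <- s) (if j == k then d j else f j z))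
     + d i * (\prod_(j <- s) f j z)
   = \sum_(k <- i :: s) \prod_(j <- i :: s) (if j == k then d j else f j z).
  rewrite [RHS]big_cons [X in _ = X + _]big_cons eqxx [RHS]addrC; congr (_ + _ * _).
    rewrite mulr_sumr; apply: eq_big_seq => k ks; rewrite big_cons ifN //.
    by apply: contraNneq is_ => ->.
  apply: eq_big_seq => k ks; rewrite ifN //.
  by apply: contraNneq is_ => <-.
by apply: (cderiv_near ltr01) => h _; rewrite big_cons.
Qed.

Lemma cderiv_expC f z d : cderiv f z d ->
  cderiv (fun s => expC (f s)) z (d * expC (f z)).
Proof.
move=> fd e e0; pose m := nc (expC (f z)).
have m0 : 0 < m by rewrite nc_gt0 expC_neq0.
have d0 := nc_ge0 d.
pose D := nc d + 1; have D0 : 0 < D by rewrite /D; lra.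
pose e1 := Num.min 1 (e / (2 * m)).
have e10 : 0 < e1 by rewrite lt_min ltr01 divr_gt0 // mulr_gt0.
have e1m : e1 * (2 * m) <= e.
  by rewrite -ler_pdivlMr ?mulr_gt0 // /e1 ge_min lexx orbT.
have e11 : e1 <= 1 by rewrite /e1 ge_min lexx.
clearbody e1.
have [d1 d10 h1] := fd _ e10.
pose d2 := Num.min (2^-1 / D) (e / (16 * m * D ^+ 2)).
have p0 : 0 < 16 * m * D ^+ 2 by rewrite !mulr_gt0 // exprn_gt0.
have d20 : 0 < d2 by rewrite lt_min !divr_gt0 ?invr_gt0.
exists (Num.min d1 d2); first by rewrite lt_min d10.
move=> h; rewrite lt_min => /andP[/h1 n1 hd2].
have q0 := nc_ge0 h; set q := nc h in n1 hd2 q0 *.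
have qD : q * D <= 2^-1.
  by rewrite -ler_pdivlMr //; apply: le_trans (ltW hd2) _; rewrite /d2 ge_min lexx.
have qm : q * (16 * m * D ^+ 2) <= e.
  by rewrite -ler_pdivlMr //; apply: le_trans (ltW hd2) _; rewrite /d2 ge_min lexx orbT.
set w := f (z + h) - f z; have wn : nc w <= q * D.
  have -> : w = (w - d * h) + d * h by ring.
  apply: le_trans (ncD _ _) _; rewrite ncM -/q /D; nra.
have we := expC_estimate (le_trans wn qD).
have -> : expC (f (z + h)) - expC (f z) - d * expC (f z) * h
    = expC (f z) * ((expC w - 1 - w) + (w - d * h)).
  have -> : f (z + h) = f z + w by rewrite /w addrCA subrr addr0.
  by rewrite expCD; ring.
rewrite ncM -/m; have n2 := ncD (expC w - 1 - w) (w - d * h).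
have w2 : nc w ^+ 2 <= (q * D) ^+ 2 by rewrite lerXn2r ?nnegrE ?nc_ge0 // mulr_ge0 // ltW.
have n3 : nc (expC w - 1 - w + (w - d * h)) <= 8 * (q * D) ^+ 2 + e1 * q by lra.
apply: le_trans (ler_wpM2l (ltW m0) n3) _.
have -> : m * (8 * (q * D) ^+ 2 + e1 * q)
  = 2^-1 * (q * (16 * m * D ^+ 2)) * q + 2^-1 * (e1 * (2 * m)) * q by field.
nra.
Qed.

(** Continuity makes the increment [E] of the branch small, and [expC E - 1 = sg h / g0] then
    determines [E] up to a quadratic error. *)
Lemma cderiv_log (l : C -> C) (s g0 sg : C) (delta : R) : g0 != 0 -> 0 < delta ->
  (forall e : R, 0 < e -> exists2 d : R, 0 < d &
     forall h, nc h < d -> nc (l (s + h) - l s) < e) ->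
  (forall h, nc h < delta -> expC (l (s + h)) = g0 + sg * h) ->
  cderiv l s (sg / g0).
Proof.
move=> g00 dl0 lc le e e0; pose m := nc g0; have m0 : 0 < m by rewrite nc_gt0.
pose S := nc sg; have S0 : 0 <= S by exact: nc_ge0.
pose K := 32 * S ^+ 2 + 1; have K0 : 0 < K.
  by rewrite /K; have := sqr_ge0 S; lra.
(* For [|E| <= 1/16] the remainder [8 |E|^2] is at most [|E| / 2], whence [|E| <= 2 |sg h / g0|]. *)
have [|d1 d10 h1] := lc 16^-1; first by rewrite invr_gt0.
exists (Num.min (Num.min delta d1) (e * m ^+ 2 / K)).
  by rewrite !lt_min dl0 d10 divr_gt0 // mulr_gt0 // exprn_gt0.
move=> h; rewrite !lt_min => /andP[/andP[/le hE /h1 n1] hK].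
have q0 := nc_ge0 h; set q := nc h in hK q0 *.
set E := l (s + h) - l s in n1 *.
have lsE : expC (l s) = g0 by have := le 0; rewrite nc0 !addr0 mulr0 addr0; exact.
have EE : expC E - 1 = sg / g0 * h.
  apply: (mulfI g00); rewrite -{1}lsE mulrBr -expCD /E addrCA subrr addr0 hE lsE.
  by field.
have n2 : nc (sg / g0 * h - E) <= 8 * nc E ^+ 2.
  rewrite -EE; apply: expC_estimate; apply: le_trans (ltW n1) _.
  by rewrite lef_pV2 ?posrE // ler_nat.
have E0 := nc_ge0 E.
have mE : nc (sg / g0 * h) = S * q / m by rewrite !ncM ncV -/S -/m -/q mulrAC.
have n3 : nc E <= 2 * (S * q / m).
  have : nc E <= nc (sg / g0 * h) + nc (sg / g0 * h - E).
    by have := ncB (sg / g0 * h) (sg / g0 * h - E); rewrite subKr.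
  have : 8 * nc E ^+ 2 <= 2^-1 * nc E.
    have : nc E <= 16^-1 by exact: ltW.
    nra.
  rewrite mE; lra.
rewrite -ncN opprB; apply: le_trans n2 _.
have Sqm : 0 <= S * q / m by rewrite divr_ge0 ?mulr_ge0 // ltW.
apply: (@le_trans _ _ (8 * (2 * (S * q / m)) ^+ 2)).
  by rewrite ler_wpM2l // lerXn2r ?nnegrE // mulr_ge0.
have mn0 : m != 0 by rewrite gt_eqF.
have -> : 8 * (2 * (S * q / m)) ^+ 2 = (32 * S ^+ 2 * q / m ^+ 2) * q by field.
rewrite ler_wpM2r // ler_pdivrMr ?exprn_gt0 //.
move: hK; rewrite ltr_pdivlMr // => hK.
by apply: le_trans (ltW hK); rewrite /K; nra.
Qed.

Lemma real_derive0 (g : R -> R) (t : R) :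
  (forall e, 0 < e -> exists2 d, 0 < d &
     forall h, `|h| < d -> `|g (t + h) - g t| <= e * `|h|) ->
  is_derive t 1 g 0.
Proof.
move=> gd; have gc : (fun h : R => h^-1 *: ((g \o shift t) (h *: (1 : R)) - g t))
    @ 0^' --> (0 : R).
  apply/cvgrPdist_le => e e0; have [d d0 hd] := gd e e0.
  apply/nbhs_ballP; exists d => //= h; rewrite /ball /= sub0r normrN => hh h0.
  rewrite sub0r normrN normrM normfV /= [h *: _]mulr1 [h + t]addrC [leLHS]mulrC.
  by rewrite ler_pdivrMr ?normr_gt0 //; exact: hd.
apply: DeriveDef; first by apply/cvg_ex; exists 0.
exact: cvg_lim.
Qed.

(** The real and imaginary parts of [f] along the segment from [a] to [s] have zero derivative, and
    the real mean value theorem applies. *)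
Lemma cderiv0_const (f : C -> C) (a : C) (rho : R) :
  (forall s, nc (s - a) < rho -> cderiv f s 0) ->
  forall s, nc (s - a) < rho -> f s = f a.
Proof.
move=> f0 s sa.
pose path (t : R) : C := a + t%:C * (s - a).
have main (phi : C -> R) : (forall z w, phi (z - w) = phi z - phi w) ->
    (forall z, `|phi z| <= nc z) -> phi (f s) = phi (f a).
  move=> phiB phin; pose g t := phi (f (path t)).
  have gd (t : R) : t \in `[0, 1] -> is_derive t 1 g 0.
    rewrite in_itv /= => /andP[t0 t1]; apply: real_derive0 => e e0.
    have pt : nc (path t - a) < rho.
      rewrite /path addrC addKr ncM nc_real ger0_norm //.
      by apply: le_lt_trans sa; rewrite ler_piMl // nc_ge0.
    pose L := nc (s - a) + 1; have L0 : 0 < L by rewrite /L; have := nc_ge0 (s - a); lra.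
    have [d d0 hd] := f0 _ pt (e / L) (divr_gt0 e0 L0).
    exists (d / L); first exact: divr_gt0.
    move=> h hh; have hL : nc (h%:C * (s - a)) <= `|h| * L.
      by rewrite ncM nc_real ler_wpM2l // /L lerDl.
    have := hd (h%:C * (s - a)); rewrite mul0r subr0.
    have -> : path t + h%:C * (s - a) = path (t + h).
      by rewrite /path rmorphD /= mulrDl addrA.
    move=> /(_ (le_lt_trans hL _)); rewrite -ltr_pdivlMr // => /(_ hh) n1.
    rewrite /g -phiB; apply: le_trans (phin _) _; apply: le_trans n1 _.
    apply: le_trans (ler_wpM2l (ltW (divr_gt0 e0 L0)) hL) _.
    by rewrite mulrCA divfK ?gt_eqF // mulrC.
  have gdo (x : R) : x \in `]0, 1[ -> is_derive x 1 g ((fun=> 0) x).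
    by rewrite in_itv /= => /andP[x0 x1]; apply: gd; rewrite in_itv /= !ltW.
  have gc : {within `[0, 1], continuous g}.
    by apply: derivable_within_continuous => x xi; have [] := gd x xi.
  have [c _] := MVT_segment ler01 gdo gc.
  rewrite mul0r => /eqP; rewrite subr_eq0 => /eqP; rewrite /g /path mul1r mul0r addr0.
  by rewrite addrC subrK.
apply/eqP; rewrite eq_complex; apply/andP; split; apply/eqP.
- by apply: main => [[a1 b1] [a2 b2]|z] //; exact: nc_Re.
- by apply: main => [[a1 b1] [a2 b2]|z] //; exact: nc_Im.
Qed.

End ComplexDerivativeRules.

(** * Functions of several complex variables and the derivative of a determinant *)

Section SeveralVariables.
Local Open Scope complex_scope.
Variables (R : realType) (n : nat).
Local Notation C := (CC R).
Local Notation nc := (@Normc.normc R).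

Lemma nbhs_rVP (z : 'rV[C]_n) (P : set 'rV[C]_n) : nbhs z P <->
  exists2 delta : R, 0 < delta &
    forall w : 'rV[C]_n, (forall k, nc (w 0 k - z 0 k) < delta) -> P w.
Proof.
split=> [/nbhs_ballP[e /= /pos_complex[x x0 ->] zP]|[d d0 zP]].
  exists x => // w wz; apply: zP; split=> [|i j]; rewrite ?ltcR // ord1 /ball /= normCE ltcR.
  by rewrite -ncN opprB.
apply/nbhs_ballP; exists d%:C => /=; first by rewrite ltcR.
move=> w [_ zw]; apply: zP => k; have := zw 0 k.
by rewrite /ball /= normCE ltcR -ncN opprB.
Qed.

Lemma upd_id (z : 'rV[C]_n) k : upd z k (z 0 k) = z.
Proof. by apply/rowP => j; rewrite mxE; case: eqP => // ->. Qed.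

Lemma upd_upd (z : 'rV[C]_n) k s t : upd (upd z k s) k t = upd z k t.
Proof. by apply/rowP => j; rewrite !mxE; case: eqP. Qed.

Lemma upd_same (z : 'rV[C]_n) k s : upd z k s 0 k = s.
Proof. by rewrite mxE eqxx. Qed.

Lemma upd_close (z : 'rV[C]_n) k h (delta : R) : 0 < delta -> nc h < delta ->
  forall j, nc (upd z k (z 0 k + h) 0 j - z 0 j) < delta.
Proof.
move=> d0 hd j; rewrite mxE; case: eqP => [->|_]; last by rewrite subrr nc0.
by rewrite addrC addKr.
Qed.

(** The coordinates are moved from [z] to [w] one at a time, which stays inside the polydisc. *)
Lemma polydisc_const (F : 'rV[C]_n -> C) (z : 'rV[C]_n) (delta : R) :
  (forall w : 'rV[C]_n, (forall k, nc (w 0 k - z 0 k) < delta) ->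
     forall k, cderiv (fun s => F (upd w k s)) (w 0 k) 0) ->
  forall w : 'rV[C]_n, (forall k, nc (w 0 k - z 0 k) < delta) -> F w = F z.
Proof.
move=> F0 w wz.
pose path m : 'rV[C]_n := \row_j (if (j < m)%N then w 0 j else z 0 j).
suff h m : (m <= n)%N -> F (path m) = F z.
  rewrite -(h n (leqnn n)); congr F; apply/rowP => j.
  by rewrite mxE ltn_ord.
elim: m => [_|m IH mn].
  by congr F; apply/rowP => j; rewrite mxE.
rewrite -(IH (ltnW mn)); pose k := Ordinal mn.
have -> : path m.+1 = upd (path m) k (w 0 k).
  apply/rowP => j; rewrite !mxE ltnS leq_eqVlt -val_eqE /=.
  by case: eqP => //= jm; congr (w 0 _); apply: val_inj.
have {2}<- : upd (path m) k (z 0 k) = path m.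
  by rewrite -[RHS](upd_id _ k); congr (upd _ _ _); rewrite mxE ltnn.
apply: (@cderiv0_const _ (fun s => F (upd (path m) k s)) _ delta); last exact: wz.
move=> s sz; have := F0 (upd (path m) k s) _ k; rewrite upd_same.
move=> h; apply: (cderiv_near ltr01) (h _) => [t _|j]; first by rewrite upd_upd.
rewrite mxE; case: eqP => [->//|_]; rewrite mxE; case: ifP => _ //.
rewrite subrr nc0; apply: le_lt_trans (nc_ge0 (s - z 0 k)) sz.
Qed.

(** By [polydisc_const] the function is locally constant, so its level sets are open and closed in
    [U]. *)
Lemma connected_const (U : set 'rV[C]_n) (F : 'rV[C]_n -> C) : open U ->
  connected U ->
  (forall z k, U z -> cderiv (fun s => F (upd z k s)) (z 0 k) 0) ->
  forall z w, U z -> U w -> F w = F z.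
Proof.
move=> Uo Uc F0 z w Uz Uw.
have loc y : U y -> nbhs y (fun y' => U y' /\ F y' = F y).
  move=> Uy; have /nbhs_rVP[d d0 yU] : nbhs y U by exact: open_nbhs_nbhs.
  apply/nbhs_rVP; exists d => // y' y'y; split; first exact: yU.
  by apply: polydisc_const y'y => y'' /yU Uy'' k; exact: F0.
pose B := [set y | U y /\ F y = F z].
suff BU : B = U by move: Uw; rewrite -BU => -[].
apply: Uc; first by exists z.
- exists B; last by apply/seteqP; split=> y [].
  rewrite openE => y [Uy Fy]; apply: filterS (loc y Uy) => y' [Uy' Fy'].
  by split=> //; rewrite Fy'.
- exists (~` [set y | U y /\ F y != F z]).
    apply: open_closedC; rewrite openE => y [Uy Fy].
    by apply: filterS (loc y Uy) => y' [Uy' Fy']; split=> //; rewrite Fy'.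
  apply/seteqP; split=> [y [Uy Fy]|y [Uy] /not_andP[//|/negP]].
    by split=> //; apply/not_andP; right; rewrite Fy eqxx.
  by rewrite negbK => /eqP.
Qed.

Lemma log_slice_cderiv (U : set 'rV[C]_n) (f lf : 'rV[C]_n -> C) z m sg :
  open U -> log_branch U f lf -> U z ->
  (forall s, f (upd z m s) = f z + sg * (s - z 0 m)) ->
  cderiv (fun s => lf (upd z m s)) (z 0 m) (sg / f z).
Proof.
move=> Uo lfP Uz fE; have [lfc lfe] := lfP z Uz.
have /nbhs_rVP[d d0 zU] : nbhs z U by exact: open_nbhs_nbhs.
apply: (@cderiv_log _ _ _ _ _ d) => //.
- by rewrite -lfe expC_neq0.
- move=> e e0; have /cvgrPdist_lt/(_ e%:C) := lfc.
  rewrite ltcR => /(_ e0)/nbhs_rVP[d1 d10 hd]; exists d1 => // h hh.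
  have := hd _ (upd_close z m d10 hh).
  by rewrite normCE ltcR -ncN opprB upd_id.
- move=> h hh; have [_ ->] := lfP _ (zU _ (upd_close z m d0 hh)).
  by rewrite fE [z 0 m + h]addrC addrK.
Qed.

(** Jacobi's formula, with the adjugate in place of an inverse, since [M s] may be singular. *)
Lemma cderiv_det d (M : C -> 'M[C]_d) s (M' A : 'M[C]_d) :
  (forall i j, cderiv (fun t => M t i j) s (M' i j)) -> M' = M s *m A ->
  cderiv (fun t => \det (M t)) s (\tr A * \det (M s)).
Proof.
move=> Md M'E.
have -> : \tr A * \det (M s) = \sum_(sg : 'S_d) (-1) ^+ sg *
    \sum_(i < d) \prod_(j < d) (if j == i then M' j (sg j) else M s j (sg j)).
  pose Mi i : 'M[C]_d := \matrix_(a, b) (if a == i then M' a b else M s a b).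
  transitivity (\sum_i \det (Mi i)); last first.
    under [RHS]eq_bigr do rewrite mulr_sumr.
    rewrite exchange_big /=; apply: eq_bigr => i _.
    by apply: eq_bigr => sg _; congr (_ * _); apply: eq_bigr => j _; rewrite mxE.
  transitivity (\tr (M' *m \adj (M s))).
    by rewrite M'E -mulmxA mxtrace_mulC -mulmxA mul_adj_mx mul_mx_scalar mxtraceZ mulrC.
  apply: eq_bigr => i _; rewrite mxE (expand_det_row _ i).
  apply: eq_bigr => j _; rewrite !mxE eqxx; congr (_ * _).
  rewrite /cofactor; congr (_ * \det _); apply/matrixP => a b.
  by rewrite !mxE eq_sym (negbTE (neq_lift _ _)).
apply: cderiv_sum => sg _; apply: cderivZ.
by apply: cderiv_prod => [|i]; [exact: index_enum_uniq|exact: Md].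
Qed.

End SeveralVariables.

(** * The determinant of the KZ system *)

(** Equates the logarithmic [z_m]-derivative of [D] with the trace of the KZ operator. It rests on
    [(z_m / z_l + 1) / (z_m / z_l - 1) = 2 z_m / (z_m - z_l) - 1]: the first term yields the powers
    of [z_k - z_l], and the [- 1] yields the exponent [- gamma_k / (2 kappa)]. *)
Lemma kz_exponent_identity (C : numFieldType) n (m : 'I_n) (z : 'I_n -> C)
    (ep : 'I_n -> 'I_n -> C) (kappa lam : C) :
  kappa != 0 -> (forall k, z k != 0) -> (forall k l, k != l -> z k != z l) ->
  (forall k l, k != l -> ep k l = ep l k) ->
  (lam / kappa - (\sum_(l | l != m) ep m l) / (2 * kappa)) / z m
  + \sum_(k < n) \sum_(l < n | (k < l)%N)
      ep k l / kappa * (((k == m)%:R - (l == m)%:R) / (z k - z l))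
  = (kappa * z m)^-1 * (\sum_(l | l != m) (z m / z l + 1) / (z m / z l - 1)
      * (ep m l / 2) + lam).
Proof.
move=> k0 zn0 zne epC; pose e k l := ep k l / kappa.
have -> : \sum_(k < n) \sum_(l < n | (k < l)%N)
      ep k l / kappa * (((k == m)%:R - (l == m)%:R) / (z k - z l))
    = \sum_(l | l != m) e m l / (z m - z l).
  transitivity (\sum_(k < n) \sum_(l < n)
      (if (k == m) && (k < l)%N then e k l / (z k - z l) else 0)
     + \sum_(k < n) \sum_(l < n)
      (if (l == m) && (k < l)%N then e k l / (z l - z k) else 0)).
    rewrite -big_split; apply: eq_bigr => k _ /=; rewrite -big_split big_mkcond.
    apply: eq_bigr => l _ /=; case: ifP => kl; rewrite ?andbF ?addr0 // !andbT.
    rewrite -[z l - z k]opprB invrN /e.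
    by case: eqP => _; case: eqP => _ /=; ring.
  rewrite (bigD1 m) //= [X in _ + X + _]big1 ?addr0 => [|k /negbTE ->]; last by rewrite big1.
  rewrite [X in _ + X]exchange_big /= [X in _ + X](bigD1 m) //=.
  rewrite [X in _ + (_ + X)]big1 ?addr0; last by move=> l /negbTE ->; rewrite big1.
  rewrite -big_split [RHS]big_mkcond; apply: eq_bigr => l _ /=; rewrite eqxx /=.
  case: (ltngtP m l) => [ml|lm|/val_inj ->]; rewrite ?addr0 ?add0r ?eqxx //.
    by rewrite -val_eqE gtn_eqF.
  by rewrite -val_eqE ltn_eqF //= /e epC // -val_eqE ltn_eqF.
have zm0 := zn0 m.
suff key : (kappa * z m)^-1 * (\sum_(l | l != m) (z m / z l + 1) / (z m / z l - 1)
      * (ep m l / 2))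
    = \sum_(l | l != m) e m l / (z m - z l)
      - (\sum_(l | l != m) ep m l) / (2 * kappa) / z m.
  rewrite mulrDr key; set A := \sum_(l | _) ep m l; set B := \sum_(l | _) _.
  by field; rewrite k0 zm0.
rewrite !mulr_suml mulr_sumr -sumrB.
apply: eq_bigr => l lm; rewrite /e.
have zl0 := zn0 l.
have zml : z m - z l != 0 by rewrite subr_eq0 eq_sym zne.
have q0 : z m / z l - 1 != 0 by rewrite subr_eq0 -(inj_eq (mulIf zl0)) divfK // mul1r eq_sym zne.
by field; rewrite zm0 k0 zml zl0.
Qed.

Section KZOperator.
Variables (C : numClosedFieldType) (r n : nat) (V : 'I_n -> slMod C r).
Local Notation N := r.+1.
Local Notation tensor := (tensor V).
Variable x : 'I_r -> 'M[C]_N.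

Lemma act_at2_linear k l X Y : linear (fun v : tensor => act_at k X (act_at l Y v)).
Proof. by move=> c v w; rewrite [act_at l _ _]linearP linearP. Qed.

Lemma sum_linear (I : Type) (s : seq I) (P : pred I) (f : I -> tensor -> tensor) :
  (forall i, linear (f i)) -> linear (fun v => \sum_(i <- s | P i) f i v).
Proof.
move=> fL c v w; rewrite scaler_sumr -big_split; apply: eq_bigr => i _.
exact: fL.
Qed.

Lemma Omega0_linear k l : linear (@Omega0 C r n V x k l).
Proof.
move=> c v w; rewrite /Omega0 (sum_linear _ _ (fun i => act_at2_linear k l (x i) (x i))).
by rewrite scalerDr !scalerA [_ * c]mulrC.
Qed.

Lemma OmegaP_linear k l : linear (@OmegaP C r n V x k l).
Proof.
move=> c v w; rewrite /OmegaP Omega0_linear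
  (sum_linear _ _ (fun a => act_at2_linear k l (rootE C a) (rootF C a))).
by apply: vec_ext => phi pD pN pZ; rewrite !(pD, pZ) /=; ring.
Qed.

Lemma OmegaM_linear k l : linear (@OmegaM C r n V x k l).
Proof.
move=> c v w; rewrite /OmegaM Omega0_linear
  (sum_linear _ _ (fun a => act_at2_linear k l (rootF C a) (rootE C a))).
by apply: vec_ext => phi pD pN pZ; rewrite !(pD, pZ) /=; ring.
Qed.

Lemma rmat_linear z k l : linear (@rmat C r n V x z k l).
Proof.
move=> c v w; rewrite /rmat OmegaP_linear OmegaM_linear.
by apply: vec_ext => phi pD pN pZ; rewrite !(pD, pZ) /=; ring.
Qed.

Hypothesis x_cartan : forall i, cartan (x i).
Variable nu : 'M[C]_N.
Local Notation W := (wspace V nu).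

Lemma rmat_wspace z k l v : v \in W -> rmat x z k l v \in W.
Proof.
move=> vW; have O0 : Omega0 x k l v \in W.
  by rewrite memvZ // memv_suml // => i _; rewrite !wspace_act_at.
rewrite memvZ // memvD ?memvZ // /OmegaP /OmegaM memvD // memv_suml // => a /posroot_neq a12.
  exact: wspace_act_EF.
exact: wspace_act_FE.
Qed.

(** The KZ equation reads [kappa z_k du/dz_k = kz_op u]. *)
Definition kz_op (lam : 'M[C]_N) (z : 'rV[C]_n) (k : 'I_n) (v : tensor) : tensor :=
  \sum_(l | l != k) rmat x (z 0 k / z 0 l) k l v + act_at k lam v.

Lemma kz_op_linear lam z k : linear (kz_op lam z k).
Proof.
move=> c v w; rewrite /kz_op linearP scalerDr addrACA; congr (_ + _).
by rewrite scaler_sumr -big_split; apply: eq_bigr => l _; exact: rmat_linear.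
Qed.
HB.instance Definition _ lam z k :=
  GRing.isLinear.Build C tensor tensor _ (kz_op lam z k) (kz_op_linear lam z k).

Lemma kz_op_wspace lam z k v : cartan lam -> v \in W -> kz_op lam z k v \in W.
Proof.
move=> lc vW; rewrite memvD ?wspace_act_at // memv_suml // => l _.
exact: rmat_wspace.
Qed.

Lemma kz_op_trace lam z k : trace_on W (kz_op lam z k) =
  \sum_(l | l != k) (z 0 k / z 0 l + 1) / (z 0 k / z 0 l - 1)
     * (epsilon V nu x k l / 2) + Lambda V nu k lam.
Proof.
rewrite /kz_op trace_onD trace_on_sum; congr (_ + _).
by apply: eq_bigr => l lk; rewrite trace_rmat // eq_sym.
Qed.


Lemma tensor_delta (y : tensor) :
  y = \sum_t y t *: ([ffun t' => (t' == t)%:R] : tensor).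
Proof.
apply/ffunP => s; rewrite sum_ffunE (bigD1 s) //= big1 => [|t ts].
  by rewrite !ffunE eqxx addr0 [RHS]mulr1.
by rewrite !ffunE eq_sym (negbTE ts) [LHS]mulr0.
Qed.

End KZOperator.

Section KZDeterminant.
Local Open Scope complex_scope.
Variables (R : realType) (r n : nat) (V : 'I_n -> slMod (CC R) r).
Local Notation C := (CC R).
Local Notation nc := (@Normc.normc R).
Local Notation N := r.+1.
Local Notation tensor := (tensor V).
Variable x : 'I_r -> 'M[C]_N.
Hypothesis x_cartan : forall i, cartan (x i).
Variable nu : 'M[C]_N.
Local Notation W := (wspace V nu).

Variables (kappa : C) (lam : 'M[C]_N) (U : set 'rV[C]_n) (d : nat).
Variables (v : d.-tuple tensor) (u : 'I_d -> 'I_d -> 'rV[C]_n -> C).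
Hypotheses (kappa0 : kappa != 0) (lam_cartan : cartan lam).
Hypotheses (U_config : U `<=` @config_space R n) (v_basis : basis_of W v).
Hypothesis u_kz : forall i,
  kz_solution x lam kappa U (fun z => \sum_j u i j z *: v`_j).

Local Notation Umx z := (\matrix_(i < d, j < d) u i j z).

(** The [z_k]-derivative of [(u_{i,j})] is [(u_{i,j})] times [A / (kappa z_k)], with [A] the matrix
    of the KZ operator on [V[nu]]. *)
Lemma det_kz_cderiv z k : U z -> cderiv (fun s => \det (Umx (upd z k s))) (z 0 k)
  ((kappa * z 0 k)^-1 * trace_on W (kz_op x lam z k) * \det (Umx z)).
Proof.
move=> Uz; pose A := opmx v (kz_op x lam z k).
have [zn0 _] := U_config Uz.
have kz0 : kappa * z 0 k != 0 by rewrite mulf_neq0.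
pose f i z := \sum_j u i j z *: v`_j.
pose M' : 'M[C]_d := \matrix_(i, j) coord v j (zpartial k (f i) z).
have uE i j y : u i j y = coord v j (f i y).
  by rewrite /f coord_sum_free // (basis_free v_basis).
have M'd i j : cderiv (fun s => (\matrix_(i < d, j < d) u i j (upd z k s)) i j) (z 0 k) (M' i j).
  have [zd _] := u_kz i Uz.
  (* Derivatives are given entrywise in the tensor product; a coordinate in [v] is a fixed linear
     combination of the entries. *)
  have cE (y : tensor) : coord v j y = \sum_t coord v j [ffun t' => (t' == t)%:R] * y t.
    rewrite {1}[y]tensor_delta linear_sum; apply: eq_bigr => t _.
    by rewrite linearZ /= mulrC.
  rewrite mxE cE.
  apply: (@cderiv_near _ (fun s => \sum_t coord v j [ffun t' => (t' == t)%:R] * f i (upd z k s) t)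
     _ _ _ 1) => //.
    by move=> h _; rewrite mxE uE cE.
  apply: cderiv_sum => t _; apply: cderivZ; rewrite ffunE.
  by apply: derivable_cderiv; exact: zd.
have M'E : M' = (Umx (upd z k (z 0 k))) *m ((kappa * z 0 k)^-1 *: A).
  apply/matrixP => i j; rewrite upd_id mxE.
  have [_ /(_ k)] := u_kz i Uz.
  rewrite /nabla -addrA -opprD => /eqP; rewrite subr_eq0 => /eqP.
  rewrite -/(kz_op x lam z k (f i z)) => e.
  have -> : zpartial k (f i) z = (kappa * z 0 k)^-1 *: kz_op x lam z k (f i z).
    by rewrite -e scalerA mulVf // scale1r.
  rewrite linearZ /= {1}/f (opmx_sum v_basis) => [|w]; last exact: kz_op_wspace.
  rewrite coord_sum_free ?(basis_free v_basis) // -scalemxAr mxE; congr (_ * _).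
  rewrite [RHS]mxE; apply: eq_bigr => l _; congr (_ * _).
  by rewrite mxE.
have := cderiv_det M'd M'E; rewrite mxtraceZ trace_onE upd_id.
by rewrite -(opmx_trace v_basis (vbasisP W)) // => w; exact: kz_op_wspace.
Qed.

Variables (logz : 'I_n -> 'rV[C]_n -> C) (logd : 'I_n -> 'I_n -> 'rV[C]_n -> C).
Hypotheses (U_open : open U) (U_connected : connected U).
Hypothesis logz_branch : forall k, log_branch U (fun z => z 0 k) (logz k).
Hypothesis logd_branch : forall k l : 'I_n, (k < l)%N ->
  log_branch U (fun z => z 0 k - z 0 l) (logd k l).

(** A logarithm of the [z]-dependent factors of [D]. *)
Definition kz_exponent (z : 'rV[C]_n) : C :=
  \sum_k (Lambda V nu k lam / kappa - gammak V nu x k / (2 * kappa)) * logz k z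
  + \sum_(k < n) \sum_(l < n | (k < l)%N) epsilon V nu x k l / kappa * logd k l z.

Lemma kz_exponent_cderiv z m : U z -> cderiv (fun s => kz_exponent (upd z m s)) (z 0 m)
  ((kappa * z 0 m)^-1 * trace_on W (kz_op x lam z m)).
Proof.
move=> Uz; have [zn0 zne] := U_config Uz.
pose a k := Lambda V nu k lam / kappa - gammak V nu x k / (2 * kappa).
pose e k l := epsilon V nu x k l / kappa.
have hz k : cderiv (fun s => a k * logz k (upd z m s)) (z 0 m)
    (a k * ((k == m)%:R / z 0 k)).
  apply: cderivZ; apply: (log_slice_cderiv U_open (logz_branch k) Uz) => s.
  by rewrite mxE; case: eqP => [->|_]; rewrite ?mul1r ?mul0r ?addr0 // addrC subrK.
have hd (k l : 'I_n) : (k < l)%N -> cderiv (fun s => e k l * logd k l (upd z m s)) (z 0 m)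
    (e k l * (((k == m)%:R - (l == m)%:R) / (z 0 k - z 0 l))).
  move=> kl; apply: cderivZ.
  apply: (log_slice_cderiv U_open (logd_branch kl) Uz) => s.
  rewrite !mxE; case: eqP => [->|_]; case: eqP => [->|_] /=.
  - by rewrite !subrr mul0r addr0.
  - by rewrite subr0 mul1r [RHS]addrC addrA subrK.
  - by rewrite sub0r mulN1r opprB addrA subrK.
  - by rewrite subrr mul0r addr0.
have s1 : cderiv (fun s => \sum_k a k * logz k (upd z m s)) (z 0 m)
    (\sum_k a k * ((k == m)%:R / z 0 k)).
  by apply: cderiv_sum => k _; exact: hz.
have s2 : cderiv (fun s => \sum_(k < n) \sum_(l < n | (k < l)%N)
      e k l * logd k l (upd z m s)) (z 0 m)
    (\sum_(k < n) \sum_(l < n | (k < l)%N)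
      e k l * (((k == m)%:R - (l == m)%:R) / (z 0 k - z 0 l))).
  by apply: cderiv_sum => k _; apply: cderiv_sum => l kl; exact: hd.
have := cderivD s1 s2.
rewrite (bigD1 m) //= [X in _ + X + _]big1 ?addr0 => [|k /negbTE ->]; last first.
  by rewrite mul0r mulr0.
rewrite eqxx kz_op_trace mul1r -kz_exponent_identity //.
by move=> k l; exact: epsilonC.
Qed.

Lemma kz_det_const z w : U z -> U w ->
  \det (Umx w) * expC (- kz_exponent w) = \det (Umx z) * expC (- kz_exponent z).
Proof.
apply: (connected_const (F := fun y => \det (Umx y) * expC (- kz_exponent y))) => // y k Uy.
have h1 := det_kz_cderiv k Uy.
have := cderiv_expC (cderivZ (-1) (kz_exponent_cderiv k Uy)); rewrite !mulN1r.
move=> h2; have := cderivM h1 h2; rewrite upd_id.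
have cancel (q A B : C) : A * (- q * B) + q * A * B = 0.
  by rewrite mulNr mulrN mulrCA [q * (A * B)]mulrA addNr.
rewrite [-1 * kz_exponent y]mulN1r cancel.
by apply: (cderiv_near ltr01) => h _; rewrite mulN1r.
Qed.

End KZDeterminant.

(** * The Gamma function *)

Section GammaFunction.
Local Open Scope complex_scope.
Variable R : realType.
Local Notation C := (CC R).
Local Notation nc := (@Normc.normc R).

Lemma cvgC_P (P : nat -> C) (l : C) :
  (forall e : R, 0 < e -> exists M, forall m, (M <= m)%N -> nc (P m - l) < e) ->
  P @ \oo --> l.
Proof.
move=> h; apply/cvgrPdist_lt => e /pos_complex[x x0 ->].
have [M hM] := h x x0; exists M => // m /= Mm.
by rewrite normCE ltcR -ncN opprB hM.
Qed.

(** [a - c] is nondecreasing and bounded, and [c] tends to 0. *)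
Lemma gap_cvg (a c : nat -> R) : (forall m, 0 <= c m) -> c @ \oo --> (0 : R) ->
  (forall m, `|a m.+1 - a m| <= c m - c m.+1) -> exists l : R, a @ \oo --> l.
Proof.
move=> c0 cc ha.
have inc : nondecreasing_seq (fun m => a m - c m).
  apply/nondecreasing_seqP => m; have := ha m; rewrite ler_norml => /andP[h1 _].
  by lra.
have dec m : a m + c m <= a 0%N + c 0%N.
  elim: m => // m; apply: le_trans; have := ha m; rewrite ler_norml => /andP[_ h1].
  by lra.
have : cvgn (fun m => a m - c m).
  apply: nondecreasing_is_cvgn => //; exists (a 0%N + c 0%N) => _ [m _ <-].
  by have := dec m; have := c0 m; lra.
move=> /cvg_ex[l al]; exists (l + 0).
have -> : a = (fun m => (a m - c m) + c m) by apply/funext => m; rewrite subrK.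
exact: cvgD.
Qed.

Lemma gap_cvgC (P : nat -> C) (c : nat -> R) : (forall m, 0 <= c m) ->
  c @ \oo --> (0 : R) -> (forall m, nc (P m.+1 - P m) <= c m - c m.+1) ->
  exists l : C, P @ \oo --> l.
Proof.
move=> c0 cc hP.
have [|a /cvgrPdist_lt ha] := @gap_cvg (fun m => complex.Re (P m : R[i])) c c0 cc.
  move=> m; apply: le_trans (hP m); apply: le_trans (nc_Re _).
  by case: (P m) => ? ?; case: (P m.+1).
have [|b /cvgrPdist_lt hb] := @gap_cvg (fun m => complex.Im (P m : R[i])) c c0 cc.
  move=> m; apply: le_trans (hP m); apply: le_trans (nc_Im _).
  by case: (P m) => ? ?; case: (P m.+1).
exists (a +i* b); apply: cvgC_P => e e0; have e20 : 0 < e / 2 by rewrite divr_gt0.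
have [M1 _ h1] := ha _ e20; have [M2 _ h2] := hb _ e20.
exists (maxn M1 M2) => m; rewrite geq_max => /andP[m1 m2].
apply: le_lt_trans (nc_le _) _.
have := h1 m m1; have := h2 m m2; rewrite /= ![`|_ - complex.Im _|]distrC ![`|_ - complex.Re _|]distrC.
by case: (P m) => p q /=; lra.
Qed.

(* Increments of P relative to P m that are dominated by a telescoping sequence
   keep the limit away from 0. *)
Lemma product_cvg (P : nat -> C) (c : nat -> R) : (forall m, 0 <= c m <= 2^-1) ->
  (forall m, 0 <= c m - c m.+1) -> c @ \oo --> (0 : R) -> P 0%N != 0 ->
  (forall m, nc (P m.+1 - P m) <= (c m - c m.+1) * nc (P m)) ->
  exists2 l : C, l != 0 & P @ \oo --> l.
Proof.
move=> c02 cd cc P0 hP.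
have c0 m : 0 <= c m by case/andP: (c02 m).
have cK m : c m <= 2^-1 by case/andP: (c02 m).
(* The increment bound makes [|P m| exp(c m)] nonincreasing, and [|P m| exp(-2 c m)] nondecreasing
   because [1 - x >= exp(-2 x)] for [0 <= x <= 1/2]. *)
have up m : nc (P m) * expR (c m) <= nc (P 0%N) * expR (c 0%N).
  elim: m => // m; apply: le_trans.
  have : nc (P m.+1) <= nc (P m) * expR (c m - c m.+1).
    have -> : P m.+1 = P m + (P m.+1 - P m) by rewrite addrC subrK.
    apply: le_trans (ncD _ _) _; have := hP m; have := expR_ge1Dx (c m - c m.+1).
    have := nc_ge0 (P m); nra.
  move=> /(ler_wpM2r (expR_ge0 (c m.+1))) /le_trans; apply.
  by rewrite -mulrA -expRD subrK.
have low m : nc (P 0%N) * expR (- 2 * c 0%N) <= nc (P m) * expR (- 2 * c m).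
  elim: m => // m /le_trans; apply.
  have : nc (P m) * expR (- 2 * (c m - c m.+1)) <= nc (P m.+1).
    have h1 : nc (P m) - (c m - c m.+1) * nc (P m) <= nc (P m.+1).
      have := ncB (P m.+1) (P m.+1 - P m); rewrite subKr; have := hP m.
      lra.
    apply: le_trans h1; set x := c m - c m.+1.
    have x0 : 0 <= x := cd m.
    have x2 : x <= 2^-1 by rewrite /x; have := cK m; have := c0 m.+1; lra.
    have -> : nc (P m) - x * nc (P m) = nc (P m) * (1 - x) by ring.
    apply: ler_wpM2l; first exact: nc_ge0.
    have -> : - 2 * x = - (2 * x) by ring.
    rewrite expRN -div1r ler_pdivrMr ?expR_gt0 //.
    have := expR_ge1Dx (2 * x); nra.
  move=> /(ler_wpM2r (expR_ge0 (- 2 * c m.+1))); apply: le_trans.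
  by rewrite -mulrA -expRD -mulrDr subrK.
pose B := nc (P 0%N) * expR (c 0%N).
have PB m : nc (P m) <= B.
  apply: le_trans (up m); rewrite ler_peMr ?nc_ge0 //.
  by have := expR_ge1Dx (c m); have := c0 m; lra.
have B0 : 0 <= B := le_trans (nc_ge0 _) (PB 0%N).
have [|||l Pl] := @gap_cvgC P (fun m => c m * B).
- by move=> m; rewrite mulr_ge0.
- by rewrite -[X in _ --> X](mul0r B); apply: cvgM => //; exact: cvg_cst.
- by move=> m; apply: le_trans (hP m) _; rewrite -mulrBl ler_wpM2l.
exists l => //; apply/eqP => l0.
pose L := nc (P 0%N) * expR (- 2 * c 0%N).
have L0 : 0 < L by rewrite mulr_gt0 ?nc_gt0 ?expR_gt0.
have /cvgrPdist_lt/(_ L%:C) := Pl; rewrite ltcR => /(_ L0)[M _ /(_ M (leqnn M))].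
rewrite l0 sub0r normrN normCE ltcR ltNge => /negP; apply.
apply: le_trans (low M) _; rewrite ler_piMr ?nc_ge0 //.
by rewrite -[leRHS]expR0 ler_expR mulNr oppr_le0 mulr_ge0.
Qed.

Definition gauss (z : C) (m : nat) : C :=
  (m`!)%:R * expC (z * (ln (m%:R : R))%:C) / \prod_(j < m.+1) (z + j%:R).

Lemma gauss_neq0 z m : ~ Gamma_pole z -> gauss z m != 0.
Proof.
move=> np; apply: mulf_neq0.
  by apply: mulf_neq0; [rewrite pnatr_eq0 -lt0n fact_gt0|exact: expC_neq0].
rewrite invr_eq0; apply/prodf_neq0 => j _; apply/eqP => zj.
by apply: np; exists j; apply/eqP; rewrite -addr_eq0 zj.
Qed.

Lemma nc_nat m : nc (m%:R : C) = m%:R.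
Proof. by rewrite -(rmorph_nat (real_complex R)) nc_real ger0_norm. Qed.

(** The ratio of consecutive terms is [a / (z + a)] times [exp(z h)], with [a = m + 2] and [h] the
    increment of [ln]. Extracting [a / (z + a)] from the ratio minus 1 leaves a factor of second
    order in [1 / m]. *)
Lemma gauss_step z m : ~ Gamma_pole z ->
  gauss z m.+2 - gauss z m.+1 = gauss z m.+1 * (m.+2%:R / (z + m.+2%:R)) *
    (expC (z * (ln (m.+2%:R : R) - ln (m.+1%:R : R))%:C) - 1 - z / m.+2%:R).
Proof.
move=> np.
have zn j : z + j%:R != 0.
  by apply/eqP => zj; apply: np; exists j; apply/eqP; rewrite -addr_eq0 zj.
have -> : gauss z m.+2 = gauss z m.+1 * (m.+2%:R / (z + m.+2%:R))
    * expC (z * (ln (m.+2%:R : R) - ln (m.+1%:R : R))%:C).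
  rewrite /gauss factS natrM big_ord_recr /= rmorphB /= mulrBr.
  have -> : z * (ln m.+2%:R)%:C = z * (ln m.+1%:R)%:C + (z * (ln m.+2%:R)%:C - z * (ln m.+1%:R)%:C).
    by rewrite addrCA subrr addr0.
  rewrite expCD [_ + (_ - _) - _]addrAC subrr add0r invfM.
  have reorder (K : comNzRingType) (a f u v p q : K) :
    a * f * (u * v) * (p * q) = f * u * p * (a * q) * v by ring.
  exact: reorder.
have factor (K : fieldType) (g a w e : K) : a != 0 -> w + a != 0 ->
    g * (a / (w + a)) * e - g = g * (a / (w + a)) * (e - 1 - w / a).
  by move=> a0 wa0; field; rewrite a0 wa0.
by apply: factor; rewrite ?pnatr_eq0.
Qed.

(** [exp x >= 1 + x] at [h] and at [- h] places [h] between [1 / (m + 2)] and [1 / (m + 1)]. *)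
Lemma ln_step m h : h = ln (m.+2%:R : R) - ln (m.+1%:R : R) ->
  0 <= h - m.+2%:R^-1 <= m.+1%:R^-1 - m.+2%:R^-1.
Proof.
move=> hE; have p1 : 0 < m.+1%:R :> R by rewrite ltr0n.
have p2 : 0 < m.+2%:R :> R by rewrite ltr0n.
have Eh : expR h = m.+2%:R / m.+1%:R.
  by rewrite hE expRD expRN !lnK ?posrE.
have h1 := expR_ge1Dx h; have h2 := expR_ge1Dx (- h).
rewrite expRN Eh invf_div in h2; rewrite Eh in h1.
have e1 : m.+2%:R / m.+1%:R = 1 + m.+1%:R^-1 :> R.
  by rewrite -[m.+2]addn1 natrD mulrDl divff ?gt_eqF // mul1r.
have e2 : m.+1%:R / m.+2%:R = 1 - m.+2%:R^-1 :> R.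
  have {1}-> : m.+1%:R = m.+2%:R - 1 :> R by rewrite -[m.+2]addn1 natrD addrK.
  by rewrite mulrBl divff ?gt_eqF // mul1r.
rewrite e1 lerD2l in h1; rewrite e2 lerD2l lerN2 in h2.
by rewrite subr_ge0 h2 lerD2r h1.
Qed.

Lemma gauss_increment z : exists K M, forall m, (M <= m)%N -> ~ Gamma_pole z ->
  0 <= K /\ nc (gauss z m.+2 - gauss z m.+1)
    <= (K / m.+1%:R - K / m.+2%:R) * nc (gauss z m.+1).
Proof.
pose q := nc z; have q0 : 0 <= q := nc_ge0 z.
(* With [a = m + 2], the factor 2 bounds [a / |z + a|]; [16 q^2] comes from [8 |z h|^2] and [q] from
   replacing [h] by [1 / a]. The index bound ensures [2 |z| <= m + 1]. *)
exists (2 * (16 * q ^+ 2 + q)), (Num.bound (2 * q)) => m Mm np.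
have p1 : 0 < m.+1%:R :> R by rewrite ltr0n.
have p2 : 0 < m.+2%:R :> R by rewrite ltr0n.
have qm : 2 * q <= m.+1%:R.
  apply: ltW; apply: lt_le_trans (archi_boundP _) _; first by rewrite mulr_ge0.
  by rewrite ler_nat (leq_trans Mm).
split; first by rewrite mulr_ge0 // addr_ge0 // mulr_ge0 // sqr_ge0.
rewrite gauss_step // !(ncM (gauss _ _ * _)) (ncM (gauss _ _)) -mulrA [leRHS]mulrC.
rewrite ler_wpM2l ?nc_ge0 // ncM ncV nc_nat.
have /andP[] := ln_step (erefl (ln (m.+2%:R : R) - ln m.+1%:R)); set h := ln _ - ln _; clearbody h.
have i12 : m.+1%:R^-1 - m.+2%:R^-1 = m.+1%:R^-1 * m.+2%:R^-1 :> R.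
  have gen (a b : R) : a != 0 -> b != 0 -> b = a + 1 -> a^-1 - b^-1 = a^-1 * b^-1.
    by move=> a0 b0 e; subst b; field; rewrite a0 b0.
  by apply: gen; rewrite ?gt_eqF // -[m.+2]addn1 natrD.
have i21 : m.+1%:R^-1 <= 2 * m.+2%:R^-1 :> R.
  by rewrite ler_pdivlMr // mulrC ler_pdivrMr // -natrM ler_nat; lia.
have qi : q * m.+1%:R^-1 <= 2^-1.
  rewrite ler_pdivrMr // mulrC ler_pdivlMr // mulrC //.
have i10 : 0 < m.+1%:R^-1 :> R by rewrite invr_gt0.
have i20 : 0 < m.+2%:R^-1 :> R by rewrite invr_gt0.
have zm2 : m.+2%:R / 2 <= nc (z + m.+2%:R).
  have := ncB (z + m.+2%:R) z; rewrite addrC addKr nc_nat -/q.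
  have : m.+2%:R = m.+1%:R + 1 :> R by rewrite -natr1.
  by move: qm p1; set a := m.+1%:R; set b := m.+2%:R; lra.
have n1 : m.+2%:R / nc (z + m.+2%:R) <= 2.
  by rewrite ler_pdivrMr ?(lt_le_trans _ zm2) ?divr_gt0 // mulrC -ler_pdivrMr.
move: i12 i21 qi i10 i20; set i1 := m.+1%:R^-1; set i2 := m.+2%:R^-1.
move=> i12 i21 qi i10 i20 h1 h2.
set X := expC _ - 1 - _.
have h0 : 0 <= h by lra.
have hi : h <= i1 by lra.
have nX : nc X <= (16 * q ^+ 2 + q) * (i1 - i2).
  pose w := z * h%:C; have nw : nc w = q * h by rewrite ncM nc_real ger0_norm.
  have -> : X = (expC w - 1 - w) + z * (h - i2)%:C.
    rewrite /X rmorphB /= mulrBr addrA subrK; congr (_ - _ * _).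
    by rewrite /i2 fmorphV /= rmorph_nat.
  apply: le_trans (ncD _ _) _; rewrite mulrDl; apply: lerD.
    apply: le_trans (expC_estimate _) _; rewrite nw.
      by apply: le_trans qi; rewrite ler_wpM2l.
    have : (q * h) ^+ 2 <= q ^+ 2 * (2 * (i1 - i2)).
      rewrite exprMn ler_wpM2l ?sqr_ge0 // i12.
      apply: (@le_trans _ _ (i1 * i1)); last by rewrite mulrCA ler_wpM2l // ltW.
      by rewrite expr2 ler_pM.
    lra.
  by rewrite ncM nc_real ger0_norm // ler_wpM2l.
apply: le_trans (ler_pM _ (nc_ge0 X) n1 nX) _.
  by rewrite divr_ge0 // nc_ge0.
by rewrite mulrA mulrBr.
Qed.

Lemma gauss_cvg z : ~ Gamma_pole z -> exists2 l : C, l != 0 & gauss z @ \oo --> l.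
Proof.
move=> np; have [K [M hM]] := gauss_increment z.
have K0 : 0 <= K by have [] := hM M (leqnn M) np.
(* The start of the sequence is shifted so that [c] stays below [1/2], as [product_cvg] requires. *)
pose s := (M + Num.bound (2 * K))%N; pose c m := K / (m + s).+1%:R : R.
have sK : 2 * K <= s%:R.
  apply: ltW; apply: lt_le_trans (archi_boundP _) _; first by rewrite mulr_ge0.
  by rewrite ler_nat leq_addl.
have [|||||l l0 Pl] := @product_cvg (fun m => gauss z (m + s).+1) c.
- move=> m; rewrite divr_ge0 //= ler_pdivrMr ?ltr0n // mulrC ler_pdivlMr // mulrC.
  by apply: le_trans sK _; rewrite ler_nat; apply: leqW; exact: leq_addl.
- by move=> m; rewrite subr_ge0 ler_wpM2l // lef_pV2 ?posrE ?ltr0n // ler_nat.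
- rewrite -[X in _ --> X](mulr0 K); apply: cvgM; first exact: cvg_cst.
  by have := @cvg_harmonic R; rewrite -(cvg_shiftn s).
- exact: gauss_neq0.
- by move=> m; have [|_] := hM (m + s)%N _ np; rewrite // addnC -addnA leq_addr.
exists l => //; rewrite -(cvg_shiftn s.+1).
by apply: cvg_trans Pl; under eq_fun do rewrite addnS.
Qed.

Lemma Gamma_lim (z l : C) : gauss z @ \oo --> l -> Gamma z = l.
Proof. by move=> gl; apply: (cvg_lim _ gl); exact: norm_hausdorff. Qed.

Lemma Gamma_neq0 (z : C) : ~ Gamma_pole z -> Gamma z != 0.
Proof. by move=> /gauss_cvg[l l0 /Gamma_lim->]. Qed.

Lemma Gamma_at_pole (z : C) : Gamma_pole z -> Gamma z = 0.
Proof.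
move=> [M zM]; apply: Gamma_lim; apply: cvgC_P => e e0; exists M => m Mm.
rewrite /gauss (bigD1 (Ordinal (Mm : (M < m.+1)%N))) //= zM addNr mul0r invr0 mulr0.
by rewrite subrr nc0.
Qed.

Lemma Gamma_poleS (z : C) : ~ Gamma_pole z -> ~ Gamma_pole (z + 1).
Proof.
move=> np [m zm]; apply: np; exists m.+1.
by rewrite -natr1 opprD -zm addrK.
Qed.

(** At index [m + 1] the Gauss products of [z + 1] and [z] differ by the factor
    [z (m + 1) / (z + m + 2)], which tends to [z]. *)
Lemma Gamma_rec (z : C) : ~ Gamma_pole z -> Gamma (z + 1) = z * Gamma z.
Proof.
move=> np; have [l l0 gl] := gauss_cvg np; rewrite (Gamma_lim gl).
have zn j : z + j%:R != 0.
  by apply/eqP => zj; apply: np; exists j; apply/eqP; rewrite -addr_eq0 zj.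
have z0 : z != 0 by have := zn 0%N; rewrite addr0.
apply: Gamma_lim; rewrite -(cvg_shiftS _).
have gE m : gauss (z + 1) m.+1 = (z * gauss z m.+1) * (m.+1%:R / (z + m.+2%:R)).
  have lnm : expC ((ln (m.+1%:R : R))%:C : C) = m.+1%:R.
    rewrite /expC /= cos0 sin0 mulr0 mulr1 lnK ?posrE ?ltr0n //.
    exact: (rmorph_nat (real_complex R)).
  rewrite /gauss mulrDl mul1r expCD lnm.
  have -> : \prod_(j < m.+2) (z + 1 + j%:R) = (\prod_(j < m.+2) (z + j%:R)) * (z + m.+2%:R) / z.
    have e : \prod_(j < m.+3) (z + j%:R) = z * \prod_(j < m.+2) (z + 1 + j%:R).
      rewrite [LHS]big_ord_recl addr0; congr (_ * _); apply: eq_bigr => j _.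
      by rewrite lift0 mulrS addrA.
    have e2 : \prod_(j < m.+3) (z + j%:R) = (\prod_(j < m.+2) (z + j%:R)) * (z + m.+2%:R).
      by rewrite big_ord_recr.
    by rewrite -e2 e mulrC mulKf.
  rewrite !invfM invrK; set A := (_`!)%:R; set B := expC _; set D := m.+1%:R.
  set P := (\prod_(_ < _) _)^-1; set Q := (z + _)^-1.
  have reorder (K : comNzRingType) (a b d p q w : K) :
    a * (b * d) * (p * q * w) = w * (a * b * p) * (d * q) by ring.
  exact: reorder.
rewrite (_ : (fun m => gauss (z + 1) m.+1) =
  (fun m => (z * gauss z m.+1) * (m.+1%:R / (z + m.+2%:R)))); last exact/funext.
suff : (fun m => (z * gauss z m.+1) * (m.+1%:R / (z + m.+2%:R))) @ \oo --> z * l * 1.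
  by rewrite mulr1.
apply: cvgM.
  by apply: cvgM; [exact: cvg_cst|rewrite (cvg_shiftS (gauss z))].
apply: cvgC_P => e e0; pose q := nc z; have q0 : 0 <= q := nc_ge0 z.
exists (Num.bound ((q + 1) / e + q)) => m Mm.
have mq : (q + 1) / e + q < m%:R.
  apply: lt_le_trans (archi_boundP _) _; last by rewrite ler_nat.
  by rewrite addr_ge0 // divr_ge0 ?addr_ge0 // ltW.
have -> : m.+1%:R / (z + m.+2%:R) - 1 = - (z + 1) / (z + m.+2%:R).
  rewrite -[X in _ - X](divff (zn m.+2)) -mulrBl; congr (_ / _).
  by rewrite -[m.+2%:R]natr1 addrCA opprD addrA subrr add0r.
rewrite ncM ncN ncV ltr_pdivrMr ?nc_gt0 //.
have d1 : q * 1 + 0 <= q by rewrite mulr1 addr0.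
have n1 : nc (z + 1) <= q + 1 by apply: le_trans (ncD _ _) _; rewrite nc1.
have n2 : m%:R - q < nc (z + m.+2%:R).
  have := ncB (z + m.+2%:R) z; rewrite addrC addKr nc_nat -/q.
  have : m%:R + 2 = m.+2%:R :> R by rewrite -natrD addn2.
  by lra.
apply: le_lt_trans n1 _.
have : (q + 1) / e < m%:R - q by lra.
rewrite ltr_pdivrMr // mulrC => h1; apply: lt_trans h1 _.
by rewrite ltr_pM2l.
Qed.

(** At a pole both sides are 0 under the convention for [Gamma]. The denominators of [X] call for
    this generality, since [Xfun_defined] restricts the numerators only. *)
Lemma Gamma_inv_rec (z : C) : (Gamma z)^-1 = z * (Gamma (z + 1))^-1.
Proof.
have [[m zm]|np] := pselect (Gamma_pole z); last first.
  have z0 : z != 0 by apply/eqP => z0; apply: np; exists 0%N; rewrite oppr0.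
  by rewrite Gamma_rec // invfM mulrA mulfV // mul1r.
rewrite (Gamma_at_pole (ex_intro _ m zm)) invr0; case: m zm => [|m] zm.
  by rewrite zm oppr0 mul0r.
rewrite (@Gamma_at_pole (z + 1)) ?invr0 ?mulr0 //; exists m.
by rewrite zm -natr1 opprD subrK.
Qed.

End GammaFunction.

(** * The difference equations in lambda *)

Section Coweights.
Variables (C : numClosedFieldType) (r : nat).
Local Notation N := r.+1.

Lemma coweight_entry (i : 'I_r) (a b : 'I_N) :
  coweight C i a b = (a == b)%:R * ((a <= i)%N%:R - i.+1%:R / N%:R).
Proof.
have -> : coweight C i
    = \sum_(j < N) ((j <= i)%N%:R - i.+1%:R / N%:R) *: (delta_mx j j : 'M[C]_N).
  rewrite /coweight [X in X - _]big_mkcond [X in _ - X]big_mkcond -sumrB /=.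
  apply: eq_bigr => j _; rewrite ltnNge; case: (j <= i)%N => /=; first by rewrite subr0.
  by rewrite !sub0r scaleNr.
rewrite summxE (bigD1 a) //= big1 => [|k ka]; rewrite !mxE ?eqxx /=.
  by rewrite addr0 eq_sym mulrC.
by rewrite eq_sym (negbTE ka) mulr0.
Qed.

Lemma coweight_cartan (i : 'I_r) : cartan (coweight C i).
Proof.
apply/andP; split.
  by apply/is_diag_mxP => a b ab; rewrite coweight_entry -val_eqE (negbTE ab) mul0r.
rewrite /mxtrace; under eq_bigr do rewrite coweight_entry eqxx mul1r.
rewrite sumrB sumr_const card_ord -[X in _ - X]mulr_natr divfK ?pnatr_eq0 //.
rewrite subr_eq0 -natr_sum; apply/eqP; congr _%:R.
have iN : (i.+1 <= N)%N by rewrite ltnS ltnW.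
rewrite -[RHS]card_ord -sum1_card (big_ord_widen N (fun=> 1%N) iN).
by rewrite [RHS]big_mkcond; apply: eq_bigr => a _; rewrite ltnS; case: leqP.
Qed.

(** The condition on the right is the one of [inversions_w_bracket]: a shift by a fundamental
    coweight affects exactly the roots occurring in [B] for [w_[i]]. *)
Lemma gform_coweight (i : 'I_r) (a : slroot r) : posroot a ->
  gform (coweight C i) (rootH C a) = ((a.1 <= i) && (i < a.2))%N%:R.
Proof.
rewrite /posroot gform_rootH !coweight_entry !eqxx !mul1r => a12.
have -> : (a.1 <= i)%N%:R - i.+1%:R / N%:R - ((a.2 <= i)%N%:R - i.+1%:R / N%:R)
    = (a.1 <= i)%N%:R - (a.2 <= i)%N%:R :> C by ring.
case: (leqP a.2 i) => ai; last by rewrite andbT subr0.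
by rewrite andbF (leq_trans (ltnW a12) ai) subrr.
Qed.

Lemma coweight_lattice0 : coweight_lattice (0 : 'M[C]_N).
Proof. by exists (fun=> 0); rewrite big1 // => i _; rewrite scale0r. Qed.

Lemma coweight_latticeD (om om' : 'M[C]_N) :
  coweight_lattice om -> coweight_lattice om' -> coweight_lattice (om + om').
Proof.
move=> [c ->] [c' ->]; exists (fun i => c i + c' i); rewrite -big_split.
by apply: eq_bigr => i _; rewrite rmorphD scalerDl.
Qed.

Lemma coweight_latticeN (om : 'M[C]_N) :
  coweight_lattice om -> coweight_lattice (- om).
Proof.
move=> [c ->]; exists (fun i => - c i); rewrite -sumrN.
by apply: eq_bigr => i _; rewrite rmorphN scaleNr.
Qed.

Lemma coweight_lattice_seq (s : seq 'I_r) :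
  coweight_lattice (\sum_(i <- s) coweight C i).
Proof.
elim: s => [|i s IH]; first by rewrite big_nil; exact: coweight_lattice0.
rewrite big_cons; apply: coweight_latticeD => //.
exists (fun j => (j == i)%:R); rewrite (bigD1 i) //= eqxx scale1r big1 ?addr0 // => j ji.
by rewrite (negbTE ji) scale0r.
Qed.

Lemma coweight_multiset (c : 'I_r -> nat) : exists s : seq 'I_r,
  \sum_(i <- s) coweight C i = \sum_i (c i)%:R *: coweight C i.
Proof.
exists (flatten [seq nseq (c i) i | i <- index_enum 'I_r]).
rewrite big_flatten big_map; apply: eq_bigr => i _.
by rewrite big_nseq iter_addr_0 scaler_nat.
Qed.

End Coweights.

Section Recursion.
Variables (R : realType) (r n : nat) (V : 'I_n -> slMod (CC R) r).
Local Notation C := (CC R).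
Local Notation N := r.+1.
Local Notation tensor := (tensor V).
Local Notation D := (\dim {: tensor}).
Variables (kappa : C) (kappa0 : kappa != 0) (nu : 'M[C]_N).

Lemma Gamma_ratio_step (p q : C) : ~ Gamma_pole p -> p != 0 ->
  Gamma p / Gamma q = q / p * (Gamma (p + 1) / Gamma (q + 1)).
Proof.
move=> np p0; rewrite Gamma_rec // Gamma_inv_rec.
have abs (K : fieldType) (g h a b : K) : a != 0 -> g * (b * h) = b / a * (a * g * h).
  by move=> ?; field.
exact: abs.
Qed.

Section Step.
Variables (lam lam' : 'M[C]_N) (m : 'I_r) (a : slroot r).
Hypothesis a_pos : posroot a.
Hypothesis lam'E : lam' = lam + kappa *: coweight C m.
Local Notation crosses := ((a.1 <= m) && (m < a.2))%N.
Local Notation num l := (X_num kappa nu a l).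
Local Notation den l := (X_den kappa nu a l).

Lemma X_num_step j : num lam j = num lam' j + crosses%:R.
Proof.
rewrite lam'E /X_num !gformBl gformDl [gform (kappa *: _) _]gformZl gform_coweight //.
have abs (K : fieldType) (x k y e : K) : k != 0 ->
    1 - (x - y) / k = 1 - (x + k * e - y) / k + e by move=> ?; field.
exact: abs.
Qed.

Lemma X_den_step j : den lam j = den lam' j + crosses%:R.
Proof.
rewrite lam'E /X_den !gformDl [gform (kappa *: _) _]gformZl gform_coweight //.
have abs (K : fieldType) (x k y e : K) : k != 0 ->
    1 - (x + y) / k = 1 - (x + k * e + y) / k + e by move=> ?; field.
exact: abs.
Qed.

Lemma X_num_same j : ~~ crosses -> num lam j = num lam' j.
Proof. by move=> /negbTE ac; have := X_num_step j; rewrite ac => ->; exact: addr0. Qed.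

Lemma X_den_same j : ~~ crosses -> den lam j = den lam' j.
Proof. by move=> /negbTE ac; have := X_den_step j; rewrite ac => ->; exact: addr0. Qed.

Lemma X_num_crossed j : crosses -> num lam j = num lam' j + 1.
Proof. by move=> ac; rewrite X_num_step ac. Qed.

Lemma X_den_crossed j : crosses -> den lam j = den lam' j + 1.
Proof. by move=> ac; rewrite X_den_step ac. Qed.

Lemma X_num_unshift j : crosses -> num lam' j = - (half_unshift nu a lam j / kappa).
Proof.
move=> ac; apply/(addIr 1); have := X_num_step j; rewrite ac => <-.
by rewrite [RHS]addrC.
Qed.

Lemma X_den_shift j : crosses -> den lam' j = - (half_shift nu a lam j / kappa).
Proof.
move=> ac; apply/(addIr 1); have := X_den_step j; rewrite ac => <-.
by rewrite [RHS]addrC.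
Qed.

Lemma pole_natr (z : C) (b : nat) : ~ Gamma_pole z -> ~ Gamma_pole (z + b%:R).
Proof.
elim: b => [|b IH] np; first by rewrite addr0.
by rewrite -natr1 addrA; apply: Gamma_poleS; exact: IH.
Qed.

Hypothesis defined : Xfun_defined V kappa nu a lam'.

(** Going down adds 0 or 1 to the arguments of the Gamma functions, and adding a natural number to a
    regular point never gives a pole. *)
Lemma Xfun_defined_down : Xfun_defined V kappa nu a lam.
Proof. by move=> k j mk jk; rewrite X_num_step; apply: pole_natr; exact: (defined mk jk). Qed.

(** At the upper point the numerator Gamma function has the argument [- half_unshift / kappa], and 0
    is a pole. *)
Lemma half_unshift_neq0 : crosses -> forall (k : 'I_D) j,
  (0 < sl2_mult V nu a k)%N -> (1 <= j <= k)%N -> half_unshift nu a lam j != 0.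
Proof.
move=> ac k j mk jk; apply/eqP => h0; apply: (defined mk jk); exists 0%N.
by rewrite X_num_unshift // h0 mul0r.
Qed.

(** The numerator changes by the functional equation at a regular point, the denominator by the one
    of [1 / Gamma], valid everywhere; signs and powers of [kappa] cancel in the quotient. *)
Lemma Xfun_step : Xfun V kappa nu a lam' =
  (if crosses then \prod_(k < D)
     (\prod_(1 <= j < k.+1) (half_shift nu a lam j / half_unshift nu a lam j))
       ^+ sl2_mult V nu a k else 1) * Xfun V kappa nu a lam.
Proof.
case: ifP => ac; last first.
  rewrite [RHS]mul1r /Xfun; apply: eq_bigr => k _.
  apply: (congr1 (fun y : C => y ^+ _)); apply: eq_bigr => j _.
  have nac : ~~ crosses by rewrite ac.
  exact (f_equal2 (fun p q : C => Gamma p / Gamma q)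
    (esym (X_num_same j nac)) (esym (X_den_same j nac))).
rewrite /Xfun -big_split; apply: eq_bigr => k _ /=.
(* Definedness says nothing about a [k] of multiplicity 0, whose factor is trivial. *)
have [m0|mk] := posnP (sl2_mult V nu a k).
  rewrite m0; exact: esym (mulr1 1).
rewrite -exprMn -big_split /=; apply: (congr1 (fun y : C => y ^+ _)).
rewrite !big_nat; apply: eq_bigr => j jk.
have np := defined mk jk; have u0 := half_unshift_neq0 ac mk jk.
have pE := X_num_unshift j ac; have qE := X_den_shift j ac.
have pE1 := X_num_crossed j ac; have qE1 := X_den_crossed j ac.
move: np pE qE pE1 qE1 u0.
move: (num lam' j) (den lam' j) (num lam j) (den lam j).
move: (half_shift nu a lam j) (half_unshift nu a lam j) => x y p q p1 q1.
move=> np pE qE -> -> y0.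
have p0 : p != 0 by rewrite pE oppr_eq0 mulf_neq0 ?invr_eq0.
rewrite (Gamma_ratio_step _ np p0); apply: (congr1 (fun w : C => w * _)).
rewrite pE qE invrN mulrN mulNr opprK.
have abs (K : fieldType) (x' y' c : K) : y' != 0 -> c != 0 -> x' / c / (y' / c) = x' / y'.
  by move=> ? ?; field; apply/andP.
exact: abs.
Qed.

End Step.
End Recursion.

Section Determinant.
Variables (R : realType) (r n : nat) (V : 'I_n -> slMod (CC R) r).
Local Notation C := (CC R).
Local Notation N := r.+1.
Local Notation tensor := (tensor V).
Variables (kappa : C) (kappa0 : kappa != 0) (x : 'I_r -> 'M[C]_N) (nu : 'M[C]_N).
Local Notation W := (wspace V nu).
Variables (logz : 'I_n -> 'rV[C]_n -> C) (logd : 'I_n -> 'I_n -> 'rV[C]_n -> C).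

Definition Dz (z : 'rV[C]_n) (lam : 'M[C]_N) : C :=
  Dfun V kappa nu x (fun k => logz k z) (fun k l => logd k l z) lam.

Definition X_defined (lam : 'M[C]_N) : Prop :=
  forall a, posroot a -> Xfun_defined V kappa nu a lam.

Definition X_product (lam : 'M[C]_N) : C :=
  \prod_(a : 'I_N * 'I_N | posroot a) Xfun V kappa nu a lam.

Lemma DzE z lam : Dz z lam
  = expC (kz_exponent V x nu kappa lam logz logd z) * X_product lam.
Proof.
rewrite /Dz /Dfun -/(X_product lam); apply: (congr1 (fun y : C => y * _)).
rewrite expCD !expC_sum; apply: (congr1 (fun y : C => _ * y)).
by apply: eq_bigr => k _; rewrite expC_sum.
Qed.

Lemma Lambda_shift k lam om : cartan lam -> cartan om ->
  Lambda V nu k (lam + kappa *: om) = Lambda V nu k lam + kappa * Lambda V nu k om.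
Proof.
move=> lc oc; rewrite /Lambda -trace_onZ -trace_onD; apply: trace_on_ext => v.
by rewrite addrC act_at_lin ?cartan_tr // addrC.
Qed.

Lemma kz_exponent_shift z lam om : cartan lam -> cartan om ->
  kz_exponent V x nu kappa (lam + kappa *: om) logz logd z
  = kz_exponent V x nu kappa lam logz logd z + \sum_k Lambda V nu k om * logz k z.
Proof.
move=> lc oc.
have e : \sum_k (Lambda V nu k (lam + kappa *: om) / kappa
      - gammak V nu x k / (2 * kappa)) * logz k z
    = \sum_k (Lambda V nu k lam / kappa - gammak V nu x k / (2 * kappa)) * logz k z
      + \sum_k Lambda V nu k om * logz k z.
  rewrite -big_split; apply: eq_bigr => k _; rewrite Lambda_shift //.
  have abs (K : fieldType) (l c o g w : K) : c != 0 ->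
     ((l + c * o) / c - g) * w = (l / c - g) * w + o * w by move=> ?; field.
  exact: abs.
exact: etrans (congr1 (fun y : C => y + _) e) (addrAC _ _ _).
Qed.

(** The roots of the reduced word are exactly the crossing ones, so each positive root contributes
    either its determinant of [B] or 1. *)
Lemma X_product_step (m : 'I_r) (lam lam' : 'M[C]_N) s d (v : d.-tuple tensor) :
  lam' = lam + kappa *: coweight C m -> basis_of W v ->
  reduced_word (w_bracket m) s -> X_defined lam' ->
  X_product lam' = \det (opmx v (Broots (V := V) nu lam (word_roots s))) * X_product lam.
Proof.
move=> lamE bv sP Xd; have pr := w_bracket_word_roots sP.
have pos a : a \in word_roots s -> posroot a /\ ((a.1 <= m)%N && (m < a.2)%N).
  rewrite (perm_mem pr) mem_enum inE => ac; split=> //.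
  by case/andP: ac => h1 h2; exact: leq_ltn_trans h1 h2.
rewrite (Broots_det _ bv); last by move=> a /pos[/posroot_neq].
pose c (a : slroot r) := (a.1 <= m)%N && (m < a.2)%N.
pose detB a := \det (opmx v (Bop (V := V) nu lam a)).
have -> : \prod_(a <- word_roots s) detB a
    = \prod_(a : 'I_N * 'I_N | posroot a) (if c a then detB a else 1).
  rewrite (perm_big _ pr) big_enum /= -big_mkcondr.
  apply: eq_bigl => a; rewrite inE /c; case: andP => [[h1 h2]|_].
    by rewrite /posroot (leq_ltn_trans h1 h2).
  by rewrite andbF.
rewrite -big_split; apply: eq_bigr => a pa /=.
rewrite (Xfun_step kappa0 pa lamE (Xd a pa)) /c.
apply: (congr1 (fun y : C => y * _)); case: ifP => // ac.
rewrite /detB (Bop_det (posroot_neq pa) bv) //.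
exact: (half_unshift_neq0 kappa0 pa lamE (Xd a pa) ac).
Qed.

Lemma X_defined_down (m : 'I_r) (lam lam' : 'M[C]_N) :
  lam' = lam + kappa *: coweight C m -> X_defined lam' -> X_defined lam.
Proof. by move=> lamE Xd a pa; exact: (Xfun_defined_down kappa0 pa lamE (Xd a pa)). Qed.

Lemma Bword_defined_down (m : 'I_r) (lam lam' : 'M[C]_N) s :
  lam' = lam + kappa *: coweight C m -> reduced_word (w_bracket m) s ->
  X_defined lam' -> Bword_defined V nu lam s.
Proof.
move=> lamE sP Xd a; rewrite (perm_mem (w_bracket_word_roots sP)) mem_enum inE => ac.
have pa : posroot a by case/andP: ac => h1 h2; exact: leq_ltn_trans h1 h2.
apply: (Bop_definedP (posroot_neq pa)).
exact: (half_unshift_neq0 kappa0 pa lamE (Xd a pa) ac).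
Qed.

Lemma pole_bound (z : C) : exists K, forall b, (K <= b)%N -> ~ Gamma_pole (z + b%:R).
Proof.
have [[m zm]|np] := pselect (Gamma_pole z); last by exists 0%N => b _; exact: pole_natr.
exists m.+1 => b mb [m' e].
have : (b + m')%:R = m%:R :> C.
  apply/eqP; rewrite -subr_eq0 natrD -[m%:R]opprK -zm opprK addrAC [_ + z]addrC.
  by rewrite e addNr.
by move/eqP; rewrite eqr_nat => /eqP; lia.
Qed.

Local Notation cw c := (\sum_(i < r) (c i)%:R *: coweight C i).

Lemma gform_cw (c : 'I_r -> nat) a : posroot a ->
  gform (cw c) (rootH C a) = (\sum_i c i * ((a.1 <= i) && (i < a.2)))%N%:R.
Proof.
move=> pa; rewrite natr_sum.
apply: (big_rec2 (fun A y => gform A (rootH C a) = y)).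
  by rewrite /gform mul0mx mxtrace0.
by move=> i y A _ <-; rewrite gformDl gformZl gform_coweight // natrM.
Qed.

(* Far enough in the direction of the negative chamber no Gamma function in X
   is evaluated at a pole. *)
Lemma X_regular (lam : 'M[C]_N) : exists K : nat,
  X_defined (lam - kappa *: cw (fun=> K)) /\
  X_product (lam - kappa *: cw (fun=> K)) != 0.
Proof.
have /choice[Kn KnP] (p : slroot r * nat) := pole_bound (X_num kappa nu p.1 lam p.2).
have /choice[Kd KdP] (p : slroot r * nat) := pole_bound (X_den kappa nu p.1 lam p.2).
pose D := \dim {: tensor}.
(* A single bound that serves all roots and all relevant [j]. *)
pose K := (\sum_(a : 'I_N * 'I_N) \sum_(j < D) (Kn (a, val j) + Kd (a, val j)))%N.
exists K; set lam' := lam - _.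
have bound (a : slroot r) (j : nat) : (j < D)%N -> (Kn (a, j) + Kd (a, j) <= K)%N.
  move=> jD; rewrite /K (bigD1 a) //= (bigD1 (Ordinal jD)) //=.
  by rewrite -!addnA !leq_add2l leq_addr.
(* A positive root pairs to 1 with the fundamental coweight of index [a.1], so [K] times the sum of
   all of them pairs with it to at least [K]. *)
have shiftE (a : slroot r) : posroot a -> exists2 b, (K <= b)%N &
    gform lam' (rootH C a) = gform lam (rootH C a) - kappa * b%:R.
  move=> pa; exists (\sum_(i < r) K * ((a.1 <= i) && (i < a.2)))%N.
    have ar : (a.1 < r)%N by apply: leq_trans (pa : (a.1 < a.2)%N) _; rewrite -ltnS ltn_ord.
    by rewrite (bigD1 (Ordinal ar)) //= leqnn (pa : (a.1 < a.2)%N) muln1 leq_addr.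
  by rewrite /lam' gformBl gformZl gform_cw.
clearbody lam'.
have abs (F : fieldType) (l k b y : F) : k != 0 ->
    1 - (l - k * b + y) / k = 1 - (l + y) / k + b by move=> ?; field.
have num_np (a : slroot r) (j : nat) : posroot a -> (j < D)%N ->
    ~ Gamma_pole (X_num kappa nu a lam' j).
  move=> pa jD; have [b Kb e] := shiftE a pa.
  have -> : X_num kappa nu a lam' j = X_num kappa nu a lam j + b%:R.
    by rewrite /X_num !gformBl e; exact: abs.
  by apply: (KnP (a, j)); apply: leq_trans Kb; apply: leq_trans (bound a j jD); rewrite leq_addr.
have den_np (a : slroot r) (j : nat) : posroot a -> (j < D)%N ->
    ~ Gamma_pole (X_den kappa nu a lam' j).
  move=> pa jD; have [b Kb e] := shiftE a pa.
  have -> : X_den kappa nu a lam' j = X_den kappa nu a lam j + b%:R.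
    by rewrite /X_den !gformDl e; exact: abs.
  by apply: (KdP (a, j)); apply: leq_trans Kb; apply: leq_trans (bound a j jD); rewrite leq_addl.
split=> [a pa k j _ /andP[_ jk]|]; first exact: num_np pa (leq_ltn_trans jk (ltn_ord k)).
apply/prodf_neq0 => a pa; apply/prodf_neq0 => k _; apply: expf_neq0.
rewrite prodf_seq_neq0; apply/allP => j; rewrite mem_index_iota ltnS => /andP[_ jk].
have jD : (j < D)%N := leq_ltn_trans jk (ltn_ord k).
by rewrite mulf_neq0 ?invr_eq0 // Gamma_neq0 //; [exact: num_np|exact: den_np].
Qed.

End Determinant.

(** * Comparison of [det(u)] and [D] on a coset of [kappa P^vee] *)

Section Solutions.
Variables (R : realType) (r n : nat) (V : 'I_n -> slMod (CC R) r).
Local Notation C := (CC R).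
Local Notation N := r.+1.
Local Notation tensor := (tensor V).
Variables (kappa : C) (kappa0 : kappa != 0) (x : 'I_r -> 'M[C]_N) (nu : 'M[C]_N).
Local Notation W := (wspace V nu).
Variables (logz : 'I_n -> 'rV[C]_n -> C) (logd : 'I_n -> 'I_n -> 'rV[C]_n -> C).
Variables (d : nat) (v : d.-tuple tensor) (bv : basis_of W v).
Variables (U : set 'rV[C]_n) (L : set 'M[C]_N).
Variable u : 'I_d -> 'I_d -> 'rV[C]_n -> 'M[C]_N -> C.
Hypothesis L_cartan : forall lam, L lam -> cartan lam.
Hypothesis L_shift : forall lam om, L lam -> coweight_lattice om ->
  L (lam + kappa *: om).
Variable word : 'I_r -> seq 'I_r.
Hypothesis word_reduced : forall i, reduced_word (w_bracket i) (word i).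
Hypothesis u_dyn : forall (i : 'I_d) (m : 'I_r) lam z, L lam -> U z ->
  Bword_defined V nu lam (word m) ->
  \sum_j u i j z (lam + kappa *: coweight C m) *: v`_j
  = zpow_op (coweight C m) (fun k => logz k z)
      (Bword nu lam (word m) (\sum_j u i j z lam *: v`_j)).

Local Notation detu z lam := (\det (\matrix_(i < d, j < d) u i j z lam)).
Local Notation Dz := (Dz V kappa x nu logz logd).
Local Notation X_defined := (X_defined V kappa nu).

(** The factor is the determinant on [V[nu]] of the operator in the dynamical equation. Definedness
    is asked at the upper point: it makes [B] defined at the lower one, where the equation for [u]
    is used. *)
Lemma determinant_step (m : 'I_r) (lam lam' : 'M[C]_N) z : L lam -> U z ->
  lam' = lam + kappa *: coweight C m -> X_defined lam' ->
  exists rho : C, detu z lam' = rho * detu z lam /\ Dz z lam' = rho * Dz z lam.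
Proof.
move=> Llam Uz lamE Xd; have lc := L_cartan Llam.
have mc := coweight_cartan C m.
pose B : {linear tensor -> tensor} := Broots nu lam (word_roots (word m)).
pose Z : {linear tensor -> tensor} := zpow_op (coweight C m) (fun k => logz k z).
have BW w : w \in W -> B w \in W.
  apply: Broots_wspace => a.
  rewrite (perm_mem (w_bracket_word_roots (word_reduced m))) mem_enum inE.
  by case/andP=> h1 h2; apply: posroot_neq; exact: leq_ltn_trans h1 h2.
have ZW w : w \in W -> Z w \in W by exact: zpow_op_wspace.
exists (\det (opmx v B) * \det (opmx v Z)); split.
  rewrite -det_mulmx -(opmx_comp bv BW ZW) mulrC -det_mulmx; congr (\det _).
  apply/matrixP => i j; rewrite !mxE.
  have Bd := Bword_defined_down kappa0 lamE (word_reduced m) Xd.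
  have ZBW w : w \in W -> (Z \o B) w \in W by move=> wW; apply/ZW/BW.
  have := u_dyn i Llam Uz Bd; rewrite -lamE.
  have -> : zpow_op (coweight C m) (fun k => logz k z)
      (Bword nu lam (word m) (\sum_j u i j z lam *: v`_j))
      = (Z \o B) (\sum_j u i j z lam *: v`_j) by [].
  rewrite (opmx_sum bv _ ZBW) => /(congr1 (coord v j)).
  rewrite !coord_sum_free ?(basis_free bv) // => ->.
  by apply: eq_bigr => l _; rewrite [X in _ = X * _]mxE.
rewrite !DzE (X_product_step kappa0 lamE bv (word_reduced m) Xd).
rewrite [in LHS]lamE kz_exponent_shift // expCD expC_sum -(zpow_op_det _ mc bv).
have abs (K : comNzRingType) (e zt b p : K) : e * zt * (b * p) = b * zt * (e * p) by ring.
exact: abs.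
Qed.

(** Definedness is inherited downwards, so every intermediate point admits the single step. *)
Lemma determinant_descent (s : seq 'I_r) (lam lam' : 'M[C]_N) z : L lam -> U z ->
  lam = lam' + kappa *: (\sum_(i <- s) coweight C i) -> X_defined lam ->
  exists rho : C, detu z lam = rho * detu z lam' /\ Dz z lam = rho * Dz z lam'.
Proof.
move=> + Uz; elim: s lam => [|m s IH] lam Llam lamE Xd.
  by exists 1; rewrite !mul1r lamE big_nil scaler0 addr0.
pose lam1 : 'M[C]_N := lam - kappa *: coweight C m.
have lam1E : lam = lam1 + kappa *: coweight C m by rewrite subrK.
have L1 : L lam1.
  rewrite /lam1 -scalerN; apply: L_shift => //; apply: coweight_latticeN.
  by have := coweight_lattice_seq C [:: m]; rewrite big_seq1.
have lam1E' : lam1 = lam' + kappa *: \sum_(i <- s) coweight C i.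
  by rewrite /lam1 lamE big_cons scalerDr [_ *: coweight C m + _]addrC addrA addrK.
have Xd1 : X_defined lam1 by exact: (X_defined_down kappa0 lam1E Xd).
have [rho [h1 h2]] := IH lam1 L1 lam1E' Xd1.
have [rho' [h1' h2']] := determinant_step L1 Uz lam1E Xd.
by exists (rho' * rho); rewrite h1' h1 h2' h2 !mulrA.
Qed.

Hypothesis u_kz : forall lam, L lam -> exists c : C, forall z, U z ->
  detu z lam = c * expC (kz_exponent V x nu kappa lam logz logd z).

(* The step from lam to lam + kappa om is only available when om is a sum of
   fundamental coweights; lam' is therefore compared with a base point lam0
   through a point far below both. *)
Lemma determinant_constant lam : L lam -> exists c : C, forall z lam', U z ->
  L lam' -> X_defined lam' ->
  (exists2 om, coweight_lattice om & lam' = lam + kappa *: om) ->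
  detu z lam' = c * Dz z lam'.
Proof.
move=> Llam; have [K] := X_regular V kappa0 nu lam.
have [om0 om0E] : exists om, om = \sum_(i < r) K%:R *: coweight C i by eexists.
rewrite -om0E; set lam0 := lam - _; move=> [Xd X0].
have om0P : coweight_lattice om0.
  have [s sE] := @coweight_multiset C r (fun=> K).
  by rewrite om0E -sE; exact: coweight_lattice_seq.
have L0 : L lam0.
  by rewrite /lam0 -scalerN; apply: L_shift => //; exact: coweight_latticeN.
have [c cE] := u_kz L0; exists (c / X_product V kappa nu lam0).
move=> z lam' Uz L' Xd' [_ [a ->] lamE].
(* Both families of coefficients, [|a| + K] and [|a| - a], are nonnegative, so [lam2] lies below
   [lam'] and below [lam0]; the two descents end at the same point because
   [a - (|a| + K) + (|a| - a) = - K]. *)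
have [s sE] := coweight_multiset C (fun i => `|a i| + K)%N.
have [t tE] := coweight_multiset C (fun i => `|(`|a i| - a i)%R|)%N.
pose lam2 := lam' - kappa *: \sum_(i <- s) coweight C i.
have lam'2 : lam' = lam2 + kappa *: \sum_(i <- s) coweight C i by rewrite subrK.
have lam02 : lam0 = lam2 + kappa *: \sum_(i <- t) coweight C i.
  rewrite /lam2 /lam0 lamE -!addrA; congr (_ + _).
  rewrite -!scalerN -!scalerDr; congr (_ *: _).
  rewrite sE tE om0E -!sumrN -!big_split; apply: eq_bigr => i _ /=.
  rewrite -!scaleNr -!scalerDl; congr (_ *: _).
  have h : (`|(`|a i| - a i)%R|%N)%:R = (`|a i| - a i)%:~R :> C.
    by rewrite natr_absz ger0_norm // subr_ge0 ler_norm.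
  rewrite h rmorphB natrD natr_absz /=.
  have abs (K0 : comNzRingType) (p q k : K0) : - k = p + (- (q + k) + (q - p)) by ring.
  exact: abs.
have [rho [h1 h2]] := determinant_descent L' Uz lam'2 Xd'.
have [rho' [h1' h2']] := determinant_descent L0 Uz lam02 Xd.
have h0 : detu z lam0 = c / X_product V kappa nu lam0 * Dz z lam0.
  have abs (F : fieldType) (p e q : F) : q != 0 -> p * e = p / q * (e * q).
    by move=> q0; field.
  rewrite DzE; apply: etrans (cE z Uz) _; exact: abs.
(* [D] is nonzero at [lam0]; division by [rho'] carries the relation from [lam0] down to [lam2], and
   [rho] carries it up to [lam']. *)
have rho0 : rho' != 0.
  apply: contraNneq X0 => rho0; have := h2'; rewrite rho0 mul0r DzE => /eqP.
  by rewrite mulf_eq0 (negbTE (expC_neq0 _)).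
rewrite h1 h2 mulrCA; apply: (congr1 (fun y : C => rho * y)).
apply: (mulfI rho0); rewrite -h1' h0 h2'.
exact: mulrCA.
Qed.

End Solutions.

Theorem corollary19 (R : realType) (r n : nat) (V : 'I_n -> slMod (CC R) r)
  (kappa : CC R) (kappa_neq0 : kappa != 0)
  (x : 'I_r -> 'M[CC R]_r.+1) (x_onb : orthonormal_basis x)
  (nu : 'M[CC R]_r.+1) (nu_cartan : cartan nu)
  (d : nat) (v : d.-tuple (tensor V)) (v_basis : basis_of (wspace V nu) v)
  (* the domain in z and the branches of the logarithms *)
  (U : set 'rV[CC R]_n) (U_open : open U) (U_connected : connected U)
  (U_simply_connected : simply_connected U) (U_config : U `<=` @config_space R n)
  (logz : 'I_n -> 'rV[CC R]_n -> CC R)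
  (logz_branch : forall k, log_branch U (fun z => z 0 k) (logz k))
  (logd : 'I_n -> 'I_n -> 'rV[CC R]_n -> CC R)
  (logd_branch : forall k l : 'I_n, (k < l)%N ->
     log_branch U (fun z => z 0 k - z 0 l) (logd k l))
  (* reduced presentations of the w_[i] *)
  (word : 'I_r -> seq 'I_r)
  (word_reduced : forall i, reduced_word (w_bracket i) (word i))
  (* the values of lambda at which the solutions are defined *)
  (L : set 'M[CC R]_r.+1) (L_cartan : forall lam, L lam -> cartan lam)
  (L_shift : forall lam om, L lam -> coweight_lattice om -> L (lam + kappa *: om))
  (u : 'I_d -> 'I_d -> 'rV[CC R]_n -> 'M[CC R]_r.+1 -> CC R)
  (u_kz : forall i lam, L lam ->
     kz_solution x lam kappa U (fun z => \sum_j u i j z lam *: v`_j))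
  (u_dyn : forall (i : 'I_d) (m : 'I_r) lam z, L lam -> U z ->
     Bword_defined V nu lam (word m) ->
     \sum_j u i j z (lam + kappa *: coweight (CC R) m) *: v`_j
     = zpow_op (coweight (CC R) m) (fun k => logz k z)
         (Bword nu lam (word m) (\sum_j u i j z lam *: v`_j))) :
  exists Cf : 'M[CC R]_r.+1 -> CC R,
    (forall lam om, cartan lam -> coweight_lattice om ->
       Cf (lam + kappa *: om) = Cf lam) /\
    (forall z lam, U z -> L lam ->
       (forall a, posroot a -> Xfun_defined V kappa nu a lam) ->
       \det (\matrix_(i < d, j < d) u i j z lam)
       = Cf lam * Dfun V kappa nu x (fun k => logz k z)
                    (fun k l => logd k l z) lam).
Proof.
have [xc _ _] := x_onb.
have det_kz lam : L lam -> exists c : CC R, forall z, U z ->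
    \det (\matrix_(i < d, j < d) u i j z lam)
    = c * expC (kz_exponent V x nu kappa lam logz logd z).
  (* [U] may be empty, in which case any constant serves. *)
  move=> Llam; have [[z0 Uz0]|U0] := pselect (exists z, U z); last first.
    by exists 0 => z Uz; case: U0; exists z.
  have cst := kz_det_const xc kappa_neq0 (L_cartan _ Llam) U_config v_basis
    (fun i => u_kz i lam Llam) U_open U_connected logz_branch logd_branch.
  exists (\det (\matrix_(i < d, j < d) u i j z0 lam)
    * expC (- kz_exponent V x nu kappa lam logz logd z0)) => z Uz.
  by rewrite -(cst z0 z Uz0 Uz) -mulrA -expCD addNr expC0 mulr1.
(* The constants that fit all regular points of the coset of [lam]. This set depends on the coset
   only, so choosing from it gives a periodic function, also outside [L]. *)
pose good lam := [set c : CC R | forall z lam', U z -> L lam' ->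
  X_defined V kappa nu lam' ->
  (exists2 om, coweight_lattice om & lam' = lam + kappa *: om) ->
  \det (\matrix_(i < d, j < d) u i j z lam')
  = c * Dz V kappa x nu logz logd z lam'].
exists (fun lam => xget 0 (good lam)); split=> [lam om _ omP|z lam Uz Llam Xd].
  congr (xget 0 _); apply/seteqP; split=> c cP z lam' Uz L' Xd' [om' om'P lamE].
    apply: cP => //; exists (om' - om).
      by apply: coweight_latticeD => //; exact: coweight_latticeN.
    by rewrite -addrA -scalerDr addrCA subrr addr0.
  apply: cP => //; exists (om + om'); first exact: coweight_latticeD.
  by rewrite scalerDr addrA.
have [c cP] := determinant_constant kappa_neq0 v_basis L_cartan L_shift
  word_reduced u_dyn det_kz Llam.
apply: (@xgetPex _ 0 (good lam)); [by exists c| | | |] => //.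
by exists 0; [exact: coweight_lattice0|rewrite scaler0 addr0].
Qed.
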